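(* Let $(A,\Delta)$ be a reduced compact quantum group, $\alpha\colon B\to A\otimes B$ a non-degenerate left coaction on a unital C$^*$-algebra $B$, and $\mathcal B=B\triangleleft\hat{\mathcal A}$. Let $(\pi,H,F,\gamma,U)$ be a $(2n+1)$-summable $\alpha$-equivariant even Fredholm module over $\mathcal B$, with cyclic cocycle $\phi_F$, and let $p\in\mathcal B$ be an $\hat{\mathcal A}$-invariant projection. Then for all $\omega\in\hat{\mathcal A}$ $$(\mathrm{Ind}_F\,p)(\omega)=\langle[\phi_F],[p]\rangle(\omega),$$ i.e. $(\mathrm{Ind}_F\,p)(\omega)=\phi_F(\omega\otimes p\otimes\dots\otimes p)$ (with $2n+1$ copies of $p$).
   Context: Compact quantum group (Woronowicz): a unital C$^*$-algebra $A$ with coassociative unital $*$-homomorphism $\Delta\colon A\to A\otimes A$ such that $\Delta(A)(A\otimes1)$ and $\Delta(A)(1\otimes A)$ are dense in $A\otimes A$; $\varphi$ is its Haar state; reduced means $\varphi$ is faithful. $\mathcal A\subset A$ is the dense Hopf $*$-algebra of matrix coefficients of irreducible unitary corepresentations. A unitary corepresentation on $H$ is a unitary $U\in M(A\otimes K(H))$ with $(\Delta\otimes\iota)(U)=U_{13}U_{23}$. $\hat{\mathcal A}$ is the algebra of bounded functionals on $A$ of the form $\varphi(a\,\cdot)$, $a\in\mathcal A$, with product $\omega\eta=(\omega\otimes\eta)\Delta$; $\hat{\mathcal A}\cong\bigoplus_sB(H_s)$ (algebraic direct sum over classes of irreducible unitary corepresentations). Coaction: a unital $*$-homomorphism $\alpha$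 with $(\Delta\otimes\iota)\alpha=(\iota\otimes\alpha)\alpha$; non-degenerate: $(A\otimes1)\alpha(B)$ is dense in $A\otimes B$. $\hat{\mathcal A}$ acts on $B$ from the right by $b\triangleleft\omega=(\omega\otimes\iota)\alpha(b)$; $\mathcal B=B\triangleleft\hat{\mathcal A}$ is a dense unital $*$-subalgebra of $B$. An element $p\in\mathcal B$ is $\hat{\mathcal A}$-invariant if $p\triangleleft\omega=\omega(1)p$ for all $\omega$ (equivalently $\alpha(p)=1\otimes p$); a projection is a self-adjoint idempotent. $\alpha$-equivariant even Fredholm module over $\mathcal B$: $\pi$ is a bounded $*$-representation of $\mathcal B$ on a graded Hilbert space $H=H_-\oplus H_+$; $F=F^*$, $F^2=1$; $\gamma=\begin{pmatrix}-1&0\\0&1\end{pmatrix}$ is the grading operator, $F$ is odd and all $\pi(b)$ are even; $[F,\pi(b)]$ is compact for all $b\in\mathcal B$; $U\in M(A\otimes K(H))$ is a unitary corepresentation commuting with $1\otimes F$ and $1\otimes\gamma$ and satisfying $U(\iota\otimes\pi)\alpha(b)=(1\otimes\pi(b))U$ for $b\in\mathcal B$. $\pi_U(\omega)=(\omega\otimes\iota)(U)$ is the associated $*$-representation of $\hat{\mathcal A}$ on $H$. The module is $(2n+1)$-summable if $[F,\pi(b)]\in\mathcal L^{2n+1}(H)$ (Schatten class) for all $b\in\mathcal B$. Then $$\phi_F(\omega\otimes b_0\otimes\dots\otimes b_{2n})=\frac{(-1)^n}{2}\mathrm{Tr}\big(\gamma\pi_U(\omega)F[F,\pi(b_0)]\cdots[F,\pi(b_{2n})]\big),$$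 an equivariant cyclic $2n$-cocycle on $\mathcal B$. The pairing of the class of an equivariant cyclic $2n$-cocycle $f$ with the equivariant $K_0$-class of an invariant idempotent $p\in\mathcal B$ is the functional $\langle[f],[p]\rangle(\omega)=f(\omega\otimes p\otimes\dots\otimes p)$ on $\hat{\mathcal A}$. Equivariant index: put $p_+=\frac12(1+\gamma)\pi(p)$ and $p_-=\frac12(1-\gamma)\pi(p)$. Then $p_-Fp_+\colon p_+H_+\to p_-H_-$ is a Fredholm operator, and the finite dimensional spaces $\mathrm{Ker}(p_-Fp_+)\subset p_+H_+$ and $\mathrm{Im}(p_-Fp_+)^\perp\subset p_-H_-$ are invariant under $\pi_U(\hat{\mathcal A})$. Let $\tilde\pi_+$, $\tilde\pi_-$ be the restrictions of $\pi_U$ to these two spaces respectively, and set $$(\mathrm{Ind}_F\,p)(\omega)=\mathrm{Tr}(\tilde\pi_+(\omega))-\mathrm{Tr}(\tilde\pi_-(\omega)).$$ *)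

(* Defs.v *)
From HB Require Import structures.
From mathcomp Require Import all_boot all_order all_algebra finmap.
From mathcomp Require Import boolp classical_sets functions reals filter.
From mathcomp Require Import topology tvs normedtype sequences.
From mathcomp Require Import complex ring lra.

Set Implicit Arguments.
Unset Strict Implicit.
Unset Printing Implicit Defensive.

Import Order.TTheory GRing.Theory Num.Theory.
Import numFieldNormedType.Exports.

Local Open Scope classical_set_scope.
Local Open Scope ring_scope.

(* The norm of a normed module over R[i] takes its values in R[i].  The inner *)
(* product is linear in its first argument.                                   *)
HB.mixin Record isHilbert (R : realType) H & CompleteNormedModule R[i] H := {
  inner : H -> H -> R[i];
  inner_scalar : forall y : H, scalar (inner^~ y);
  innerC : forall x y : H, inner y x = (inner x y)^*;
  norm_inner : forall x : H, `|x| ^+ 2 = inner x x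
}.

#[short(type="hilbertType")]
HB.structure Definition Hilbert (R : realType) :=
  {H of CompleteNormedModule R[i] H & isHilbert R H}.

Reserved Notation "x ⋅ y" (at level 40, left associativity).

(* Unital C*-algebras, including the zero algebra.  The product is not a ring *)
(* structure of the library: Num.NumDomain, declared before, would have to    *)
(* inherit from the join of that structure with the norm.                     *)
HB.mixin Record isCStarAlgebra (R : realType) A & CompleteNormedModule R[i] A := {
  cmul : A -> A -> A;
  cone : A;
  star : A -> A;
  cmulA : associative cmul;
  cmul1l : left_id cone cmul;
  cmul1r : right_id cone cmul;
  cmulDl : left_distributive cmul +%R;
  cmulDr : right_distributive cmul +%R;
  cmulZl : forall (c : R[i]) (x y : A), cmul (c *: x) y = c *: cmul x y;
  cmulZr : forall (c : R[i]) (x y : A), cmul x (c *: y) = c *: cmul x y;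
  starK : involutive star;
  starD : {morph star : x y / x + y};
  starZ : forall (c : R[i]) (x : A), star (c *: x) = c^* *: star x;
  starM : forall x y : A, star (cmul x y) = cmul (star y) (star x);
  cnormM : forall x y : A, `|cmul x y| <= `|x| * `|y|;
  cnorm_star : forall x : A, `|cmul (star x) x| = `|x| ^+ 2
}.

#[short(type="cstarAlgType")]
HB.structure Definition CStarAlgebra (R : realType) :=
  {A of CompleteNormedModule R[i] A & isCStarAlgebra R A}.

Notation "x ⋅ y" := (cmul x y) : ring_scope.

Section InnerTheory.
Variables (R : realType) (H : hilbertType R).
Implicit Types (x y z : H) (c : R[i]).

Lemma innerDl x y z : inner (x + y) z = inner x z + inner y z.
Proof. by have := inner_scalar z 1 x y; rewrite scale1r mul1r. Qed.

Lemma inner0l z : inner 0 z = 0 :> R[i].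
Proof. by apply: (addrI (inner 0 z)); rewrite -innerDl !addr0. Qed.

Lemma innerZl c x z : inner (c *: x) z = c * inner x z.
Proof. by have := inner_scalar z c x 0; rewrite !addr0 inner0l addr0. Qed.

Lemma innerNl x z : inner (- x) z = - inner x z.
Proof. by rewrite -scaleN1r innerZl mulN1r. Qed.

Lemma innerBl x y z : inner (x - y) z = inner x z - inner y z.
Proof. by rewrite innerDl innerNl. Qed.

Lemma innerDr x y z : inner z (x + y) = inner z x + inner z y.
Proof. by rewrite !(innerC _ z) innerDl rmorphD. Qed.

Lemma innerZr c x z : inner z (c *: x) = c^* * inner z x.
Proof. by rewrite !(innerC _ z) innerZl rmorphM. Qed.

Lemma innerNr x z : inner z (- x) = - inner z x.
Proof. by rewrite !(innerC _ z) innerNl rmorphN. Qed.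

Lemma innerBr x y z : inner z (x - y) = inner z x - inner z y.
Proof. by rewrite innerDr innerNr. Qed.

Lemma inner_inj x y : (forall z, inner z x = inner z y) -> x = y.
Proof.
move=> h; apply/eqP; rewrite -subr_eq0 -normr_eq0 -sqrf_eq0 norm_inner.
by rewrite innerBr h subrr.
Qed.

Lemma CauchySchwarz x y : `|inner x y| <= `|x| * `|y|.
Proof.
have [->|y0] := eqVneq y 0.
  by rewrite (innerC 0 x) inner0l rmorph0 !normr0 mulr0.
have yy0 : 0 < inner y y by rewrite -norm_inner exprn_gt0 // normr_gt0.
rewrite -(@ler_pXn2r _ 2) ?nnegrE ?mulr_ge0 // exprMn !norm_inner.
rewrite -ler_pdivrMr //.
have : 0 <= inner (x - (inner x y / inner y y) *: y)
                  (x - (inner x y / inner y y) *: y).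
  by rewrite -norm_inner exprn_ge0.
rewrite !(innerBl, innerBr, innerZl, innerZr) rmorphM fmorphV /=.
rewrite (_ : (inner y y)^* = inner y y) -?innerC //.
rewrite normCK (_ : (inner x y)^* = inner y x) -?innerC //.
move: (inner x x) (inner x y) (inner y x) (inner y y) yy0 => a b c d d0.
have dn : d != 0 by rewrite gt_eqF.
by rewrite (_ : a - _ - _ = a - b * c / d) ?subr_ge0 //; field.
Qed.

End InnerTheory.

Local Open Scope complex_scope.

Section Riesz.
Variables (R : realType) (H : hilbertType R) (g : H -> R[i]) (M : R).
Hypotheses (gl : scalar g) (gM : forall x, `|g x| <= M%:C * `|x|).

Local Notation nr x := (complex.Re `|x|).
Local Notation Re := complex.Re.

Let nrE (x : H) : `|x| = (nr x)%:C.
Proof. by rewrite RRe_real // ger0_real. Qed.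

Let nr_ge0 (x : H) : 0 <= nr x.
Proof. by rewrite -ler0c -nrE. Qed.

Let nr2 (x : H) : nr x ^+ 2 = Re (inner x x).
Proof. by rewrite -norm_inner nrE -rmorphXn. Qed.

Let ReD (a b : R[i]) : Re (a + b) = Re a + Re b. Proof. by case: a b => ? ? []. Qed.
Let ReN (a : R[i]) : Re (- a) = - Re a. Proof. by case: a. Qed.
Let ReZ (t : R) (a : R[i]) : Re (t%:C * a) = t * Re a.
Proof. by case: a => ? ? /=; rewrite mul0r subr0. Qed.
Let ReJ (a : R[i]) : Re (a^*)%R = Re a. Proof. by case: a. Qed.
Let Re_norm (a : R[i]) (t : R) : `|a| <= t%:C -> `|Re a| <= t.
Proof.
move=> h; rewrite -lecR; apply: le_trans h.
case: a => x y; rewrite normc_def lecR /= -sqrtr_sqr ler_wsqrtr //.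
by rewrite lerDl sqr_ge0.
Qed.

Let gZ (t : R) x y : Re (g (x + t%:C *: y)) = Re (g x) + t * Re (g y).
Proof. by rewrite addrC gl ReD ReZ addrC. Qed.

Let nrDZ (t : R) (x y : H) :
  nr (x + t%:C *: y) ^+ 2 = nr x ^+ 2 + 2 * t * Re (inner y x) + t ^+ 2 * nr y ^+ 2.
Proof.
rewrite !nr2 !(innerDl, innerDr, innerZl, innerZr) (innerC y x) !ReD /=.
have -> : (t%:C^*)%R = t%:C by rewrite -[LHS]/(conjc _) conjc_real.
by rewrite !ReZ ReJ; ring.
Qed.

Let J (x : H) := nr x ^+ 2 - 2 * Re (g x).

Let JDZ (t : R) x y : J (x + t%:C *: y) =
  J x + 2 * t * (Re (inner y x) - Re (g y)) + t ^+ 2 * nr y ^+ 2.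
Proof. by rewrite /J nrDZ gZ; ring. Qed.

Let J_lb (x : H) : - M ^+ 2 <= J x.
Proof.
have h : `|Re (g x)| <= M * nr x by apply: Re_norm; rewrite rmorphM /= -nrE.
have := ler_norm (Re (g x)); have := sqr_ge0 (nr x - M); rewrite /J; nra.
Qed.

Let d := inf (range J).

Let d_le x : d <= J x.
Proof.
apply: ge_inf; last by exists x.
by exists (- M ^+ 2) => _ [y _ <-]; exact: J_lb.
Qed.

Let d_ex (e : R) : 0 < e -> exists x, J x < d + e.
Proof.
move=> e0; have [|_ [x _ <-] h] := @inf_adherent _ (range J) e e0; last by exists x.
split; first by exists (J 0); exists 0.
by exists (- M ^+ 2) => _ [y _ <-]; exact: J_lb.
Qed.

Let J_par x y : nr (x - y) ^+ 2 <= 2 * (J x - d) + 2 * (J y - d).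
Proof.
have := JDZ 1 x (y - x); have := JDZ 2^-1 x (y - x).
rewrite rmorph1 scale1r subrKC => h1 h2.
by have := d_le (x + (2^-1)%:C *: (y - x)); rewrite h1 (distrC x y); nra.
Qed.

Let Fm := filter_from [set e : R | 0 < e] (fun e => [set x | J x < d + e]).

Let Fm_proper : ProperFilter Fm.
Proof.
apply: filter_from_proper; last by move=> e /d_ex.
apply: filter_from_filter; first by exists 1 => /=.
move=> e1 e2 /= e10 e20; exists (Num.min e1 e2) => /=; first by rewrite lt_min e10.
move=> x /= h; split; apply: lt_le_trans h _; rewrite lerD2l ge_min lexx ?orbT //.
Qed.

Let lt0cE (e : R[i]) : 0 < e -> e = (Re e)%:C /\ 0 < Re e.
Proof. by rewrite ltcE => /andP[/eqP /= h1 h2]; split=> //; case: e h1 {h2} => a b /= ->. Qed.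

Let Fm_cvg : cvg Fm.
Proof.
have FF : ProperFilter Fm := Fm_proper.
apply: (@cauchy_cvg _ Fm Fm_proper); apply/(cauchy_ballP Fm) => e /lt0cE[eE e0].
exists ([set x | J x < d + Re e ^+ 2 / 4], [set x | J x < d + Re e ^+ 2 / 4]).
  by split; exists (Re e ^+ 2 / 4) => //=; rewrite divr_gt0 ?exprn_gt0.
move=> [x y] [/= hx hy]; rewrite -ball_normE /= nrE eE ltcR.
rewrite -(@ltr_pXn2r _ 2) ?nnegrE ?nr_ge0 ?(ltW e0) //.
apply: le_lt_trans (J_par x y) _; lra.
Qed.

Let x0 := lim Fm.

Let g0 : g 0 = 0.
Proof. by have := gl (-1) 0 0; rewrite scaler0 addr0 mulN1r addNr. Qed.

Let var (x z : H) (e : R) : J x < d + e ->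
  (Re (inner z x) - Re (g z)) ^+ 2 <= e * nr z ^+ 2.
Proof.
move=> hx; set r := _ - _.
have h t : 0 <= e + 2 * t * r + t ^+ 2 * nr z ^+ 2.
  by have := d_le (x + t%:C *: z); rewrite JDZ -/r; lra.
have [z0|z0] := eqVneq (nr z) 0.
  have : z = 0 by apply/eqP; rewrite -normr_eq0 nrE z0.
  by move=> zE; rewrite /r zE inner0l g0 normr0 subrr expr0n /= mulr0.
have zp : 0 < nr z ^+ 2 by rewrite exprn_even_gt0.
have := h (- r / nr z ^+ 2).
rewrite (_ : _ + _ = e - r ^+ 2 / nr z ^+ 2); last by field.
by rewrite subr_ge0 ler_pdivrMr.
Qed.

Let x0P z : Re (inner z x0) = Re (g z).
Proof.
have FF : ProperFilter Fm := Fm_proper.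
apply/eqP; rewrite -subr_eq0; apply/negPn/negP => r0.
set r := _ - _ in r0.
have rp : 0 < `|r| by rewrite normr_gt0.
pose k := nr z + 1.
have kp : 0 < k by rewrite /k ltr_wpDl.
pose e := `|r| / (2 * k); have ep : 0 < e by rewrite divr_gt0 // mulr_gt0.
have Fd : Fm [set x | J x < d + e ^+ 2] by exists (e ^+ 2) => //=; rewrite exprn_gt0.
have /(@cvgrPdist_lt _ _ _ Fm _ id) /(_ e%:C) : Fm --> x0 by exact: Fm_cvg.
rewrite ltcR => /(_ ep) Fb.
have [x [/= hx hb]] := filter_ex (filterI Fd Fb).
have h1 := var z hx.
have h2 : `|Re (inner z (x0 - x))| <= nr z * nr (x0 - x).
  by apply: Re_norm; rewrite rmorphM /= -!nrE; exact: CauchySchwarz.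
move: h2; rewrite innerBr ReD ReN.
have {}hb : nr (x0 - x) < e by rewrite -ltcR -nrE; exact: hb.
have h3 : `|Re (inner z x) - Re (g z)| <= e * nr z.
  have he : 0 <= e * nr z by exact: mulr_ge0 (ltW ep) (nr_ge0 z).
  rewrite -(@ler_pXn2r _ 2) ?nnegrE //.
  by rewrite exprMn real_normK ?num_real.
move=> h2.
have h4 : `|r| <= nr z * nr (x0 - x) + e * nr z.
  rewrite (_ : r = (Re (inner z x0) - Re (inner z x)) + (Re (inner z x) - Re (g z))).
    by apply: le_trans (ler_normD _ _) _; exact: lerD.
  by rewrite /r; ring.
have rE : `|r| = e * (2 * k) by rewrite /e divfK // gt_eqF // mulr_gt0.
have := nr_ge0 z; move: h4 hb ep; rewrite rE /k.
move: (nr z) (nr _) => a b *; nra.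
Qed.

Lemma Riesz : exists y : H, forall z, g z = inner z y.
Proof.
exists x0 => z; have h1 := x0P z; have h2 := x0P ('i *: z).
move: h2; rewrite innerZl; have := gl 'i z 0; rewrite addr0 => ->.
rewrite g0 addr0; move: h1; case: (inner z x0) (g z) => a b [a' b'] /= ->.
by rewrite !mul0r !mul1r !sub0r => /oppr_inj ->.
Qed.

End Riesz.

Definition bounded_linear (R : realType) (H : hilbertType R) (f : H -> H) :=
  linear f /\ exists M : R, forall x, `|f x| <= M%:C * `|x|.

Record bop (R : realType) (H : hilbertType R) :=
  Bop { bop_fun :> H -> H; bop_bounded : bounded_linear bop_fun }.

Section Bop.
Variables (R : realType) (H : hilbertType R).
Implicit Types (x y z : H) (c : R[i]) (S T : bop H).

Lemma bopP S T : (forall x, S x = T x) -> S = T.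
Proof.
case: S T => [f fP] [g gP] /= h; have e : f = g by apply/funext.
by case: _ / e gP => gP; congr Bop; exact: Prop_irrelevance.
Qed.

HB.instance Definition _ := gen_eqMixin (bop H).
HB.instance Definition _ := gen_choiceMixin (bop H).

Lemma bopD T x y : T (x + y) = T x + T y.
Proof. by have := (bop_bounded T).1 1 x y; rewrite !scale1r. Qed.
Lemma bop0 T : T 0 = 0.
Proof. by apply: (addrI (T 0)); rewrite -bopD !addr0. Qed.
Lemma bopZ T c x : T (c *: x) = c *: T x.
Proof. by have := (bop_bounded T).1 c x 0; rewrite !addr0 bop0 addr0. Qed.
Lemma bopN T x : T (- x) = - T x.
Proof. by rewrite -scaleN1r bopZ scaleN1r. Qed.
Lemma bopB T x y : T (x - y) = T x - T y.
Proof. by rewrite bopD bopN. Qed.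

Lemma bop_bound T : exists2 M : R, 0 <= M & forall x, `|T x| <= M%:C * `|x|.
Proof.
have [_ [M hM]] := bop_bounded T; exists (Num.max 0 M).
  by rewrite le_max lexx.
move=> x; apply: le_trans (hM x) _; apply: ler_wpM2r => //.
by rewrite lecR le_max lexx orbT.
Qed.

Lemma bounded_linearZD c S T : bounded_linear (fun x => c *: S x + T x).
Proof.
split=> [a x y|].
  rewrite !bopD !bopZ !scalerDr addrACA; congr (_ + _ + _).
  by rewrite !scalerA mulrC.
have [M M0 hM] := bop_bound S; have [N N0 hN] := bop_bound T.
have cE : (complex.Re `|c|)%:C = `|c| by rewrite RRe_real // ger0_real.
move: (complex.Re `|c|) cE => r cE.
exists (r * M + N) => x; apply: le_trans (ler_normD _ _) _.
rewrite rmorphD rmorphM /= cE mulrDl; apply: lerD => //.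
by rewrite normrZ -mulrA; apply: ler_wpM2l.
Qed.

Lemma bounded_linear0 : bounded_linear (fun=> 0 : H).
Proof. by split=> [a x y|]; [rewrite scaler0 addr0|exists 0 => x; rewrite mul0r normr0]. Qed.

Lemma bounded_linear_id : bounded_linear (id : H -> H).
Proof. by split=> [a x y //|]; exists 1 => x; rewrite mul1r. Qed.

Lemma bounded_linear_comp S T : bounded_linear (S \o T).
Proof.
split=> [a x y|] /=; first by rewrite bopD bopZ bopD bopZ.
have [M M0 hM] := bop_bound S; have [N N0 hN] := bop_bound T.
exists (M * N) => x; apply: le_trans (hM _) _.
by rewrite rmorphM -mulrA; apply: ler_wpM2l (hN x); rewrite ler0c.
Qed.

Definition bop_zero := Bop bounded_linear0.
Definition bop_one := Bop bounded_linear_id.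
Definition bop_comp S T := Bop (bounded_linear_comp S T).
Definition bop_scale c S : bop H := Bop (bounded_linearZD c S bop_zero).
Definition bop_add S T : bop H := Bop (bounded_linearZD 1 S T).

Lemma bop_addE S T x : bop_add S T x = S x + T x.
Proof. by rewrite /= scale1r. Qed.
Lemma bop_scaleE c S x : bop_scale c S x = c *: S x.
Proof. by rewrite /= addr0. Qed.

Lemma bop_addA : associative bop_add.
Proof. by move=> S T U; apply: bopP => x; rewrite !bop_addE addrA. Qed.
Lemma bop_addC : commutative bop_add.
Proof. by move=> S T; apply: bopP => x; rewrite !bop_addE addrC. Qed.
Lemma bop_add0 : left_id bop_zero bop_add.
Proof. by move=> S; apply: bopP => x; rewrite !bop_addE /= add0r. Qed.
Lemma bop_addN : left_inverse bop_zero (bop_scale (-1)) bop_add.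
Proof. by move=> S; apply: bopP => x; rewrite !bop_addE bop_scaleE scaleN1r addNr. Qed.

HB.instance Definition _ :=
  GRing.isZmodule.Build (bop H) bop_addA bop_addC bop_add0 bop_addN.

Lemma bop_scaleA a b S : bop_scale a (bop_scale b S) = bop_scale (a * b) S.
Proof. by apply: bopP => x; rewrite !bop_scaleE scalerA. Qed.
Lemma bop_scale1 : left_id 1 bop_scale.
Proof. by move=> S; apply: bopP => x; rewrite !bop_scaleE scale1r. Qed.
Lemma bop_scaleDr : right_distributive bop_scale +%R.
Proof.
by move=> a S T; apply: bopP => x; rewrite bop_scaleE !bop_addE !bop_scaleE scalerDr.
Qed.
Lemma bop_scaleDl S : {morph bop_scale^~ S : a b / a + b}.
Proof. by move=> a b; apply: bopP => x; rewrite bop_addE !bop_scaleE scalerDl. Qed.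

HB.instance Definition _ := GRing.Zmodule_isLmodule.Build R[i] (bop H)
  bop_scaleA bop_scale1 bop_scaleDr bop_scaleDl.

Lemma bopDE S T x : (S + T) x = S x + T x. Proof. exact: bop_addE. Qed.
Lemma bopZE c T x : (c *: T) x = c *: T x. Proof. exact: bop_scaleE. Qed.
Lemma bopNE T x : (- T) x = - T x.
Proof. by rewrite -scaleN1r bopZE scaleN1r. Qed.
Lemma bopBE S T x : (S - T) x = S x - T x.
Proof. by rewrite bopDE bopNE. Qed.

Definition bop_norm T : R[i] :=
  (inf [set M : R | 0 <= M /\ forall x, `|T x| <= M%:C * `|x|])%:C.

Let normset T := [set M : R | 0 <= M /\ forall x, `|T x| <= M%:C * `|x|].

Let normset_inf T : has_inf (normset T).
Proof.
have [M M0 hM] := bop_bound T; split; first by exists M.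
by exists 0 => ? [].
Qed.

Lemma bop_norm_ge0 T : 0 <= bop_norm T.
Proof.
rewrite ler0c; apply: lb_le_inf; last by move=> ? [].
exact: (normset_inf T).1.
Qed.

Lemma bop_normP T x : `|T x| <= bop_norm T * `|x|.
Proof.
have [->|x0] := eqVneq x 0; first by rewrite bop0 !normr0 mulr0.
have xp : 0 < `|x| by rewrite normr_gt0.
rewrite -ler_pdivrMr //.
have yE : `|T x| / `|x| = (complex.Re (`|T x| / `|x|))%:C.
  by rewrite RRe_real // ger0_real // divr_ge0.
rewrite yE lecR; apply: lb_le_inf; first exact: (normset_inf T).1.
by move=> M [M0 hM]; rewrite -lecR -yE ler_pdivrMr.
Qed.

Lemma bop_norm_le T c : 0 <= c -> (forall x, `|T x| <= c * `|x|) -> bop_norm T <= c.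
Proof.
move=> c0; have cE : c = (complex.Re c)%:C by rewrite RRe_real // ger0_real.
rewrite cE => h; rewrite lecR; apply: ge_inf; first by exists 0 => ? [].
by split=> //; rewrite -ler0c -cE.
Qed.

Lemma bop_norm_triangle S T : bop_norm (S + T) <= bop_norm S + bop_norm T.
Proof.
apply: bop_norm_le => [|x]; first by rewrite addr_ge0 ?bop_norm_ge0.
rewrite bopDE mulrDl; apply: le_trans (ler_normD _ _) _.
by apply: lerD; exact: bop_normP.
Qed.

Lemma bop_norm0_eq0 T : bop_norm T = 0 -> T = 0.
Proof.
move=> h; apply: bopP => x; apply/eqP; rewrite -normr_le0.
by have := bop_normP T x; rewrite h mul0r.
Qed.

Lemma bop_normZ c T : bop_norm (c *: T) = `|c| * bop_norm T.
Proof.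
have le a U : bop_norm (a *: U) <= `|a| * bop_norm U.
  apply: bop_norm_le => [|x]; first by rewrite mulr_ge0 ?bop_norm_ge0.
  by rewrite bopZE normrZ -mulrA ler_wpM2l // bop_normP.
apply/eqP; rewrite eq_le le /=.
have [->|c0] := eqVneq c 0; first by rewrite normr0 mul0r bop_norm_ge0.
have := le c^-1 (c *: T); rewrite scalerA mulVf // scale1r normfV.
by rewrite ler_pdivlMl ?normr_gt0.
Qed.

HB.instance Definition _ := Lmodule_isNormed.Build R[i] (bop H)
  bop_norm_triangle bop_normZ bop_norm0_eq0.

Lemma bop_normE T : `|T| = bop_norm T. Proof. by []. Qed.

Lemma bop_complete (F : set_system (bop H)) :
  ProperFilter F -> cauchy F -> cvg F.
Proof.
move=> FF /cauchy_ballP Fc.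
have Fc' (e : R[i]) : 0 < e -> \forall S & T \near F, `|S - T| < e.
  by move=> e0; have := Fc e e0; rewrite -ball_normE.
have pc x : cvg ((fun T : bop H => T x) @ F).
  apply: cauchy_cvg; apply/cauchy_ballP => e e0.
  have kp : 0 < `|x| + 1 by rewrite ltr_wpDl.
  have [[A B] /= [FA FB] h] := Fc' (e / (`|x| + 1)) (divr_gt0 e0 kp).
  exists ((fun T : bop H => T x) @` A, (fun T : bop H => T x) @` B).
    by split; [apply: filterS FA|apply: filterS FB] => T AT; exists T.
  move=> [_ _] [/= [S AS <-] [T BT <-]]; rewrite -ball_normE /= -bopBE.
  apply: le_lt_trans (bop_normP _ _) _; rewrite -bop_normE.
  have := h (S, T) (conj AS BT); rewrite /= ltr_pdivlMr //.
  by apply: le_lt_trans; rewrite ler_wpM2l // lerDl.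
pose f x := lim ((fun T : bop H => T x) @ F).
have fP x : ((fun T : bop H => T x) @ F) --> f x by exact: pc.
have fl : linear f.
  move=> a x y; have h := cvgD (cvgZl_tmp (k := a) (fP x)) (fP y).
  rewrite -(cvg_lim _ (h _ _)) // /f; congr (lim (_ @ F)); apply/funext => T.
  by rewrite bopD bopZ.
have f0 : f 0 = 0.
  by have := fl (-1) 0 0; rewrite scaler0 addr0 scaleN1r addNr.
have fle (e : R[i]) : 0 < e -> \forall T \near F, forall x, `|f x - (T : bop H) x| <= e * `|x|.
  move=> e0; have e20 : 0 < e / 2 by rewrite divr_gt0.
  have [[A B] /= [FA FB] h] := Fc' (e / 2) e20.
  near=> T => x; have TA : A T by near: T.
  have [->|x0] := eqVneq x 0; first by rewrite f0 bop0 subrr !normr0 mulr0.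
  have /cvgrPdist_lt /(_ (e / 2 * `|x|)) := fP x.
  rewrite mulr_gt0 ?normr_gt0 // => /(_ isT) Fx.
  have [S [/= hS SB]] := filter_ex (filterI Fx FB).
  rewrite -(subrK (S x) (f x)) -addrA -bopBE.
  apply: le_trans (ler_normD _ _) _.
  rewrite [in leRHS](splitr e) mulrDl; apply: lerD; first exact: ltW.
  apply: le_trans (bop_normP _ _) _; rewrite -bop_normE ler_wpM2r //.
  by rewrite distrC; apply: ltW; exact: (h (T, S)).
have fb : bounded_linear f.
  split=> //; have [T hT] := filter_ex (fle 1 ltr01).
  have [M M0 hM] := bop_bound T; exists (1 + M) => x.
  rewrite -(subrK (T x) (f x)); apply: le_trans (ler_normD _ _) _.
  by rewrite rmorphD mulrDl; apply: lerD.
apply/cvg_ex; exists (Bop fb); apply/cvgrPdist_le => e e0.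
apply: filterS (fle e e0) => T hT.
by apply: bop_norm_le => [|x]; [exact: ltW|rewrite bopBE].
Unshelve. all: by end_near. Qed.

HB.instance Definition _ := Uniform_isComplete.Build (bop H) bop_complete.

Lemma adjoint_ex T y : exists z, forall x, inner (T x) y = inner x z.
Proof.
have [M M0 hM] := bop_bound T.
have yE : (complex.Re `|y|)%:C = `|y| by rewrite RRe_real // ger0_real.
move: (complex.Re `|y|) yE => r yE.
apply: (@Riesz _ _ (fun x => inner (T x) y) (M * r)).
  by move=> c x x'; rewrite bopD bopZ innerDl innerZl.
move=> x; apply: le_trans (CauchySchwarz _ _) _.
by rewrite rmorphM /= yE mulrAC ler_wpM2r.
Qed.

Definition adj_fun T (y : H) : H := projT1 (cid (adjoint_ex T y)).

Lemma adj_funP T x y : inner (T x) y = inner x (adj_fun T y).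
Proof. by rewrite /adj_fun; case: cid. Qed.

Lemma adj_bounded_linear T : bounded_linear (adj_fun T).
Proof.
split=> [a x y|].
  apply: inner_inj => z; rewrite -adj_funP !innerDr !innerZr.
  by rewrite -!adj_funP.
have [M M0 hM] := bop_bound T; exists M => y.
have [->|y0] := eqVneq (adj_fun T y) 0.
  by rewrite normr0 mulr_ge0 // ler0c.
rewrite -(@ler_pM2r _ `|adj_fun T y|) ?normr_gt0 // -expr2 norm_inner -adj_funP.
have Ty : `|inner (T (adj_fun T y)) y| = inner (T (adj_fun T y)) y.
  by rewrite ger0_norm // adj_funP -norm_inner exprn_ge0.
rewrite -Ty; apply: le_trans (CauchySchwarz _ _) _.
by rewrite mulrAC ler_wpM2r.
Qed.

Definition adjoint T := Bop (adj_bounded_linear T).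

Lemma adjointP T x y : inner (T x) y = inner x (adjoint T y).
Proof. exact: adj_funP. Qed.

Lemma adjointP' T x y : inner (adjoint T x) y = inner x (T y).
Proof. by rewrite (innerC y) -adjointP -innerC. Qed.

Lemma adjointK : involutive adjoint.
Proof.
by move=> T; apply: bopP => x; apply: inner_inj => z; rewrite -adjointP adjointP'.
Qed.

Lemma adjointD : {morph adjoint : S T / S + T}.
Proof.
move=> S T; apply: bopP => x; apply: inner_inj => z.
by rewrite -adjointP !bopDE innerDl innerDr -!adjointP.
Qed.

Lemma adjointZ c T : adjoint (c *: T) = c^*%R *: adjoint T.
Proof.
apply: bopP => x; apply: inner_inj => z.
by rewrite -adjointP !bopZE innerZl innerZr -adjointP conjCK.
Qed.

Lemma adjointM S T : adjoint (bop_comp S T) = bop_comp (adjoint T) (adjoint S).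
Proof. by apply: bopP => x; apply: inner_inj => z; rewrite -adjointP /= -!adjointP. Qed.

Lemma bop_normM S T : `|bop_comp S T| <= `|S| * `|T|.
Proof.
apply: bop_norm_le => [|x]; first exact: mulr_ge0.
apply: le_trans (bop_normP S (T x)) _; rewrite -mulrA.
by apply: ler_wpM2l; [exact: bop_norm_ge0|exact: bop_normP].
Qed.

Lemma bop_norm_sqr T : `|T| ^+ 2 <= `|bop_comp (adjoint T) T|.
Proof.
have rt (c : R[i]) : 0 <= c -> exists2 a : R[i], 0 <= a & a ^+ 2 = c.
  by move=> c0; exists (sqrtC c); rewrite ?sqrtC_ge0 // sqrtCK.
have [a a0 aE] := rt _ (normr_ge0 (bop_comp (adjoint T) T)).
rewrite -aE ler_pXn2r ?nnegrE //; apply: bop_norm_le => // x.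
rewrite -(@ler_pXn2r _ 2) ?nnegrE ?mulr_ge0 // exprMn aE norm_inner adjointP.
have p : 0 <= inner x (adjoint T (T x)) by rewrite -adjointP -norm_inner exprn_ge0.
rewrite -(ger0_norm p); apply: le_trans (CauchySchwarz _ _) _.
rewrite expr2 mulrA mulrC ler_wpM2r //.
exact: (bop_normP (bop_comp (adjoint T) T)).
Qed.

Lemma adjoint_norm_le T : `|adjoint T| <= `|T|.
Proof.
have [T0|T0] := eqVneq `|adjoint T| 0; first by rewrite T0.
have := bop_norm_sqr (adjoint T); rewrite adjointK => h.
rewrite -(@ler_pM2r _ `|adjoint T|); last by rewrite lt_def T0 normr_ge0.
by rewrite -expr2; apply: le_trans h _; exact: bop_normM.
Qed.

Lemma bop_cstar T : `|bop_comp (adjoint T) T| = `|T| ^+ 2.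
Proof.
apply/eqP; rewrite eq_le bop_norm_sqr andbT; apply: le_trans (bop_normM _ _) _.
by rewrite expr2 ler_wpM2r // adjoint_norm_le.
Qed.

Lemma bop_compA : associative bop_comp. Proof. by move=> S T U; apply: bopP. Qed.
Lemma bop_comp1l : left_id bop_one bop_comp. Proof. by move=> S; apply: bopP. Qed.
Lemma bop_comp1r : right_id bop_one bop_comp. Proof. by move=> S; apply: bopP. Qed.
Lemma bop_compDl : left_distributive bop_comp +%R.
Proof. by move=> S T U; apply: bopP => x; rewrite [RHS]bopDE; exact: bopDE. Qed.
Lemma bop_compDr : right_distributive bop_comp +%R.
Proof. by move=> S T U; apply: bopP => x; rewrite [RHS]bopDE; apply: etrans (congr1 S (bopDE T U x)) (bopD _ _ _). Qed.
Lemma bop_compZl c S T : bop_comp (c *: S) T = c *: bop_comp S T.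
Proof. by apply: bopP => x; rewrite [RHS]bopZE; exact: bopZE. Qed.
Lemma bop_compZr c S T : bop_comp S (c *: T) = c *: bop_comp S T.
Proof. by apply: bopP => x; rewrite [RHS]bopZE; apply: etrans (congr1 S (bopZE c T x)) (bopZ _ _ _). Qed.

(* B(H) as a C*-algebra *)
HB.instance Definition _ := isCStarAlgebra.Build R (bop H)
  bop_compA bop_comp1l bop_comp1r bop_compDl bop_compDr bop_compZl bop_compZr
  adjointK adjointD adjointZ adjointM bop_normM bop_cstar.

End Bop.

Section Spans.
Variables (R : realType) (V : normedModType R[i]).

Definition lin_span (S : set V) : set V :=
  [set x | exists s : seq (R[i] * V),
     (forall u, u \in s -> S u.2) /\ x = \sum_(u <- s) u.1 *: u.2].

Definition closed_span (S : set V) : set V := closure (lin_span S).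

End Spans.

Section Homomorphisms.
Variables (R : realType) (A B : cstarAlgType R).

Definition unital_star_hom (f : A -> B) : Prop :=
  [/\ linear f, {morph f : x y / x ⋅ y}, {morph f : x / star x} & f cone = cone].

Definition positive_functional (f : A -> R[i]) : Prop :=
  scalar f /\ forall a, 0 <= f (star a ⋅ a).

End Homomorphisms.

(* The minimal (spatial) tensor product.  An element of the algebraic tensor  *)
(* product of A and B is given by a list s of pairs, standing for the sum of  *)
(* u.1 (x) u.2 over u in s.  For positive functionals f and g, with GNS       *)
(* vectors L_f and L_g, gns_form f g s is the squared norm of                 *)
(* (L_f (x) L_g)(s), so that spatial_bound s M says that                      *)
(* ||(pi_f (x) pi_g)(s)|| <= M for all GNS representations pi_f and pi_g.     *)
Section TensorProduct.
Variables (R : realType) (A B T : cstarAlgType R).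

Definition gns_form (f : A -> R[i]) (g : B -> R[i]) (s : seq (A * B)) : R[i] :=
  \sum_(u <- s) \sum_(v <- s) f (star u.1 ⋅ v.1) * g (star u.2 ⋅ v.2).

Definition tens_mul (s s' : seq (A * B)) : seq (A * B) :=
  [seq (u.1 ⋅ v.1, u.2 ⋅ v.2) | u <- s, v <- s'].

Definition spatial_bound (s : seq (A * B)) (M : R[i]) : Prop :=
  forall f g, positive_functional f -> positive_functional g ->
  forall s', gns_form f g (tens_mul s s') <= M ^+ 2 * gns_form f g s'.

Definition tens_sum (t : A -> B -> T) (s : seq (A * B)) : T :=
  \sum_(u <- s) t u.1 u.2.

(* T, with the bilinear map tens, is a realization of the C*-algebra A (x) B. *)
Record tensor_product := TensorProduct {
  tens :> A -> B -> T;
  tens_linearl : forall b, linear (tens^~ b);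
  tens_linearr : forall a, linear (tens a);
  tensM : forall a a' b b', tens a b ⋅ tens a' b' = tens (a ⋅ a') (b ⋅ b');
  tens_star : forall a b, star (tens a b) = tens (star a) (star b);
  tens_one : tens cone cone = cone;
  tens_norm_bound : forall s, spatial_bound s `|tens_sum tens s|;
  tens_norm_le : forall s M, 0 <= M -> spatial_bound s M ->
    `|tens_sum tens s| <= M;
  tens_dense : closure (range (tens_sum tens)) = setT
}.

Variable t : tensor_product.

(* slicel w x y means (w (x) id)(x) = y, and slicer w x y means               *)
(* (id (x) w)(x) = y.  Slice maps are determined by continuity.               *)
Definition is_slicel (w : A -> R[i]) (s : T -> B) : Prop :=
  [/\ linear s, continuous s & forall a b, s (t a b) = w a *: b].

Definition is_slicer (w : B -> R[i]) (s : T -> A) : Prop :=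
  [/\ linear s, continuous s & forall a b, s (t a b) = w b *: a].

Definition slicel (w : A -> R[i]) (x : T) (y : B) : Prop :=
  exists2 s, is_slicel w s & s x = y.

Definition slicer (w : B -> R[i]) (x : T) (y : A) : Prop :=
  exists2 s, is_slicer w s & s x = y.

End TensorProduct.

(* h = f (x) g *)
Definition is_tens_map (R : realType) (A B T A' B' T' : cstarAlgType R)
    (t : tensor_product A B T) (t' : tensor_product A' B' T')
    (f : A -> A') (g : B -> B') (h : T -> T') : Prop :=
  [/\ unital_star_hom h, continuous h & forall a b, h (t a b) = t' (f a) (g b)].

Definition tens_assoc (R : realType) (A B C AB BC T : cstarAlgType R)
    (tAB : tensor_product A B AB) (tBC : tensor_product B C BC)
    (tl : tensor_product AB C T) (tr : tensor_product A BC T) : Prop :=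
  forall a b c, tl (tAB a b) c = tr a (tBC b c).

(* qalg3 realizes both (A (x) A) (x) A and A (x) (A (x) A). *)
Record compact_quantum_group (R : realType) := CompactQuantumGroup {
  qalg :> cstarAlgType R;
  qalg2 : cstarAlgType R;
  qalg3 : cstarAlgType R;
  qtens : tensor_product qalg qalg qalg2;
  qtensl : tensor_product qalg2 qalg qalg3;
  qtensr : tensor_product qalg qalg2 qalg3;
  qtens_assoc : tens_assoc qtens qtens qtensl qtensr;
  Delta : qalg -> qalg2;
  Delta_hom : unital_star_hom Delta;
  Delta_coassoc : exists Dl Dr,
    [/\ is_tens_map qtens qtensl Delta id Dl,
        is_tens_map qtens qtensr id Delta Dr
      & forall a, Dl (Delta a) = Dr (Delta a)];
  Delta_densel :
    closed_span [set z | exists a b, z = Delta a ⋅ qtens b cone] = setT;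
  Delta_denser :
    closed_span [set z | exists a b, z = Delta a ⋅ qtens cone b] = setT
}.

Section QuantumGroup.
Variables (R : realType) (G : compact_quantum_group R).
Implicit Types (phi : G -> R[i]) (w : G -> R[i]).

Definition haar_state phi : Prop :=
  [/\ positive_functional phi, phi cone = 1,
      forall a, slicel (qtens G) phi (Delta a) (phi a *: cone)
    & forall a, slicer (qtens G) phi (Delta a) (phi a *: cone)].

Definition faithful phi : Prop := forall a, phi (star a ⋅ a) = 0 -> a = 0.

(* A finite-dimensional unitary corepresentation, as the matrix (u_ij) of     *)
(* U = sum_ij u_ij (x) e_ij; then U_13 U_23 has entries sum_k u_ik (x) u_kj.  *)
Definition unitary_corep_mx d (u : 'M[G]_d) : Prop :=
  [/\ forall i j, Delta (u i j) = \sum_k qtens G (u i k) (u k j),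
      forall i j, \sum_k star (u k i) ⋅ u k j = if i == j then cone else 0
    & forall i j, \sum_k u i k ⋅ star (u j k) = if i == j then cone else 0].

(* The image of the idempotent P is an invariant subspace: U P = P U P. *)
Definition invariant_image d (u : 'M[G]_d) (P : 'M[R[i]]_d) : Prop :=
  forall i j, \sum_k P k j *: u i k = \sum_k \sum_l (P i k * P l j) *: u k l.

Definition irreducible_mx d (u : 'M[G]_d) : Prop :=
  (0 < d)%N /\
  forall P : 'M[R[i]]_d, P *m P = P -> invariant_image u P -> P = 0 \/ P = 1%:M.

(* Irreducible unitary corepresentations of a compact quantum group are       *)
(* finite-dimensional, so they are all given by matrices.                     *)
Definition matrix_coefficients : set G :=
  lin_span [set a | exists d (u : 'M[G]_d),
    [/\ unitary_corep_mx u, irreducible_mx u & exists i j, a = u i j]].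

(* The dual algebra, as a set of functionals. *)
Definition dual_algebra phi : set (G -> R[i]) :=
  [set w | exists2 a, matrix_coefficients a & w = fun x => phi (a ⋅ x)].

End QuantumGroup.

Record coaction (R : realType) (G : compact_quantum_group R)
    (B : cstarAlgType R) := Coaction {
  calg2 : cstarAlgType R;
  calg3 : cstarAlgType R;
  ctens : tensor_product G B calg2;
  ctensl : tensor_product (qalg2 G) B calg3;
  ctensr : tensor_product G calg2 calg3;
  ctens_assoc : tens_assoc (qtens G) ctens ctensl ctensr;
  coact :> B -> calg2;
  coact_hom : unital_star_hom coact;
  coact_coassoc : exists hl hr,
    [/\ is_tens_map ctens ctensl (@Delta R G) id hl,
        is_tens_map ctens ctensr id coact hr
      & forall b, hl (coact b) = hr (coact b)]
}.

Section Coaction.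
Variables (R : realType) (G : compact_quantum_group R) (phi : G -> R[i]).
Variables (B : cstarAlgType R) (alpha : coaction G B).

Definition nondegenerate_coaction : Prop :=
  closed_span [set z | exists a b, z = ctens alpha a cone ⋅ alpha b] = setT.

(* right_act b w c means that c = b <| w. *)
Definition right_act (b : B) (w : G -> R[i]) (c : B) : Prop :=
  slicel (ctens alpha) w (alpha b) c.

Definition regular_part : set B :=
  lin_span [set c | exists b w, dual_algebra phi w /\ right_act b w c].

Definition invariant_elt (p : B) : Prop :=
  forall w, dual_algebra phi w -> right_act p w (w cone *: p).

Definition is_projection (p : B) : Prop := star p = p /\ p ⋅ p = p.

End Coaction.

Section Multipliers.
Variable (R : realType) (T : cstarAlgType R).

(* A multiplier of a closed *-subalgebra J of T is a double centralizer       *)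
(* (L, R) of J: L is x |-> m x and R is x |-> x m.  Only the restrictions of  *)
(* L and R to J matter, which is why multipliers are compared by mult_eq.     *)
Definition mult : Type := ((T -> T) * (T -> T))%type.

Definition is_mult (J : set T) (m : mult) : Prop :=
  [/\ forall x, J x -> J (m.1 x), forall x, J x -> J (m.2 x)
    & forall x y, J x -> J y -> x ⋅ m.1 y = m.2 x ⋅ y].

Definition mult_eq (J : set T) (m m' : mult) : Prop :=
  forall x, J x -> m.1 x = m'.1 x /\ m.2 x = m'.2 x.

Definition mult_mul (m m' : mult) : mult := (m.1 \o m'.1, m'.2 \o m.2).

Definition mult_star (m : mult) : mult :=
  (fun x => star (m.2 (star x)), fun x => star (m.1 (star x))).

Definition mult_of (z : T) : mult := (cmul z, cmul^~ z).

Definition mult_unitary (J : set T) (m : mult) : Prop :=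
  [/\ is_mult J m, mult_eq J (mult_mul (mult_star m) m) (mult_of cone)
    & mult_eq J (mult_mul m (mult_star m)) (mult_of cone)].

End Multipliers.

(* m' is the image of the multiplier m of J under the extension of the        *)
(* nondegenerate homomorphism h : J -> M(J').                                 *)
Definition mult_ext (R : realType) (T T' : cstarAlgType R) (J : set T)
    (J' : set T') (h : T -> T') (m : mult T) (m' : mult T') : Prop :=
  is_mult J' m' /\
  forall x y, J x -> J' y ->
    m'.1 (h x ⋅ y) = h (m.1 x) ⋅ y /\ m'.2 (y ⋅ h x) = y ⋅ h (m.2 x).

Section Operators.
Variables (R : realType) (H : hilbertType R).
Implicit Types (S T : bop H) (V E : set H).

Definition compact_op T : Prop := precompact (T @` [set x | `|x| <= 1]).

Definition commutator S T : bop H := S ⋅ T - T ⋅ S.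

(* T = sum_k mu_k <., e_k> f_k, with singular values mu_k; the vectors e_k    *)
(* and f_k are only constrained for mu_k != 0.                                *)
Definition schatten (r : nat) T : Prop :=
  exists (mu : nat -> R) (e f : nat -> H),
  [/\ forall k, 0 <= mu k,
      forall j k, mu j != 0 -> mu k != 0 ->
        inner (e j) (e k) = (j == k)%:R /\ inner (f j) (f k) = (j == k)%:R,
      cvgn (series (fun k => mu k ^+ r))
    & forall x, (\sum_(0 <= k < m) ((mu k)%:C * inner x (e k)) *: f k)
        @[m --> \oo] --> T x].

Definition orthonormal_basis V E : Prop :=
  [/\ E `<=` V, forall x y, E x -> E y -> inner x y = (x == y)%:R
    & V `<=` closed_span E].

(* Unconditional summation over a set of vectors of any cardinality. *)
Definition has_sum E (g : H -> R[i]) (tau : R[i]) : Prop :=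
  forall e : R, 0 < e -> exists2 X0 : {fset H}, [set` X0] `<=` E &
  forall X : {fset H}, (X0 `<=` X)%fset -> [set` X] `<=` E ->
    `|\sum_(x <- X) g x - tau| < e%:C.

(* The trace of the compression of T to the closed subspace V, i.e. of the    *)
(* restriction of T when V is invariant.                                      *)
Definition trace_on V T : R[i] :=
  xget 0 [set tau | forall E, orthonormal_basis V E ->
                      has_sum E (fun x => inner (T x) x) tau].

Definition trace T : R[i] := trace_on setT T.

End Operators.

Section Corepresentation.
Variables (R : realType) (G : compact_quantum_group R) (H : hilbertType R).

(* The ideal C (x) K(H) of C (x) B(H). *)
Definition tens_compact (C T : cstarAlgType R) (t : tensor_product C (bop H) T)
    : set T :=
  closed_span [set z | exists a k, compact_op k /\ z = t a k].

Variables (T T2 : cstarAlgType R).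
Variables (t : tensor_product G (bop H) T).
Variables (t2 : tensor_product (qalg2 G) (bop H) T2).

(* m' = (psi (x) id)(m) for a unital *-homomorphism psi : A -> A (x) A; for   *)
(* psi = (a |-> a (x) 1) and psi = (a |-> 1 (x) a) this is m_13 and m_23.     *)
Definition leg_ext (psi : G -> qalg2 G) (m : mult T) (m' : mult T2) : Prop :=
  exists2 h, is_tens_map t t2 psi id h &
    mult_ext (tens_compact t) (tens_compact t2) h m m'.

Definition unitary_corep (U : mult T) : Prop :=
  mult_unitary (tens_compact t) U /\
  exists U13 U23,
  [/\ leg_ext (fun a => qtens G a cone) U U13,
      leg_ext (fun a => qtens G cone a) U U23
    & leg_ext (@Delta R G) U (mult_mul U13 U23)].

(* S = (w (x) id)(U), as a multiplier of K(H): S k = (w (x) id)(U (1 (x) k)). *)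
Definition mult_slice (w : G -> R[i]) (U : mult T) (S : bop H) : Prop :=
  exists2 s, is_slicel t w s &
    forall k, compact_op k -> S ⋅ k = s (U.1 (t cone k)).

End Corepresentation.

(* Only the restriction of frep to the regular part of B is relevant.  In     *)
(* fequiv, (id (x) frep)(alpha b) is computed in the algebraic tensor product *)
(* of A and the regular part, which contains alpha b.                         *)
Record fredholm_module (R : realType) (G : compact_quantum_group R)
    (phi : G -> R[i]) (B : cstarAlgType R) (alpha : coaction G B)
    (H : hilbertType R) := FredholmModule {
  frep : B -> bop H;
  fop : bop H;
  fgrading : bop H;
  falg : cstarAlgType R;
  falg2 : cstarAlgType R;
  ftens : tensor_product G (bop H) falg;
  ftens2 : tensor_product (qalg2 G) (bop H) falg2;
  fcorep : mult falg;
  frep_linear : forall (c : R[i]) b b', regular_part phi alpha b ->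
    regular_part phi alpha b' -> frep (c *: b + b') = c *: frep b + frep b';
  frepM : forall b b', regular_part phi alpha b ->
    regular_part phi alpha b' -> frep (b ⋅ b') = frep b ⋅ frep b';
  frep_star : forall b, regular_part phi alpha b ->
    frep (star b) = star (frep b);
  frep_bounded : exists M : R, forall b, regular_part phi alpha b ->
    `|frep b| <= M%:C * `|b|;
  fop_star : star fop = fop;
  fop_sqr : fop ⋅ fop = cone;
  fgrading_star : star fgrading = fgrading;
  fgrading_sqr : fgrading ⋅ fgrading = cone;
  fop_odd : fop ⋅ fgrading = - (fgrading ⋅ fop);
  frep_even : forall b, regular_part phi alpha b ->
    frep b ⋅ fgrading = fgrading ⋅ frep b;
  fcompact : forall b, regular_part phi alpha b ->
    compact_op (commutator fop (frep b));
  fcorep_unitary : unitary_corep ftens ftens2 fcorep;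
  fcorep_op : mult_eq (tens_compact ftens)
    (mult_mul fcorep (mult_of (ftens cone fop)))
    (mult_mul (mult_of (ftens cone fop)) fcorep);
  fcorep_grading : mult_eq (tens_compact ftens)
    (mult_mul fcorep (mult_of (ftens cone fgrading)))
    (mult_mul (mult_of (ftens cone fgrading)) fcorep);
  fequiv : forall (b : B) (s : seq (G * B)), regular_part phi alpha b ->
    (forall u, u \in s -> regular_part phi alpha u.2) ->
    alpha b = tens_sum (ctens alpha) s ->
    mult_eq (tens_compact ftens)
      (mult_mul fcorep
        (mult_of (tens_sum ftens [seq (u.1, frep u.2) | u <- s])))
      (mult_mul (mult_of (ftens cone (frep b))) fcorep)
}.

Section Index.
Variables (R : realType) (G : compact_quantum_group R) (phi : G -> R[i]).
Variables (B : cstarAlgType R) (alpha : coaction G B) (H : hilbertType R).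
Variable M : fredholm_module phi alpha H.

Local Notation F := (fop M).
Local Notation gamma := (fgrading M).

Definition summable_module (r : nat) : Prop :=
  forall b, regular_part phi alpha b -> schatten r (commutator F (frep M b)).

(* piU w = (w (x) id)(U) *)
Definition associated_rep (piU : (G -> R[i]) -> bop H) : Prop :=
  forall w, dual_algebra phi w -> mult_slice (ftens M) w (fcorep M) (piU w).

Variable piU : (G -> R[i]) -> bop H.

Definition phi_F (n : nat) (w : G -> R[i]) (b : 'I_(n.*2.+1) -> B) : R[i] :=
  (-1) ^+ n / 2 *
  trace (gamma ⋅ piU w ⋅ F ⋅
         \big[cmul/cone]_(i < n.*2.+1) commutator F (frep M (b i))).

(* The pairing of a 2n-cocycle f with an invariant idempotent p. *)
Definition pairing (n : nat) (f : (G -> R[i]) -> ('I_(n.*2.+1) -> B) -> R[i])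
    (p : B) : (G -> R[i]) -> R[i] :=
  fun w => f w (fun=> p).

Definition p_plus (p : B) : bop H := 2^-1 *: ((cone + gamma) ⋅ frep M p).
Definition p_minus (p : B) : bop H := 2^-1 *: ((cone - gamma) ⋅ frep M p).

Definition H_plus : set H := [set x | gamma x = x].
Definition H_minus : set H := [set x | gamma x = - x].

Definition index_op (p : B) : bop H := p_minus p ⋅ F ⋅ p_plus p.

Definition index_ker (p : B) : set H :=
  [set x | (p_plus p @` H_plus) x /\ index_op p x = 0].

Definition index_coker (p : B) : set H :=
  [set y | (p_minus p @` H_minus) y /\
           forall x, (p_plus p @` H_plus) x -> inner y (index_op p x) = 0].

Definition Ind_F (p : B) (w : G -> R[i]) : R[i] :=
  trace_on (index_ker p) (piU w) - trace_on (index_coker p) (piU w).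

End Index.

Arguments phi_F {R G phi B alpha H} M piU n w b.

(* Main.v *)
(** Write [P = pi(p)], [Q = F P F], [C = P - Q] and [T = pi_U(w)].  Since
    [[F, P] = F C] and [F C = - C F], the cocycle evaluates to
    [Tr(gamma T C^(2n+1)) / 2].  The operator [W = 1 - P - Q] commutes with
    [gamma T], anticommutes with [C] and satisfies [W^2 = 1 - C^2], so [gamma T C]
    is traceless on every eigenspace of [C^2] for an eigenvalue other than [0] and
    [1].  On [C^2 = 1], the symmetry [F] anticommutes with [gamma T], which is
    therefore traceless as well, and what remains is the trace of [gamma T] on
    [C x = x]; the even and odd parts of this space are the kernel and the cokernel
    of [p_- F p_+].

    That [T] commutes with [P] rests on [alpha p = 1 (x) p].  By strong invariance of
    the Haar state and coassociativity, [alpha] sends a spectral element to a finite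
    sum of tensors [a (x) b] with [a^*] a matrix coefficient, and the slices by the
    functionals [phi (a^* .)] separate such sums. *)

Require Import Defs.
From mathcomp Require Import all_boot all_order all_algebra finmap.
From mathcomp Require Import boolp classical_sets functions reals filter.
From mathcomp Require Import topology tvs normedtype sequences.
From mathcomp Require Import complex ring lra.

Set Implicit Arguments.
Unset Strict Implicit.
Unset Printing Implicit Defensive.

Import Order.TTheory GRing.Theory Num.Theory.
Import numFieldNormedType.Exports.

Local Open Scope classical_set_scope.
Local Open Scope complex_scope.
Local Open Scope ring_scope.

(** * Normed spaces and C*-algebras *)

(** A Schatten operator comes with singular vectors, whereas [trace] is an unconditional sum over
    arbitrary orthonormal bases, so no eigenvalue argument applies to it directly. The trace of
    [S C^(2n+1)] is first converted into the absolutely convergent series of the numbers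
    [mu k ^+ (2n+1) <S (f k), e k>]. Its order may interleave equal singular values; summability
    makes every level set of a nonzero value finite, and the cancellation takes place on finite
    unions of level sets, where [W] acts as a finite matrix. The factor 1/2 of the cocycle is that
    of the projection [(1 + C) / 2] from the space [C^2 = 1] onto [C = 1]: the summand [1]
    contributes the trace killed by [F], the summand [C] the trace of [gamma T C]. The sign comes
    from [(F C)^2 = - C^2]. Invariance of [p] is a statement about slices, while equivariance of the
    module needs [alpha p] in the algebraic tensor product. The passage requires slice maps with
    values in a tensor product, whose norm is known only through pairs of positive functionals. *)

Section Normed.
Variables (R : realType) (V W : normedModType R[i]).

Lemma closure_approxP (D : set V) (x : V) :
  closure D x <-> forall e : R[i], 0 < e -> exists2 d, D d & `|x - d| < e.
Proof.
split=> [h e e0|h U /nbhs_ballP[e /= e0 eU]].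
  have [d [Dd xd]] := h _ (nbhsx_ballx x e e0).
  by exists d => //; move: xd; rewrite -ball_normE.
by have [d Dd xd] := h e e0; exists d; split=> //; apply: eU; rewrite -ball_normE.
Qed.

Lemma lipschitz_continuous (f : V -> W) (M : R[i]) :
  (forall x y, `|f x - f y| <= M * `|x - y|) -> continuous f.
Proof.
move=> h x; apply/cvgrPdist_lt => e e0.
have k0 : 0 < `|M| + 1 by rewrite ltr_wpDl.
near=> y; apply: le_lt_trans (h x y) _.
apply: (@le_lt_trans _ _ ((`|M| + 1) * `|x - y|)).
  have [->|xy] := eqVneq `|x - y| 0; first by rewrite !mulr0.
  have xp : 0 < `|x - y| by rewrite lt_def xy normr_ge0.
  (* [M] carries no sign assumption: a nonzero distance forces [0 <= M]. *)
  have := le_trans (normr_ge0 _) (h x y); rewrite pmulr_lge0 // => M0.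
  by rewrite ler_pM2r // ger0_norm // lerDl.
rewrite mulrC -ltr_pdivlMr //; near: y.
by apply: cvgr_dist_lt; [exact: cvg_id|rewrite divr_gt0].
Unshelve. all: by end_near. Qed.

Lemma bounded_continuous (f : V -> W) (M : R[i]) :
  (forall x y, f (x - y) = f x - f y) -> (forall x, `|f x| <= M * `|x|) ->
  continuous f.
Proof. by move=> fB h; apply: (@lipschitz_continuous f M) => x y; rewrite -fB. Qed.

Lemma continuous_eq_closure (f g : V -> W) (D : set V) (x : V) :
  continuous f -> continuous g -> (forall d, D d -> f d = g d) ->
  closure D x -> f x = g x.
Proof.
move=> fc gc fg Dx; apply/eqP; rewrite -subr_eq0 -normr_le0.
apply/ler_addgt0Pr => e e0; rewrite add0r.
have e20 : 0 < e / 2 by rewrite divr_gt0.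
have /cvgrPdist_lt/(_ _ e20) hf := fc x; have /cvgrPdist_lt/(_ _ e20) hg := gc x.
have [d [Dd [/= h1 h2]]] := Dx _ (filterI hf hg).
rewrite -(subrK (f d) (f x)) -addrA; apply: le_trans (ler_normD _ _) _.
by rewrite (splitr e) lerD // ltW // (fg d Dd) distrC.
Qed.

End Normed.

Section RealComplex.
Variable R : realType.

Lemma conjCM (x y : R[i]) : (x * y)^* = x^* * y^*. Proof. exact: rmorphM. Qed.
Lemma conjCD (x y : R[i]) : (x + y)^* = x^* + y^*. Proof. exact: rmorphD. Qed.
Lemma conjCV (x : R[i]) : (x^-1)^* = (x^*)^-1. Proof. exact: fmorphV. Qed.
Lemma realCM (x y : R) : (x * y)%:C = x%:C * y%:C. Proof. exact: rmorphM. Qed.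

Lemma gt0_complex (e : R[i]) : 0 < e -> exists2 e' : R, 0 < e' & e = e'%:C.
Proof.
case: e => a b; rewrite ltcE /= => /andP[/eqP -> a0]; exists a => //.
Qed.

Lemma ge0_complex (e : R[i]) : 0 <= e -> exists2 e' : R, 0 <= e' & e = e'%:C.
Proof.
case: e => a b; rewrite lecE /= => /andP[/eqP -> a0]; exists a => //.
Qed.

Lemma norm_complex (V : normedModType R[i]) (x : V) :
  exists2 r : R, 0 <= r & `|x| = r%:C.
Proof. exact: ge0_complex. Qed.

Lemma cauchy_rate_cvg (V : completeNormedModType R[i]) (u : nat -> V) (b : nat -> R) :
  b @ \oo --> 0 -> (forall n m, (n <= m)%N -> `|u m - u n| <= (b n)%:C) ->
  cvgn u.
Proof.
move=> b0 h; apply: cauchy_cvg; apply/cauchy_ballP => e e0.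
have [e' e'0 ee'] := gt0_complex e0.
have /cvgr0Pnorm_lt /(_ (e' / 2)) := b0; rewrite divr_gt0 // => /(_ isT)[N _ hN].
exists (u @` [set n | (N <= n)%N], u @` [set n | (N <= n)%N]).
  by split; exists N => // n Nn; exists n.
move=> [_ _] [/= [n Nn <-] [m Nm <-]]; rewrite -ball_normE /=.
have bN : (b N)%:C < (e' / 2)%:C.
  by rewrite ltcR; apply: le_lt_trans (ler_norm _) _; apply: hN => /=.
rewrite -(subrK (u N) (u n)) -addrA; apply: le_lt_trans (ler_normD _ _) _.
rewrite ee' (splitr e') rmorphD /= ltrD //; first by apply: le_lt_trans (h _ _ Nn) bN.
by rewrite distrC; apply: le_lt_trans (h _ _ Nm) bN.
Qed.

End RealComplex.

Section LinearFun.
Variables (R : pzRingType) (V W : lmodType R) (f : V -> W).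
Hypothesis fl : linear f.
Lemma linfunD x y : f (x + y) = f x + f y.
Proof. by have := fl 1 x y; rewrite !scale1r. Qed.
Lemma linfun0 : f 0 = 0.
Proof. by apply: (addrI (f 0)); rewrite -linfunD !addr0. Qed.
Lemma linfunZ c x : f (c *: x) = c *: f x.
Proof. by have := fl c x 0; rewrite !addr0 linfun0 addr0. Qed.
Lemma linfunN x : f (- x) = - f x.
Proof. by rewrite -scaleN1r linfunZ scaleN1r. Qed.
Lemma linfunB x y : f (x - y) = f x - f y.
Proof. by rewrite linfunD linfunN. Qed.
Lemma linfun_sum I (r : seq I) P (F : I -> V) :
  f (\sum_(i <- r | P i) F i) = \sum_(i <- r | P i) f (F i).
Proof. exact: (big_morph f linfunD linfun0). Qed.
End LinearFun.

Section ScalarFun.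
Variables (R : pzRingType) (V : lmodType R) (f : V -> R).
Hypothesis fl : scalar f.
Lemma scalfunD x y : f (x + y) = f x + f y.
Proof. by have := fl 1 x y; rewrite scale1r mul1r. Qed.
Lemma scalfun0 : f 0 = 0.
Proof. by apply: (addrI (f 0)); rewrite -scalfunD !addr0. Qed.
Lemma scalfunZ c x : f (c *: x) = c * f x.
Proof. by have := fl c x 0; rewrite !addr0 scalfun0 addr0. Qed.
Lemma scalfunN x : f (- x) = - f x.
Proof. by rewrite -scaleN1r scalfunZ mulN1r. Qed.
Lemma scalfunB x y : f (x - y) = f x - f y.
Proof. by rewrite scalfunD scalfunN. Qed.
Lemma scalfun_sum I (r : seq I) P (F : I -> V) :
  f (\sum_(i <- r | P i) F i) = \sum_(i <- r | P i) f (F i).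
Proof. exact: (big_morph f scalfunD scalfun0). Qed.
End ScalarFun.

Section CStarTheory.
Variables (R : realType) (A : cstarAlgType R).
Implicit Types x y z : A.

Lemma cmul0l y : 0 ⋅ y = 0 :> A.
Proof. by rewrite -(scale0r (0 : A)) cmulZl !scale0r. Qed.
Lemma cmul0r y : y ⋅ 0 = 0 :> A.
Proof. by rewrite -(scale0r (0 : A)) cmulZr !scale0r. Qed.
Lemma cmulNl x y : (- x) ⋅ y = - (x ⋅ y).
Proof. by rewrite -scaleN1r cmulZl scaleN1r. Qed.
Lemma cmulNr x y : x ⋅ (- y) = - (x ⋅ y).
Proof. by rewrite -scaleN1r cmulZr scaleN1r. Qed.
Lemma cmulBl x y z : (x - y) ⋅ z = x ⋅ z - y ⋅ z.
Proof. by rewrite cmulDl cmulNl. Qed.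
Lemma cmulBr x y z : z ⋅ (x - y) = z ⋅ x - z ⋅ y.
Proof. by rewrite cmulDr cmulNr. Qed.
Lemma cmul_suml I (r : seq I) P (F : I -> A) y :
  (\sum_(i <- r | P i) F i) ⋅ y = \sum_(i <- r | P i) F i ⋅ y.
Proof. by apply: (big_morph (cmul^~ y)) => [a b|]; rewrite ?cmulDl ?cmul0l. Qed.
Lemma cmul_sumr I (r : seq I) P (F : I -> A) y :
  y ⋅ (\sum_(i <- r | P i) F i) = \sum_(i <- r | P i) y ⋅ F i.
Proof. by apply: (big_morph (cmul y)) => [a b|]; rewrite ?cmulDr ?cmul0r. Qed.
Lemma star0 : star (0 : A) = 0.
Proof. by rewrite -(scale0r (0 : A)) starZ rmorph0 !scale0r. Qed.
Lemma starN x : star (- x) = - star x.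
Proof. by rewrite -scaleN1r starZ rmorphN rmorph1 scaleN1r. Qed.
Lemma starB x y : star (x - y) = star x - star y.
Proof. by rewrite starD starN. Qed.
Lemma star_sum I (r : seq I) P (F : I -> A) :
  star (\sum_(i <- r | P i) F i) = \sum_(i <- r | P i) star (F i).
Proof. by apply: (big_morph star) => [a b|]; rewrite ?starD ?star0. Qed.
Lemma star1 : star (cone : A) = cone.
Proof. by rewrite -[LHS]cmul1r -{2}(starK cone) -starM cmul1r starK. Qed.

Lemma norm_star x : `|star x| = `|x|.
Proof.
have le y : `|y| <= `|star y|.
  have [->|y0] := eqVneq `|y| 0; first exact: normr_ge0.
  rewrite -(@ler_pM2r _ `|y|) ?lt_def ?y0 ?normr_ge0 //.
  by rewrite -expr2 -cnorm_star; exact: cnormM.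
by apply/eqP; rewrite eq_le le andbT -{2}(starK x) le.
Qed.

Lemma cmul_continuousr x : continuous (cmul x).
Proof. by apply: (@bounded_continuous _ _ _ _ `|x|) => [y z|y]; rewrite ?cmulBr ?cnormM. Qed.
Lemma cmul_continuousl x : continuous (cmul^~ x).
Proof.
apply: (@bounded_continuous _ _ _ _ `|x|) => [y z|y]; first by rewrite cmulBl.
by rewrite mulrC cnormM.
Qed.
Lemma star_continuous : continuous (@star R A).
Proof. by apply: (@bounded_continuous _ _ _ _ 1) => [y z|y]; rewrite ?starB ?mul1r ?norm_star. Qed.

(* [r = 1 - q], where [q] is the fixed point of [q = (y + q ^ 2) / 2] in the  *)
(* ball of radius [`|y|].                                                     *)
Lemma sqrt_one_minus y : star y = y -> `|y| < 1 ->
  exists2 r, star r = r & r ⋅ r = cone - y.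
Proof.
move=> ys y1; have [c c0 yc] := norm_complex y.
have c1 : c < 1 by rewrite -ltcR -yc.
pose f q := 2^-1 *: (y + q ⋅ q).
have n2 : `|2^-1 : R[i]| = 2^-1 by rewrite ger0_norm // invr_ge0.
have fn q : `|q| <= c%:C -> `|f q| <= c%:C.
  move=> qc; rewrite normrZ n2 ler_pdivrMl //.
  apply: le_trans (ler_normD _ _) _; rewrite mulr_natl mulr2n yc lerD2l.
  apply: le_trans (cnormM _ _) _; apply: le_trans (ler_pM _ _ qc qc) _ => //.
  by rewrite -rmorphM /= lecR -[leRHS]mulr1 ler_wpM2l // ltW.
(* Contraction with constant [c]: [2 (f q - f q') = q (q - q') + (q - q') q'], and both [q] and [q']
   have norm at most [c]. *)
have fl q q' : `|q| <= c%:C -> `|q'| <= c%:C -> `|f q - f q'| <= c%:C * `|q - q'|.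
  move=> qc qc'; rewrite -scalerBr normrZ n2 ler_pdivrMl //.
  rewrite (_ : _ - _ = q ⋅ (q - q') + (q - q') ⋅ q'); last first.
    by rewrite cmulBr cmulBl opprD addrACA subrr add0r addrA subrK.
  apply: le_trans (ler_normD _ _) _; rewrite mulr_natl mulr2n; apply: lerD.
    by apply: le_trans (cnormM _ _) _; rewrite ler_wpM2r.
  by apply: le_trans (cnormM _ _) _; rewrite mulrC ler_wpM2r.
pose u n := iter n f 0.
have uS n : u n.+1 = f (u n) by [].
have un n : `|u n| <= c%:C.
  by elim: n => [|n IHn]; rewrite ?normr0 ?ler0c // uS fn.
have us n : star (u n) = u n.
  elim: n => [|n IHn]; first exact: star0.
  by rewrite uS starZ starD ys starM IHn fmorphV rmorph_nat.
have ud n : `|u n.+1 - u n| <= (c ^+ n)%:C.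
  elim: n => [|n IHn].
    by rewrite subr0 expr0; apply: le_trans (un 1%N) _; rewrite lecR ltW.
  rewrite uS [in X in _ - X]uS; apply: le_trans (fl _ _ (un _) (un _)) _.
  by rewrite exprS rmorphM ler_wpM2l // ler0c.
have um n k : `|u (n + k)%N - u n| <= (c ^+ n * (1 - c ^+ k) / (1 - c))%:C.
  elim: k => [|k IHk]; first by rewrite addn0 subrr normr0 ler0c expr0 subrr mulr0 mul0r.
  rewrite addnS -(subrK (u (n + k)%N) (u _.+1)) -addrA.
  apply: le_trans (ler_normD _ _) _; apply: le_trans (lerD (ud _) IHk) _.
  rewrite -rmorphD /= lecR exprS.
  suff -> : c ^+ n * (1 - c * c ^+ k) / (1 - c) =
    c ^+ (n + k) + c ^+ n * (1 - c ^+ k) / (1 - c) by [].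
  by rewrite exprD; field; rewrite subr_eq0 gt_eqF.
have c01 : `|c| < 1 by rewrite ger0_norm.
have ucv : cvgn u.
  apply: (@cauchy_rate_cvg _ _ _ (fun n => c ^+ n * (1 - c)^-1)) => [|n m nm].
    by have := cvgM (cvg_expr c01) (cvg_cst (1 - c)^-1); rewrite mul0r; apply.
  rewrite -(subnKC nm); apply: le_trans (um _ _) _; rewrite lecR.
  apply: ler_wpM2r; first by rewrite invr_ge0 subr_ge0 ltW.
  apply: ler_piMr; first exact: exprn_ge0.
  by rewrite gerBl exprn_ge0.
set l := limn u in ucv.
have lc : `|l| <= c%:C.
  apply/ler_addgt0Pr => e e0; have /cvgrPdist_le/(_ _ e0) [N _ hN] := ucv.
  rewrite -(subrK (u N) l) addrC; apply: le_trans (ler_normD _ _) _.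
  by rewrite lerD //; apply: hN => /=.
have ls : star l = l.
  apply: (@norm_cvg_unique _ _ (u @ \oo)) => //=.
  have /(_ l) := star_continuous; move/(cvg_comp _ _ ucv).
  by rewrite (_ : @star R A \o u = u) //; apply/funext => n /=.
have lf : l = f l.
  apply/eqP; rewrite -subr_eq0 -normr_le0; apply/ler_addgt0Pr => e e0.
  have e20 : 0 < e / 2 by rewrite divr_gt0.
  have /cvgrPdist_le/(_ _ e20) [N _ hN] := ucv.
  rewrite add0r (_ : l - f l = (l - u N.+1) + (u N.+1 - f l)); last by rewrite addrA subrK.
  apply: le_trans (ler_normD _ _) _; rewrite (splitr e) lerD //; first by apply: hN => /=.
  rewrite uS distrC; apply: le_trans (fl _ _ lc (un _)) _.
  apply: le_trans (hN N _) => //=.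
  by rewrite -[leRHS]mul1r ler_wpM2r // lecR ltW.
(* Since [2 l = y + l ⋅ l], the square of [1 - l] is [1 - 2 l + l ⋅ l = 1 - y]. *)
exists (cone - l); first by rewrite starB star1 ls.
rewrite cmulBl !cmulBr !cmul1l cmul1r {1 2}lf /f.
move: (l ⋅ l) => m; rewrite opprB -addrA; congr (_ + _).
rewrite addrCA -opprD -scalerDl (_ : 2^-1 + 2^-1 = 1); last first.
  by rewrite [RHS]splitr mul1r.
by rewrite scale1r opprD addrCA subrr addr0.
Qed.

End CStarTheory.

(** * Positive functionals *)

Section PosForm.
Variables (R : realType) (V : lmodType R[i]) (q : V -> V -> R[i]).

Definition pos_form : Prop :=
  [/\ forall x, scalar (q x), forall x y, q y x = (q x y)^* & forall x, 0 <= q x x].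

Hypothesis qP : pos_form.

Let qD x y z : q x (y + z) = q x y + q x z.
Proof. by case: qP => h _ _; exact: scalfunD. Qed.
Let qZ x c y : q x (c *: y) = c * q x y.
Proof. by case: qP => h _ _; exact: scalfunZ. Qed.
Let qC x y : q y x = (q x y)^*. Proof. by case: qP. Qed.
Let q_ge0 x : 0 <= q x x. Proof. by case: qP. Qed.

Lemma pos_formBB x y c : q (y - c *: x) (y - c *: x) =
  q y y - c * q y x - c^* * q x y + c * c^* * q x x.
Proof.
have e a b d : q (a - b *: d) =1 fun z => q a z - b^* * q d z.
  by move=> z; rewrite (qC z) (qC z a) (qC z d) qD -scaleN1r !qZ mulN1r rmorphB rmorphM.
by rewrite e !qD -scaleN1r !qZ; ring.
Qed.

Lemma pos_form_eq0 x y : q x x = 0 -> q x y = 0.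
Proof.
move=> x0; apply/eqP/negPn/negP => b0.
have bn : 0 < q x y * (q x y)^* by rewrite -normCK exprn_gt0 // normr_gt0.
(* The coefficient makes each of the two cross terms equal to [(q y y + 1) / 2], so that the form
   takes the value [-1]. *)
have := q_ge0 (y - ((q y y + 1) / (2 * (q x y)^*) ) *: x).
rewrite pos_formBB x0 mulr0 addr0 (qC x y).
have := q_ge0 y; move: (q y y) => d d0.
have dc : d^* = d by rewrite geC0_conj.
rewrite conjCM conjCV conjCM conjCK conjCD dc rmorph1 rmorph_nat.
have b1 : q x y != 0 by [].
have b2 : (q x y)^* != 0 by rewrite conjC_eq0.
rewrite (_ : _ - _ - _ = - 1); last by field; rewrite b1 b2.
by rewrite ler0N1.
Qed.

Lemma pos_form_CS x y : `|q x y| ^+ 2 <= q x x * q y y.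
Proof.
have [x0|x0] := eqVneq (q x x) 0.
  by rewrite pos_form_eq0 // normr0 expr0n /= x0 mul0r.
have xp : 0 < q x x by rewrite lt_def x0 q_ge0.
have := q_ge0 (y - (q x y / q x x) *: x).
rewrite pos_formBB (qC x y) conjCM conjCV (geC0_conj (q_ge0 x)) normCK.
rewrite (_ : _ - _ - _ + _ = q y y - q x y * (q x y)^* / q x x); last by field.
by rewrite subr_ge0 ler_pdivrMr // [leRHS]mulrC.
Qed.

End PosForm.

Section Schur.
Variables (R : realType) (V W : lmodType R[i]).
Variables (q : V -> V -> R[i]) (r : W -> W -> R[i]).
Hypotheses (qP : pos_form q) (rP : pos_form r).

(* Schur product theorem: one step of Gram-Schmidt in the first variable. *)
Lemma pos_form_tensor (s : seq (V * W)) :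
  0 <= \sum_(u <- s) \sum_(v <- s) q u.1 v.1 * r u.2 v.2.
Proof.
have [qs qC q0] := qP; have [rs rC r0] := rP.
have [n] := ubnP (size s); elim: n s => // n IHn [|[a b] s] /= sn.
  by rewrite big_nil.
rewrite big_cons big_cons /=.
have -> : \sum_(u <- s) \sum_(v <- (a, b) :: s) q u.1 v.1 * r u.2 v.2 =
  \sum_(u <- s) q u.1 a * r u.2 b + \sum_(u <- s) \sum_(v <- s) q u.1 v.1 * r u.2 v.2.
  by rewrite -big_split; apply: eq_bigr => u _; rewrite big_cons.
have [a0|a0] := eqVneq (q a a) 0.
  rewrite a0 mul0r add0r big1 => [|u _]; last by rewrite (pos_form_eq0 qP) // mul0r.
  rewrite add0r big1 => [|u _]; last by rewrite (qC a) (pos_form_eq0 qP) // rmorph0 mul0r.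
  by rewrite add0r; exact: IHn.
(* Subtracting [c u *: a] makes [u.1] orthogonal to [a]; the subtracted tensors join [a (x) b] and
   form [a (x) b']. *)
pose c (u : V * W) := q a u.1 / q a a.
pose b' := b + \sum_(u <- s) c u *: u.2.
have rl x y z : r (x + y) z = r x z + r y z.
  by rewrite (rC z) (rC z x) (rC z y) (scalfunD (rs z)) rmorphD.
have rlZ t x z : r (t *: x) z = t^* * r x z.
  by rewrite (rC z) (rC z x) (scalfunZ (rs z)) rmorphM.
have rl0 z : r 0 z = 0 by rewrite (rC z) (scalfun0 (rs z)) rmorph0.
have rb x : r b' x = r b x + \sum_(u <- s) (c u)^* * r u.2 x.
  rewrite rl; congr (_ + _).
  by elim: (s) => [|u l IH]; rewrite ?big_nil ?rl0 // !big_cons rl IH rlZ.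
have rb' x : r x b' = r x b + \sum_(u <- s) c u * r x u.2.
  rewrite (scalfunD (rs x)) (scalfun_sum (rs x)); congr (_ + _).
  by apply: eq_bigr => u _; rewrite (scalfunZ (rs x)).
have qc u : q a u.1 = q a a * c u by rewrite mulrC divfK.
have qc' u : q u.1 a = q a a * (c u)^*.
  by rewrite (qC a) qc conjCM (geC0_conj (q0 a)).
have -> : q a a * r b b + \sum_(u <- s) q a u.1 * r b u.2 +
   (\sum_(u <- s) q u.1 a * r u.2 b + \sum_(u <- s) \sum_(v <- s) q u.1 v.1 * r u.2 v.2)
  = q a a * r b' b' + \sum_(u <- [seq (v.1 - c v *: a, v.2) | v <- s])
      \sum_(v <- [seq (v.1 - c v *: a, v.2) | v <- s]) q u.1 v.1 * r u.2 v.2.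
  rewrite big_map rb rb' mulrDr mulrDr -!addrA; congr (_ + _).
  rewrite mulr_sumr (eq_bigr (fun u => q a a * (c u * r b u.2))); last first.
    by move=> u _; rewrite qc mulrA.
  congr (_ + _); rewrite mulr_sumr -!big_split; apply: eq_bigr => u _ /=.
  rewrite big_map rb' qc' !mulrDr !mulr_sumr -!addrA -big_split /=.
  rewrite mulrA; congr (_ + _); apply: eq_bigr => v _ /=.
  have -> : q (u.1 - c u *: a) (v.1 - c v *: a) = q u.1 v.1 - q a a * (c u)^* * c v.
    rewrite (scalfunB (qs _)) (scalfunZ (qs _)).
    have ql x y z : q (x - c u *: y) z = q x z - (c u)^* * q y z.
      by rewrite (qC z) (qC z x) (qC z y) (scalfunB (qs z)) (scalfunZ (qs z)) rmorphB rmorphM.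
    by rewrite !ql qc qc'; ring.
  by ring.
by rewrite addr_ge0 ?mulr_ge0 //; apply: IHn; rewrite size_map.
Qed.

End Schur.

Section PositiveFunctional.
Variables (R : realType) (A : cstarAlgType R) (f : A -> R[i]).
Hypothesis fP : positive_functional f.

(** Expanding [f] at the square of [1 + b] shows that [f (star b) + f b] is real; the cases [b = a]
    and [b = 'i *: a] compare the imaginary and the real parts. *)
Lemma posfun_star a : f (star a) = (f a)^*.
Proof.
have [fl f0] := fP.
have h b : (f (star b) + f b)^* = f (star b) + f b.
  have := f0 (cone + b); have := f0 b; have := f0 cone.
  rewrite starD star1 cmulDl !cmulDr !cmul1l !cmul1r !(scalfunD fl).
  move=> h1 h2 h3.
  have : f (star b) + f b \is Num.real.
    rewrite (_ : _ + _ = f cone + f b + (f (star b) + f (star b ⋅ b)) - f cone - f (star b ⋅ b)).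
      by rewrite !rpredB // ger0_real.
    by ring.
  by move/CrealP.
have h1 := h a; have h2 := h ('i *: a).
move: h2; rewrite starZ !(scalfunZ fl); move: h1.
case: (f a) (f (star a)) => x y [x' y'] /= [h1] [h2].
by congr (_ +i* _); move: h1 h2; lra.
Qed.

Lemma posfun_form : pos_form (fun x y => f (star x ⋅ y)).
Proof.
have [fl f0] := fP; split=> [x c y z|x y|x //].
  by rewrite cmulDr cmulZr fl.
by rewrite -posfun_star starM starK.
Qed.

Lemma posfun1_ge0 : 0 <= f cone.
Proof. by have [_ /(_ cone)] := fP; rewrite star1 cmul1l. Qed.

(** When the norm of [b] is less than 1, [1 - star b ⋅ b] is the square of a self-adjoint element,
    on which [f] is nonnegative. The general case follows by scaling. *)
Lemma posfun_bound_sqr a : f (star a ⋅ a) <= `|a| ^+ 2 * f cone.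
Proof.
have [fl f0] := fP.
have h b : `|b| < 1 -> f (star b ⋅ b) <= f cone.
  move=> b1; have [||r rs rr] := @sqrt_one_minus _ _ (star b ⋅ b).
  - by rewrite starM starK.
  - by rewrite cnorm_star expr_lt1.
  by rewrite -subr_ge0 -(scalfunB fl) -rr -{1}rs.
have [->|a0] := eqVneq a 0; first by rewrite cmul0r (scalfun0 fl) normr0 expr0n /= mul0r.
have [n n0 nE] := norm_complex a; have [X X0 XE] := ge0_complex (f0 a).
have [F F0 FE] := ge0_complex posfun1_ge0.
have np : 0 < n by rewrite -ltcR -nE normr_gt0.
rewrite XE nE FE -rmorphXn -rmorphM lecR leNgt; apply/negP => lt.
have Xp : 0 < X by apply: le_lt_trans lt; rewrite mulr_ge0 // sqr_ge0.
pose m := n ^+ 2 * F / X.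
have m1 : m < 1 by rewrite ltr_pdivrMr // mul1r.
have m0 : 0 <= m by rewrite divr_ge0 // mulr_ge0 // sqr_ge0.
(* Scaling [a] to norm [t < 1] yields [t ^+ 2 <= m], which contradicts
   [t ^+ 2 - m = (1 - m) ^+ 2 / 4 > 0]. *)
pose t := (1 + m) / 2.
have t0 : 0 <= t by rewrite /t; lra.
have := h ((t / n)%:C *: a).
rewrite normrZ nE.
rewrite [X in X * _]ger0_norm; last by rewrite ler0c divr_ge0.
rewrite -realCM divfK ?gt_eqF //.
rewrite -[1]/(1%:C) ltcR (_ : t < 1); last by rewrite /t; lra.
move/(_ isT); rewrite starZ cmulZl cmulZr scalerA (scalfunZ fl) XE FE.
rewrite (_ : ((t / n)%:C^*)%R = (t / n)%:C); last by rewrite geC0_conj // ler0c divr_ge0.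
rewrite -!realCM lecR mulf_div mulrAC ler_pdivrMr ?mulr_gt0 //.
move=> h'; have : t * t <= m by rewrite /m ler_pdivlMr // expr2 [leRHS]mulrC.
have : 0 < (1 - m) ^+ 2 by rewrite exprn_gt0 // subr_gt0.
rewrite (_ : t * t = m + (1 - m) ^+ 2 / 4); last by rewrite /t; field.
by move=> d0; rewrite gerDl pmulr_rle0 // leNgt invr_gt0 ltr0n.
Qed.

Lemma posfun_bound a : `|f a| <= f cone * `|a|.
Proof.
have := pos_form_CS posfun_form cone a.
rewrite star1 !cmul1l => h.
rewrite -(@ler_pXn2r _ 2) ?nnegrE ?mulr_ge0 ?posfun1_ge0 //.
apply: le_trans h _; rewrite exprMn expr2 -mulrA ler_wpM2l ?posfun1_ge0 //.
by rewrite mulrC posfun_bound_sqr.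
Qed.

Lemma posfun_continuous : continuous (f : A -> R[i]^o).
Proof.
apply: (@bounded_continuous _ _ R[i]^o _ (f cone)) => [x y|x]; last exact: posfun_bound.
by rewrite (scalfunB fP.1).
Qed.

End PositiveFunctional.

(** Nonnegativity is the equality of [f] with its absolute value, and equalities of continuous maps
    pass to the closure. *)
Lemma ge0_closure (R : realType) (V : normedModType R[i]) (D : set V)
    (f : V -> R[i]^o) x :
  continuous f -> (forall d, D d -> 0 <= f d) -> closure D x -> 0 <= f x.
Proof.
move=> fc h Dx; have nc : continuous (fun x => `|f x| : R[i]^o).
  by move=> z; apply: continuous_comp; [exact: fc|exact: norm_continuous].
rewrite (continuous_eq_closure fc nc _ Dx) ?normr_ge0 // => d /h h0.
by rewrite ger0_norm.
Qed.

(** * Tensor products and slice maps *)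

(** Extension by continuity for a map known only through its graph. Tensors are represented by lists
    in many ways, so a formula on lists defines no function at first; the bound is what makes the
    relation single-valued. *)
Lemma bounded_relation_ext (R : realType) (V : normedModType R[i])
    (W : completeNormedModType R[i]) (L : V -> W -> Prop) (K : R[i]) :
  0 <= K ->
  (forall c v w v' w', L v w -> L v' w' -> L (c *: v + v') (c *: w + w')) ->
  (forall v w, L v w -> `|w| <= K * `|v|) ->
  (forall v, closure [set v | exists w, L v w] v) ->
  exists2 s : V -> W, linear s /\ continuous s & forall v w, L v w -> s v = w.
Proof.
move=> K0 Ll Lb Ld.
have LB v w v' w' : L v w -> L v' w' -> `|w - w'| <= K * `|v - v'|.
  move=> h h'; apply: Lb; rewrite -(scaleN1r v') -(scaleN1r w') addrC [w + _]addrC.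
  exact: Ll.
have L00 : L 0 0.
  have /closure_approxP /(_ 1 ltr01)[d [w h] _] := Ld 0.
  by have := Ll (-1) _ _ _ _ h h; rewrite !scaleN1r !addNr.
(* The value at [v] is pinned down by its distance to every related [w']; linearity follows from
   this estimate without returning to sequences. *)
have ex v : exists l, forall v' w', L v' w' -> `|l - w'| <= K * `|v - v'|.
  have h n : {u : V * W | L u.1 u.2 & `|v - u.1| < (n.+1%:R^-1)%:C}.
    apply: cid2; have /closure_approxP /(_ (n.+1%:R^-1)%:C) := Ld v.
    by rewrite ltcR invr_gt0 ltr0n => /(_ isT)[d [w Ldw] vd]; exists (d, w).
  pose u n := s2val (h n).
  have uL n : L (u n).1 (u n).2 by rewrite /u; case: (h n).
  have uv n : `|v - (u n).1| < (n.+1%:R^-1)%:C by rewrite /u; case: (h n).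
  have [k k0 Kk] := ge0_complex K0.
  have ucv : cvgn (fun n => (u n).2).
    apply: (@cauchy_rate_cvg _ _ _ (fun n => (k * 2) * n.+1%:R^-1)) => [|n m nm].
      by have := cvgM (cvg_cst (k * 2)) (@cvg_harmonic R); rewrite mulr0; apply.
    apply: le_trans (LB _ _ _ _ (uL m) (uL n)) _.
    rewrite Kk -mulrA realCM ler_wpM2l ?ler0c //.
    rewrite (_ : _ - _ = (v - (u n).1) - (v - (u m).1)); last first.
      by rewrite opprB [RHS]addrC subrKA.
    apply: le_trans (ler_normB _ _) _; rewrite mulr_natl mulr2n rmorphD /=.
    apply: lerD; first exact/ltW/uv.
    apply: le_trans (ltW (uv _)) _; rewrite lecR lef_pV2 ?posrE ?ltr0n //.
    by rewrite ler_nat.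
  exists (limn (fun n => (u n).2)) => v' w' L'.
  apply/ler_addgt0Pr => e e0.
  have e20 : 0 < e / 2 by rewrite divr_gt0.
  have [r r0 er] := gt0_complex e20.
  have /cvgrPdist_le/(_ _ e20) [N _ hN] := ucv.
  have : (k * n.+1%:R^-1) @[n --> \oo] --> (0 : R).
    by have := cvgM (cvg_cst k) (@cvg_harmonic R); rewrite mulr0; apply.
  move=> /cvgr0Pnorm_le /(_ _ r0) [N' _ hN'].
  pose n := maxn N N'.
  have h1 := hN n (leq_maxl _ _); have h2 := hN' n (leq_maxr _ _).
  rewrite -(subrK (u n).2 (limn _)) -addrA; apply: le_trans (ler_normD _ _) _.
  rewrite [in leRHS](splitr e) [in leRHS]addrC -[in leRHS]addrA lerD //.
  apply: le_trans (LB _ _ _ _ (uL n) L') _.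
  have -> : (u n).1 - v' = ((u n).1 - v) + (v - v') by rewrite subrKA.
  apply: le_trans (ler_wpM2l K0 (ler_normD _ _)) _; rewrite mulrDr lerD2r distrC.
  apply: le_trans (ler_wpM2l K0 (ltW (uv _))) _.
  by rewrite er Kk -realCM lecR; apply: le_trans (ler_norm _) h2.
pose s v := projT1 (cid (ex v)).
have sP v v' w' : L v' w' -> `|s v - w'| <= K * `|v - v'|.
  by rewrite /s; case: cid => l /= h; exact: h.
have sb v : `|s v| <= K * `|v| by have := sP v _ _ L00; rewrite !subr0.
have sl : linear s.
  move=> c x y; apply/eqP; rewrite -subr_eq0 -normr_le0; apply/ler_addgt0Pr => e e0.
  rewrite add0r.
  (* Two errors will occur, each at most [(K + 1) (|c| + 1) (e / m) = e / 2]. *)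
  pose m := 2 * (K + 1) * (`|c| + 1).
  have c1 : 0 < `|c| + 1 by rewrite ltr_wpDl.
  have k1 : 0 < K + 1 by rewrite ltr_wpDl.
  have m0 : 0 < m by rewrite !mulr_gt0.
  have d0 : 0 < e / m by rewrite divr_gt0.
  have /closure_approxP /(_ _ d0)[x' [wx Lx] hx] := Ld x.
  have /closure_approxP /(_ _ d0)[y' [wy Ly] hy] := Ld y.
  have h1 := sP (c *: x + y) _ _ (Ll c _ _ _ _ Lx Ly).
  have h2 := sP x _ _ Lx; have h3 := sP y _ _ Ly.
  rewrite (_ : _ - _ = (s (c *: x + y) - (c *: wx + wy)) - (c *: (s x - wx) + (s y - wy))); last first.
    have -> : c *: (s x - wx) + (s y - wy) = (c *: s x + s y) - (c *: wx + wy).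
      by rewrite scalerBr addrACA -opprD.
    by rewrite opprB subrKA.
  have b (u v : W) w z : `|u| <= K * w -> `|v| <= K * z -> `|c *: u + v| <= K * (`|c| * w + z).
    move=> hu hv; apply: le_trans (ler_normD _ _) _; rewrite normrZ mulrDr mulrCA.
    by rewrite lerD // ler_wpM2l.
  have {}h2 := b _ _ _ _ h2 h3.
  have {}h1 : `|s (c *: x + y) - (c *: wx + wy)| <= K * (`|c| * `|x - x'| + `|y - y'|).
    apply: le_trans h1 _; rewrite ler_wpM2l // opprD addrACA -scalerBr.
    by apply: le_trans (ler_normD _ _) _; rewrite normrZ.
  apply: le_trans (ler_normB _ _) _; apply: le_trans (lerD h1 h2) _.
  have h4 : `|c| * `|x - x'| + `|y - y'| <= (`|c| + 1) * (e / m).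
    by rewrite mulrDl mul1r lerD ?ler_wpM2l // ltW.
  have h5 : K * (`|c| * `|x - x'| + `|y - y'|) <= (K + 1) * ((`|c| + 1) * (e / m)).
    apply: le_trans (ler_wpM2l K0 h4) _; rewrite ler_wpM2r ?lerDl //.
    by rewrite mulr_ge0 // ltW.
  apply: le_trans (lerD h5 h5) _; rewrite le_eqVlt; apply/orP; left; apply/eqP.
  by rewrite /m; field; rewrite !gt_eqF.
exists s.
  split=> //; apply: (@bounded_continuous _ _ _ _ K) => // x y.
  exact: linfunB.
move=> v w Lw; apply/eqP; rewrite -subr_eq0 -normr_le0.
by have := sP v _ _ Lw; rewrite subrr normr0 mulr0.
Qed.

Section Tensor.
Variables (R : realType) (A B T : cstarAlgType R) (t : tensor_product A B T).

Lemma gns_form_ge0 (f : A -> R[i]) (g : B -> R[i]) (s : seq (A * B)) :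
  positive_functional f -> positive_functional g -> 0 <= gns_form f g s.
Proof.
by move=> fP gP; exact: (pos_form_tensor (posfun_form fP) (posfun_form gP)).
Qed.

Lemma tens_mul1 (u : A * B) s :
  tens_mul [:: u] s = [seq (u.1 ⋅ v.1, u.2 ⋅ v.2) | v <- s].
Proof. by rewrite /tens_mul /= cats0. Qed.

(** It suffices to bound [a (x) 1] and [1 (x) b]. For fixed [f], [g] and [s], letting [c] act on one
    leg of [s] defines a positive functional [k] of [c], and [posfun_bound_sqr] for [k] is exactly
    the spatial bound. *)
Lemma norm_tens_le (a : A) (b : B) : `|t a b| <= `|a| * `|b|.
Proof.
have -> : t a b = t a cone ⋅ t cone b by rewrite tensM cmul1r cmul1l.
have sE u : tens_sum t [:: u] = t u.1 u.2 by rewrite /tens_sum big_seq1.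
apply: le_trans (cnormM _ _) _; apply: ler_pM => //.
- rewrite -(sE (a, cone)); apply: tens_norm_le => // f g fP gP s.
  pose k c := \sum_(u <- s) \sum_(v <- s) f (star u.1 ⋅ (c ⋅ v.1)) * g (star u.2 ⋅ v.2).
  have kE c : gns_form f g (tens_mul [:: (c, cone)] s) = k (star c ⋅ c).
    rewrite /gns_form tens_mul1 big_map; apply: eq_bigr => u _.
    rewrite big_map; apply: eq_bigr => v _ /=.
    by rewrite !cmul1l starM !cmulA.
  have kP : positive_functional k.
    split=> [c x y|c]; last by rewrite -kE gns_form_ge0.
    rewrite /k mulr_sumr -big_split; apply: eq_bigr => u _.
    rewrite mulr_sumr -big_split; apply: eq_bigr => v _ /=.
    by rewrite cmulDl cmulZl cmulDr cmulZr fP.1 mulrDl mulrA.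
  rewrite kE (_ : gns_form f g s = k cone); first exact: posfun_bound_sqr.
  by apply: eq_bigr => u _; apply: eq_bigr => v _; rewrite cmul1l.
- rewrite -(sE (cone, b)); apply: tens_norm_le => // f g fP gP s.
  pose k c := \sum_(u <- s) \sum_(v <- s) f (star u.1 ⋅ v.1) * g (star u.2 ⋅ (c ⋅ v.2)).
  have kE c : gns_form f g (tens_mul [:: (cone, c)] s) = k (star c ⋅ c).
    rewrite /gns_form tens_mul1 big_map; apply: eq_bigr => u _.
    rewrite big_map; apply: eq_bigr => v _ /=.
    by rewrite !cmul1l starM !cmulA.
  have kP : positive_functional k.
    split=> [c x y|c]; last by rewrite -kE gns_form_ge0.
    rewrite /k mulr_sumr -big_split; apply: eq_bigr => u _.
    rewrite mulr_sumr -big_split; apply: eq_bigr => v _ /=.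
    by rewrite cmulDl cmulZl cmulDr cmulZr gP.1 mulrDr mulrCA.
  rewrite kE (_ : gns_form f g s = k cone); first exact: posfun_bound_sqr.
  by apply: eq_bigr => u _; apply: eq_bigr => v _; rewrite cmul1l.
Qed.

Lemma tens_continuousr a : continuous (t a).
Proof.
apply: (@bounded_continuous _ _ _ _ `|a|) => [x y|x]; last exact: norm_tens_le.
exact: (linfunB (tens_linearr t a)).
Qed.

Lemma tens_continuousl b : continuous (t^~ b).
Proof.
apply: (@bounded_continuous _ _ _ _ `|b|) => [x y|x].
  exact: (linfunB (tens_linearl t b)).
by rewrite mulrC norm_tens_le.
Qed.

Lemma tens_linear_eq (W : normedModType R[i]) (f g : T -> W) :
  linear f -> linear g -> continuous f -> continuous g ->
  (forall a b, f (t a b) = g (t a b)) -> f =1 g.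
Proof.
move=> fl gl fc gc h x.
apply: (@continuous_eq_closure _ _ _ _ _ (range (tens_sum t))) => //.
  by move=> _ [s _ <-]; rewrite /tens_sum !linfun_sum //; apply: eq_bigr.
by rewrite tens_dense.
Qed.

Lemma slicel_unique w s s' : is_slicel t w s -> is_slicel t w s' -> s =1 s'.
Proof.
move=> [sl sc sE] [s'l s'c s'E].
by apply: tens_linear_eq => // a b; rewrite sE s'E.
Qed.

Lemma slicel_tens_mull w s x : is_slicel t w s ->
  is_slicel t (fun a => w (x ⋅ a)) (fun z => s (t x cone ⋅ z)).
Proof.
move=> [sl sc sE]; split=> [c y z|z|a b].
- by rewrite cmulDr cmulZr sl.
- by apply: continuous_comp; [exact: cmul_continuousr|exact: sc].
- by rewrite tensM cmul1l sE.
Qed.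

Lemma slicel_tens_mulr w s y z : is_slicel t w s ->
  s (t cone y ⋅ z) = y ⋅ s z.
Proof.
move=> [sl sc sE]; apply: (tens_linear_eq (f := fun z => s (t cone y ⋅ z))
    (g := fun z => y ⋅ s z)).
- by move=> c u v; rewrite cmulDr cmulZr sl.
- by move=> c u v; rewrite sl cmulDr cmulZr.
- by move=> u; apply: continuous_comp; [exact: cmul_continuousr|exact: sc].
- by move=> u; apply: continuous_comp; [exact: sc|exact: cmul_continuousr].
- by move=> a b; rewrite tensM cmul1l !sE cmulZr.
Qed.

End Tensor.

Lemma scale_continuous (R : realType) (V : normedModType R[i]) (c : R[i]) :
  continuous (fun x : V => c *: x).
Proof.
apply: (@bounded_continuous _ _ _ _ `|c|) => [x y|x]; first by rewrite scalerBr.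
by rewrite normrZ.
Qed.

Lemma star_cmul_continuous (R : realType) (A : cstarAlgType R) :
  continuous (fun x : A => star x ⋅ x).
Proof.
move=> x; apply/cvgrPdist_lt => e e0.
have k0 : 0 < 2 * (`|x| + 1) by rewrite mulr_gt0 // ltr_wpDl.
near=> y.
have h1 : `|x - y| < 1.
  by near: y; apply: cvgr_dist_lt; [exact: cvg_id|].
have h2 : `|x - y| < e / (2 * (`|x| + 1)).
  by near: y; apply: cvgr_dist_lt; [exact: cvg_id|rewrite divr_gt0].
have yx : `|y| <= `|x| + 1.
  rewrite (_ : y = x - (x - y)); last by rewrite opprB addrC subrK.
  by apply: le_trans (ler_normB _ _) _; rewrite lerD2l ltW.
rewrite (_ : _ - _ = star (x - y) ⋅ x + star y ⋅ (x - y)); last first.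
  by rewrite starB cmulBl cmulBr addrA subrK.
apply: le_lt_trans (ler_normD _ _) _.
have h3 : `|star (x - y) ⋅ x| <= `|x - y| * (`|x| + 1).
  apply: le_trans (cnormM _ _) _; rewrite norm_star ler_wpM2l //.
  by rewrite lerDl.
have h4 : `|star y ⋅ (x - y)| <= `|x - y| * (`|x| + 1).
  by apply: le_trans (cnormM _ _) _; rewrite norm_star mulrC ler_wpM2l.
apply: le_lt_trans (lerD h3 h4) _.
by rewrite -mulr2n -mulr_natl mulrCA -ltr_pdivlMr.
Unshelve. all: by end_near. Qed.

(** * Slicing the first leg of a triple tensor product *)

Section TripleSlice.
Variables (R : realType) (A1 A2 B A12 T T3 : cstarAlgType R).
Variables (t : tensor_product A1 A2 A12) (tB : tensor_product A2 B T).
Variables (tl : tensor_product A12 B T3) (tr : tensor_product A1 T T3).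
Hypothesis tA : tens_assoc t tB tl tr.
Variables (phi : A1 -> R[i]) (sg : A12 -> A2).
Hypotheses (phiP : positive_functional phi) (phi1 : phi cone = 1).
Hypothesis sgP : is_slicel t phi sg.

(** On a sum of elementary tensors the value at [star x ⋅ x] is the form [gns_form phi f],
    nonnegative by the Schur product theorem; density does the rest. *)
Lemma posfun_comp_slicel (f : A2 -> R[i]) :
  positive_functional f -> positive_functional (f \o sg).
Proof.
move=> fP; have [sl sc sE] := sgP.
split=> [c x y|x] /=; first by rewrite sl fP.1.
apply: (@ge0_closure _ _ (range (tens_sum t)) (fun x => f (sg (star x ⋅ x)))).
- move=> y; apply: (@continuous_comp _ _ R[i]^o (fun x => sg (star x ⋅ x)) f).
    apply: (@continuous_comp _ _ _ (fun x => star x ⋅ x) sg).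
      exact: star_cmul_continuous.
    exact: sc.
  exact: posfun_continuous.
- move=> _ [s _ <-]; suff -> : f (sg (star (tens_sum t s) ⋅ tens_sum t s)) =
    gns_form phi f s by apply: gns_form_ge0.
  rewrite /tens_sum /gns_form star_sum cmul_suml (linfun_sum sl) (scalfun_sum fP.1).
  apply: eq_bigr => u _; rewrite cmul_sumr (linfun_sum sl) (scalfun_sum fP.1).
  apply: eq_bigr => v _; rewrite tens_star tensM sE.
  by rewrite (scalfunZ fP.1).
- by rewrite tens_dense.
Qed.

(** Slicing decreases the form. The difference of the two sides is the form of the centred list,
    with [u.1 - phi u.1 *: cone] in the place of [u.1]: as [phi cone = 1], the products then yield
    the covariance of [phi]. *)
Let slice_form_le f g (r : seq (A1 * (A2 * B))) :
  positive_functional f -> positive_functional g ->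
  gns_form f g [seq (phi u.1 *: u.2.1, u.2.2) | u <- r] <=
  gns_form (f \o sg) g [seq (t u.1 u.2.1, u.2.2) | u <- r].
Proof.
move=> fP gP; have [sl sc sE] := sgP.
have := gns_form_ge0 [seq (t (u.1 - phi u.1 *: cone) u.2.1, u.2.2) | u <- r]
   (posfun_comp_slicel fP) gP.
rewrite -[_ <= gns_form _ _ _]subr_ge0; set X := (X in 0 <= X -> _).
set Y := (Y in _ -> 0 <= Y); suff -> : Y = X by [].
rewrite /X /Y /gns_form !big_map -sumrB.
apply: eq_bigr => u _; rewrite !big_map -sumrB; apply: eq_bigr => v _ /=.
rewrite -mulrBl; congr (_ * _).
rewrite !tens_star !tensM !sE starB !starZ star1.
rewrite cmulZl cmulZr !(scalfunZ fP.1) mulrA -mulrBl; congr (_ * _).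
rewrite cmulBl !cmulBr !cmulZl cmulZr cmul1l cmulZr cmul1l cmul1r.
rewrite !(scalfunB phiP.1) !(scalfunZ phiP.1) (posfun_star phiP) phi1.
by ring.
Qed.

(** Graph of the slice map on algebraic tensors. They are bracketed to the left because the test
    functionals [f \o sg] live on [A12]. *)
Let rel (v : T3) (w : T) := exists2 r : seq (A1 * (A2 * B)),
  v = tens_sum tl [seq (t u.1 u.2.1, u.2.2) | u <- r] &
  w = tens_sum tB [seq (phi u.1 *: u.2.1, u.2.2) | u <- r].

Let rel_linear c v w v' w' : rel v w -> rel v' w' -> rel (c *: v + v') (c *: w + w').
Proof.
move=> [r -> ->] [r' -> ->]; exists ([seq (c *: u.1, u.2) | u <- r] ++ r').
  rewrite /tens_sum !big_map big_cat big_map scaler_sumr; congr (_ + _).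
  apply: eq_bigr => u _ /=.
  by rewrite (linfunZ (tens_linearl t _)) (linfunZ (tens_linearl tl _)).
rewrite /tens_sum !big_map big_cat big_map scaler_sumr; congr (_ + _).
apply: eq_bigr => u _ /=.
by rewrite (scalfunZ phiP.1) -scalerA [in RHS](linfunZ (tens_linearl tB _)).
Qed.

(** Putting [cone] in front embeds a test list of [A2 (x) B] into the triple product without
    changing its form, because [phi cone = 1]. There the norm of [v] bounds the action of [v], and
    slicing back only decreases the form. *)
Let rel_bound v w : rel v w -> `|w| <= 1 * `|v|.
Proof.
move=> [r -> ->]; have [sl sc sE] := sgP.
rewrite mul1r; apply: tens_norm_le => // f g fP gP s.
have -> : gns_form f g s = gns_form (f \o sg) g [seq (t cone u.1, u.2) | u <- s].
  rewrite /gns_form big_map; apply: eq_bigr => u _; rewrite big_map.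
  apply: eq_bigr => u' _ /=; congr (_ * _).
  by rewrite tens_star tensM sE star1 cmul1l phi1 scale1r.
have h := @tens_norm_bound _ _ _ _ tl [seq (t u.1 u.2.1, u.2.2) | u <- r] _ _
  (posfun_comp_slicel fP) gP [seq (t cone u.1, u.2) | u <- s].
apply: le_trans h.
pose r' := [seq (u.1, (u.2.1 ⋅ v.1, u.2.2 ⋅ v.2)) | u <- r, v <- s].
have -> : tens_mul [seq (phi u.1 *: u.2.1, u.2.2) | u <- r] s =
    [seq (phi u.1 *: u.2.1, u.2.2) | u <- r'].
  rewrite /tens_mul allpairs_mapl map_allpairs; apply: eq_allpairs => u' v' /=.
  by rewrite cmulZl.
have -> : tens_mul [seq (t u.1 u.2.1, u.2.2) | u <- r] [seq (t cone u.1, u.2) | u <- s] =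
    [seq (t u.1 u.2.1, u.2.2) | u <- r'].
  rewrite /tens_mul allpairs_mapl allpairs_mapr map_allpairs.
  by apply: eq_allpairs => u' v' /=; rewrite tensM cmul1r.
exact: slice_form_le.
Qed.

Let rel_dense v : closure [set v | exists w, rel v w] v.
Proof.
set D := [set _ | _].
have DD x y : closure D x -> closure D y -> closure D (x + y).
  move=> /closure_approxP hx /closure_approxP hy; apply/closure_approxP => e e0.
  have e20 : 0 < e / 2 by rewrite divr_gt0.
  have [x' [wx Dx] xx'] := hx _ e20; have [y' [wy Dy] yy'] := hy _ e20.
  exists (x' + y').
    by exists (1 *: wx + wy); rewrite -(scale1r x'); exact: rel_linear.
  rewrite opprD addrACA (splitr e); apply: le_lt_trans (ler_normD _ _) _.
  by rewrite ltrD.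
(* Density is available for the other bracketing, [A1 (x) (A2 (x) B)]; associativity brings
   elementary tensors back to the form used in [rel]. *)
have Dt a z : closure D (tr a z).
  have : closure (range (tens_sum tB)) z by rewrite tens_dense.
  move=> h U /(tens_continuousr (a := a)) /h [_ [[s _ <-] Us]].
  exists (tr a (tens_sum tB s)); split=> //.
  pose r := [seq (a, u) | u <- s].
  exists (tens_sum tB [seq (phi u.1 *: u.2.1, u.2.2) | u <- r]); exists r => //.
  rewrite /tens_sum !big_map (linfun_sum (tens_linearr tr a)).
  by apply: eq_bigr => u _ /=; rewrite tA.
have Ds (s : seq (A1 * T)) : closure D (tens_sum tr s).
  elim: s => [|u s IHs]; last by rewrite /tens_sum big_cons; exact: DD.
  apply: subset_closure; rewrite /tens_sum big_nil; exists 0; exists [::];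
  by rewrite /tens_sum big_nil.
apply/closure_approxP => e e0; have e20 : 0 < e / 2 by rewrite divr_gt0.
have /closure_approxP /(_ _ e20)[_ [s _ <-] vs] : closure (range (tens_sum tr)) v.
  by rewrite tens_dense.
have /closure_approxP /(_ _ e20)[d Dd sd] := Ds s; exists d => //.
rewrite -(subrKA (tens_sum tr s)) (splitr e); apply: le_lt_trans (ler_normD _ _) _.
by rewrite ltrD.
Qed.

(* A slice map with values in a tensor product is bounded because the norm of *)
(* the latter is determined by product functionals [f (x) g], and slicing     *)
(* turns them into the functionals [(f \o sg) (x) g] of [T3].                 *)
Lemma slicel_triple : exists s, is_slicel tr phi s.
Proof.
have [s [sl sc] sE] := bounded_relation_ext ler01 rel_linear rel_bound rel_dense.
exists s; split=> // a z.
apply: (@tens_linear_eq _ _ _ _ tB _ (fun z => s (tr a z)) (fun z => phi a *: z)).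
- by move=> c x y; rewrite (tens_linearr tr) sl.
- by move=> c x y; rewrite scalerDr !scalerA mulrC.
- by move=> x; apply: continuous_comp; [exact: tens_continuousr|exact: sc].
- exact: scale_continuous.
move=> x y; rewrite -tA -(linfunZ (tens_linearl tB y)); apply: sE.
by exists [:: (a, (x, y))]; rewrite /tens_sum big_map big_seq1.
Qed.

End TripleSlice.

(** * Strong invariance and invariant elements *)

Section LinSpan.
Variables (R : realType) (V : normedModType R[i]) (S : set V).

Lemma lin_span0 : lin_span S 0.
Proof. by exists [::]; split=> //; rewrite big_nil. Qed.

Lemma lin_span_incl x : S x -> lin_span S x.
Proof.
move=> Sx; exists [:: (1, x)]; rewrite big_seq1 scale1r; split=> // u.
by rewrite inE => /eqP ->.
Qed.

Lemma lin_spanZD c x y : lin_span S x -> lin_span S y -> lin_span S (c *: x + y).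
Proof.
move=> [s [sS ->]] [s' [s'S ->]]; exists ([seq (c * u.1, u.2) | u <- s] ++ s').
split=> [u|].
  by rewrite mem_cat => /orP[/mapP[v /sS Sv ->]|/s'S].
rewrite big_cat big_map scaler_sumr; congr (_ + _).
by apply: eq_bigr => u _; rewrite scalerA.
Qed.

Lemma lin_span_sum I (r : seq I) (c : I -> R[i]) (F : I -> V) :
  (forall i, lin_span S (F i)) -> lin_span S (\sum_(i <- r) c i *: F i).
Proof.
move=> h; elim: r => [|i r IHr]; first by rewrite big_nil; exact: lin_span0.
by rewrite big_cons; exact: lin_spanZD.
Qed.

End LinSpan.

Section Haar.
Variables (R : realType) (G : compact_quantum_group R) (phi : G -> R[i]).
Hypotheses (phiH : haar_state phi) (phiF : faithful phi).

Lemma haar_posfun : positive_functional phi. Proof. by case: phiH. Qed.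
Lemma haar1 : phi cone = 1. Proof. by case: phiH. Qed.
Let phil : scalar phi. Proof. by case: haar_posfun. Qed.

(** [haar_state] provides a slice map for each element separately; uniqueness of slice maps merges
    them into one. *)
Lemma haar_slicel_ex : exists2 s, is_slicel (qtens G) phi s &
  forall a, s (Delta a) = phi a *: cone.
Proof.
have [_ _ h _] := phiH; have [s sP s1] := h cone; exists s => // a.
have [s' s'P <-] := h a; exact: (slicel_unique sP s'P).
Qed.

Lemma matrix_coefficients1 : matrix_coefficients (cone : G).
Proof.
apply: lin_span_incl; exists 1%N, (const_mx cone); split; last by exists 0, 0; rewrite mxE.
  have [_ _ _ D1] := Delta_hom G.
  by split=> i j; rewrite !big_ord1 !mxE ?tens_one ?star1 ?cmul1l ?D1 // !ord1 eqxx.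
split=> // P PP _; have P0 : P 0 0 * P 0 0 = P 0 0 by rewrite -[in RHS]PP mxE big_ord1.
have [z|z] := eqVneq (P 0 0) 0; [left|right]; apply/matrixP => i j; rewrite !ord1 mxE //.
by rewrite eqxx; apply: (mulfI z); rewrite P0 mulr1.
Qed.

Section Corep.
Variables (d : nat) (u : 'M[G]_d).
Hypothesis uP : unitary_corep_mx u.

(** Gram matrix of the rows of [u]. It would be the identity if the algebra were commutative; in
    general it measures how far the entrywise adjoint of [u] is from being unitary. *)
Let Q := \matrix_(i, j) phi (\sum_k star (u i k) ⋅ u j k).

(** Invariance of [phi] in the second leg, applied to [\sum_k star (u i k) ⋅ u j k]: after expansion
    of [Delta], the second legs recombine into the entries of [Q]. *)
Let Q_intertwines i j :
  \sum_a \sum_b Q a b *: (star (u i a) ⋅ u j b) = Q i j *: cone.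
Proof.
have [uD _ _] := uP; have [Dl DM Ds _] := Delta_hom G.
have [_ _ _ h] := phiH.
have := h (\sum_k star (u i k) ⋅ u j k); rewrite mxE.
move=> [s [sl sc sE] <-]; rewrite (linfun_sum Dl) (linfun_sum sl).
transitivity (\sum_k \sum_a \sum_b phi (star (u a k) ⋅ u b k) *: (star (u i a) ⋅ u j b)).
  rewrite [RHS]exchange_big; apply: eq_bigr => a _; rewrite [RHS]exchange_big.
  by apply: eq_bigr => b _; rewrite mxE (scalfun_sum phil) scaler_suml.
apply: eq_bigr => k _; rewrite DM Ds !uD star_sum cmul_suml (linfun_sum sl).
apply: eq_bigr => a _; rewrite cmul_sumr (linfun_sum sl); apply: eq_bigr => b _.
by rewrite tens_star tensM sE.
Qed.

Let cone_neq0 : (cone : G) != 0.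
Proof.
by apply/eqP => c0; have /eqP := haar1; rewrite c0 (scalfun0 phil) eq_sym oner_eq0.
Qed.

(** If [v Q = 0], the elements [y k] satisfy [\sum_k phi (star (y k) ⋅ y k) = 0], hence vanish by
    faithfulness; unitarity of [u] recovers the conjugate of [v 0 i] as
    [\sum_k y k ⋅ star (u i k)]. *)
Let Q_unit : Q \in unitmx.
Proof.
rewrite -row_free_unit -kermx_eq0; apply/eqP/eqP/rowV0P => v /sub_kermxP vQ.
pose y k := \sum_j (v 0 j)^* *: u j k.
have yE : \sum_k phi (star (y k) ⋅ y k) = 0.
  transitivity (\sum_j (v *m Q) 0 j * (v 0 j)^*); last first.
    by rewrite vQ big1 // => j _; rewrite mxE mul0r.
  transitivity (\sum_k \sum_j \sum_i v 0 i * (v 0 j)^* * phi (star (u i k) ⋅ u j k)).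
    apply: eq_bigr => k _; rewrite /y cmul_sumr (scalfun_sum phil).
    apply: eq_bigr => j _; rewrite star_sum cmul_suml (scalfun_sum phil).
    apply: eq_bigr => i _; rewrite cmulZr starZ cmulZl !(scalfunZ phil) conjCK.
    by rewrite mulrA [_^* * _]mulrC.
  rewrite exchange_big; apply: eq_bigr => j _; rewrite exchange_big mxE mulr_suml.
  apply: eq_bigr => i _; rewrite mxE (scalfun_sum phil) mulr_sumr mulr_suml.
  by apply: eq_bigr => k _; rewrite mulrAC.
have y0 k : y k = 0.
  apply: phiF; apply/eqP; move/eqP: yE.
  rewrite psumr_eq0 => [/allP /(_ k (mem_index_enum _)) //|i _].
  by case: haar_posfun.
have [_ _ uu] := uP; apply/rowP => i; rewrite mxE.
have : (v 0 i)^* *: (cone : G) = \sum_k y k ⋅ star (u i k).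
  transitivity (\sum_j (v 0 j)^* *: \sum_k u j k ⋅ star (u i k)).
    rewrite (bigD1 i) //= uu eqxx big1 ?addr0 // => j ji.
    by rewrite uu (negPf ji) scaler0.
  under eq_bigr do rewrite scaler_sumr.
  rewrite exchange_big; apply: eq_bigr => k _; rewrite /y cmul_suml.
  by apply: eq_bigr => j _; rewrite cmulZl.
rewrite big1 => [|k _]; last by rewrite y0 cmul0l.
by move/eqP; rewrite scaler_eq0 (negPf cone_neq0) orbF conjC_eq0 => /eqP.
Qed.

(* [phi] intertwines the conjugate of [u] with a unitary corepresentation     *)
(* through the positive matrix [Q], so the transpose of [u] has a left        *)
(* inverse whose adjoint has entries in the span of those of [u].             *)
Lemma transpose_left_inverse : exists (v : 'M[G]_d) (c : 'I_d -> 'I_d -> 'M[R[i]]_d),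
  (forall j k, star (v j k) = \sum_b \sum_l c j k b l *: u l b) /\
  forall j l, \sum_k v j k ⋅ u l k = if j == l then cone else 0.
Proof.
(* With [ubar] for the matrix of the [star (u i j)], [Q_intertwines] reads [ubar Q u^T = Q]. So
   [w = (Q^-1)^T u Q^T] satisfies [ubar w^T = 1], and the adjoint of this identity is the claim. *)
pose c j k := \matrix_(b, l) (Q k b * invmx Q l j).
pose w j k := \sum_b \sum_l c j k b l *: u l b.
exists (\matrix_(j, k) star (w j k)), c; split=> [j k|j l]; first by rewrite mxE starK.
transitivity (star (\sum_k star (u l k) ⋅ w j k)).
  by rewrite star_sum; apply: eq_bigr => k _; rewrite mxE starM starK.
transitivity (star (((Q *m invmx Q) l j) *: (cone : G))); last first.
  rewrite mulmxV // mxE eq_sym; case: eqP => _; first by rewrite scale1r star1.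
  by rewrite scale0r star0.
congr star; rewrite mxE scaler_suml.
transitivity (\sum_m invmx Q m j *: (Q l m *: (cone : G))); last first.
  by apply: eq_bigr => m _; rewrite scalerA mulrC.
under [RHS]eq_bigr do rewrite -Q_intertwines scaler_sumr.
rewrite exchange_big; apply: eq_bigr => k _; rewrite /w cmul_sumr.
under [RHS]eq_bigr do rewrite scaler_sumr.
rewrite exchange_big; apply: eq_bigr => b _; rewrite cmul_sumr.
by apply: eq_bigr => m _; rewrite mxE cmulZr scalerA mulrC.
Qed.

(** Multiplying the slices for the [u i l] by [u l k] and summing over [l] gives the slice of
    [Delta (u i k ⋅ x)], a scalar by invariance. This is a linear system with matrix the transpose
    of [u], solved by its left inverse. *)
Lemma strong_invariance s : is_slicel (qtens G) phi s ->
  (forall a, s (Delta a) = phi a *: cone) ->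
  exists2 v : 'M[G]_d,
    forall j k, exists c : 'M[R[i]]_d, star (v j k) = \sum_b \sum_l c b l *: u l b &
    forall i j x, s (qtens G (u i j) cone ⋅ Delta x) = \sum_k phi (u i k ⋅ x) *: v j k.
Proof.
move=> sP sD; have [v [c [vc vu]]] := transpose_left_inverse.
exists v => [j k|i j x]; first by exists (c j k).
have [uD _ _] := uP; have [_ DM _ _] := Delta_hom G.
have h k : \sum_l u l k ⋅ s (qtens G (u i l) cone ⋅ Delta x) = phi (u i k ⋅ x) *: cone.
  rewrite -sD DM uD cmul_suml; have [sl _ _] := sP; rewrite (linfun_sum sl).
  apply: eq_bigr => l _; rewrite -(slicel_tens_mulr _ _ sP) cmulA tensM.
  by rewrite cmul1l cmul1r.
transitivity (\sum_k v j k ⋅ (phi (u i k ⋅ x) *: cone)); last first.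
  by apply: eq_bigr => k _; rewrite cmulZr cmul1r.
under eq_bigr do rewrite -h cmul_sumr.
rewrite exchange_big (bigD1 j) //= [X in _ + X]big1 => [|l lj].
  under eq_bigr do rewrite cmulA.
  by rewrite -cmul_suml vu eqxx cmul1l addr0.
under eq_bigr do rewrite cmulA.
by rewrite -cmul_suml vu eq_sym (negPf lj) cmul0l.
Qed.

End Corep.

(** Induction on the length. For [x != 0] faithfulness gives [phi (star x ⋅ x) != 0], so the slice
    by [phi (star x ⋅ _)] expresses [b] through the other right legs, and [x (x) b] is absorbed by
    changing their left legs by multiples of [x]. *)
Lemma slices_separate (B T : cstarAlgType R) (t : tensor_product G B T) (s : seq (G * B)) :
  (forall u, u \in s -> matrix_coefficients (star u.1)) ->
  (forall a, matrix_coefficients a -> \sum_(u <- s) phi (a ⋅ u.1) *: u.2 = 0) ->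
  tens_sum t s = 0.
Proof.
have [n] := ubnP (size s); elim: n s => // n IHn [|[x b] s] /= sn sc s0.
  by rewrite /tens_sum big_nil.
have sc' u : u \in s -> matrix_coefficients (star u.1).
  by move=> us; apply: sc; rewrite inE us orbT.
rewrite /tens_sum big_cons /=.
have [x0|x0] := eqVneq x 0.
  rewrite x0 (linfun0 (tens_linearl t b)) add0r; apply: IHn => // a /s0.
  by rewrite big_cons x0 cmul0r (scalfun0 phil) scale0r add0r.

pose q := phi (star x ⋅ x).
have q0 : q != 0 by apply/eqP => /phiF /eqP; exact/negP.
pose c (u : G * B) := phi (star x ⋅ u.1) / q.
have xc : matrix_coefficients (star x) by exact: (sc (x, b) (mem_head _ _)).
have bE : b = - \sum_(u <- s) c u *: u.2.
  have := s0 _ xc; rewrite big_cons /= => /eqP; rewrite addr_eq0 => /eqP h.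
  rewrite -[LHS]scale1r -(mulVf q0) -scalerA h scalerN scaler_sumr; congr (- _).
  by apply: eq_bigr => u _; rewrite scalerA mulrC.
have := IHn [seq (u.1 - c u *: x, u.2) | u <- s].
rewrite size_map => /(_ sn) /= h; rewrite -[RHS]h.
- rewrite /tens_sum big_map {1}bE (linfunN (tens_linearr t x)) addrC.
  rewrite (linfun_sum (tens_linearr t x)) -sumrB; apply: eq_bigr => u _ /=.
  rewrite [RHS](linfunB (tens_linearl t u.2)) (linfunZ (tens_linearl t u.2)).
  by rewrite (linfunZ (tens_linearr t x)).
- move=> _ /mapP[u us ->] /=; rewrite starB addrC starZ -scaleNr.
  by apply: lin_spanZD => //; exact: sc'.
- move=> a ac; rewrite big_map -[RHS](s0 a ac) big_cons /= {1}bE scalerN scaler_sumr.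
  rewrite addrC -sumrB; apply: eq_bigr => u _.
  by rewrite cmulBr cmulZr (scalfunB phil) (scalfunZ phil) scalerBl scalerA mulrC.
Qed.

End Haar.

Lemma sum_continuous (R : realType) (V W : normedModType R[i]) I (r : seq I)
    (F : I -> V -> W) :
  (forall i, continuous (F i)) -> continuous (fun x => \sum_(i <- r) F i x).
Proof.
move=> Fc x; elim: r => [|i r IHr].
  rewrite (_ : (fun x => _) = (fun=> 0)); first exact: cvg_cst.
  by apply/funext => y; rewrite big_nil.
rewrite (_ : (fun x => _) = (fun x => F i x + \sum_(j <- r) F j x)).
  by apply: cvgD; [exact: Fc|exact: IHr].
by apply/funext => y; rewrite big_cons.
Qed.

(** * The coaction on spectral elements *)

Section CoactionInvariants.
Variables (R : realType) (G : compact_quantum_group R) (phi : G -> R[i]).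
Hypotheses (phiH : haar_state phi) (phiF : faithful phi).
Variables (B : cstarAlgType R) (alpha : coaction G B).
Variable S : calg2 alpha -> B.
Hypothesis SP : is_slicel (ctens alpha) phi S.

Let al : linear alpha. Proof. by case: (coact_hom alpha). Qed.
Let phil : scalar phi. Proof. by case: (haar_posfun phiH). Qed.

(** The condition bears on [star u.1] because strong invariance controls [v] through its adjoints
    and [slices_separate] slices by the adjoint of a left leg. *)
Let regular (z : calg2 alpha) := exists2 s : seq (G * B),
  forall u, u \in s -> matrix_coefficients (star u.1) & z = tens_sum (ctens alpha) s.

Let regularZD c x y : regular x -> regular y -> regular (c *: x + y).
Proof.
move=> [s sr ->] [s' s'r ->]; exists ([seq (c *: u.1, u.2) | u <- s] ++ s').
  move=> u; rewrite mem_cat => /orP[/mapP[v /sr vr ->] /=|/s'r //].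
  by rewrite starZ -[_ *: _]addr0; apply: lin_spanZD => //; exact: lin_span0.
rewrite /tens_sum big_cat big_map scaler_sumr; congr (_ + _).
by apply: eq_bigr => u _; rewrite (linfunZ (tens_linearl (ctens alpha) _)).
Qed.

Let regular_sum I (r : seq I) (c : I -> R[i]) (F : I -> calg2 alpha) :
  (forall i, regular (F i)) -> regular (\sum_(i <- r) c i *: F i).
Proof.
move=> h; elim: r => [|i r IHr]; last by rewrite big_cons; exact: regularZD.
by rewrite big_nil; exists [::] => //; rewrite /tens_sum big_nil.
Qed.

(* [(iota (x) alpha) alpha = (Delta (x) iota) alpha], sliced by [phi (u i j .)] *)
Lemma coact_slice_coefficient d (u : 'M[G]_d) i j b :
  unitary_corep_mx u -> irreducible_mx u ->
  regular (alpha (S (ctens alpha (u i j) cone ⋅ alpha b))).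
Proof.
move=> uP uI; have [sg sgP sgD] := haar_slicel_ex phiH.
have [v vc vE] := strong_invariance phiH phiF uP sgP sgD.
have [s3 s3P] := slicel_triple (@ctens_assoc _ _ _ alpha) (haar_posfun phiH) (haar1 phiH) sgP.
have [hl [hr [[[hll _ _ _] hlc hlE] [[hrl _ _ _] hrc hrE] hlr]]] := coact_coassoc alpha.
have [sl sc sE] := SP; have [s3l s3c s3E] := s3P; have [sgl sgc sgE] := sgP.
(* Slicing [hr (1 (x) c) = 1 (x) alpha c] by [phi] returns [alpha c], so [alpha] inherits the
   continuity of [hr]. *)
have ac : continuous alpha.
  rewrite (_ : (alpha : B -> _) = s3 \o hr \o ctens alpha cone); last first.
    by apply/funext => c /=; rewrite hrE s3E haar1 // scale1r.
  move=> c; apply: continuous_comp; first exact: tens_continuousr.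
  by apply: continuous_comp; [exact: hrc|exact: s3c].
have [s3ul s3uc s3uE] := slicel_tens_mull (u i j) s3P.
pose s3u z := s3 (ctensr alpha (u i j) cone ⋅ z).
have [sul suc suE] := slicel_tens_mull (u i j) SP.
have e1 z : s3u (hr z) = alpha (S (ctens alpha (u i j) cone ⋅ z)).
  apply: (@tens_linear_eq _ _ _ _ (ctens alpha) _ (s3u \o hr)
    (fun z => alpha (S (ctens alpha (u i j) cone ⋅ z)))).
  - by move=> c x y; rewrite /= hrl /s3u s3ul.
  - by move=> c x y; rewrite sul al.
  - by move=> x; apply: continuous_comp; [exact: hrc|exact: s3uc].
  - by move=> x; apply: continuous_comp; [exact: suc|exact: ac].
  - by move=> a c; rewrite /= hrE /s3u s3uE suE (linfunZ al).
have e2 x c : s3u (ctensl alpha x c) = ctens alpha (sg (qtens G (u i j) cone ⋅ x)) c.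
  have [tl tc tE] := slicel_tens_mull (u i j) sgP.
  apply: (@tens_linear_eq _ _ _ _ (qtens G) _ (fun x => s3u (ctensl alpha x c))
    (fun x => ctens alpha (sg (qtens G (u i j) cone ⋅ x)) c)).
  - by move=> k y z; rewrite (tens_linearl (ctensl alpha)) /s3u s3ul.
  - by move=> k y z; rewrite tl (tens_linearl (ctens alpha)).
  - move=> y; apply: (@continuous_comp _ _ _ ((ctensl alpha)^~ c) s3u).
      exact: tens_continuousl.
    exact: s3uc.
  - move=> y; apply: (@continuous_comp _ _ _ (fun x => sg (qtens G (u i j) cone ⋅ x))
      ((ctens alpha)^~ c)); first exact: tc.
    exact: tens_continuousl.
  - move=> a1 a2; rewrite (ctens_assoc alpha) /s3u s3uE tE.
    by rewrite (linfunZ (tens_linearl (ctens alpha) c)).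
(* On the [Delta] side the slice acts within the first two legs, where strong invariance turns it
   into a finite sum of elementary tensors. *)
have e3 z : s3u (hl z) = \sum_k ctens alpha (v j k) (S (ctens alpha (u i k) cone ⋅ z)).
  apply: (@tens_linear_eq _ _ _ _ (ctens alpha) _ (s3u \o hl)
    (fun z => \sum_k ctens alpha (v j k) (S (ctens alpha (u i k) cone ⋅ z)))).
  - by move=> c x y; rewrite /= hll /s3u s3ul.
  - move=> c x y; rewrite scaler_sumr -big_split; apply: eq_bigr => k _.
    have [skl _ _] := slicel_tens_mull (u i k) SP.
    by rewrite skl (tens_linearr (ctens alpha)).
  - by move=> x; apply: continuous_comp; [exact: hlc|exact: s3uc].
  - apply: sum_continuous => k x.
    have [_ skc _] := slicel_tens_mull (u i k) SP.
    by apply: continuous_comp; [exact: skc|exact: tens_continuousr].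
  - move=> a c; rewrite /= hlE e2 vE (linfun_sum (tens_linearl (ctens alpha) c)).
    apply: eq_bigr => k _; have [_ _ skE] := slicel_tens_mull (u i k) SP.
    rewrite skE (linfunZ (tens_linearl (ctens alpha) c)).
    by rewrite (linfunZ (tens_linearr (ctens alpha) _)).
rewrite -e1 -hlr e3; under eq_bigr do rewrite -[ctens _ _ _]scale1r.
apply: regular_sum => k.
exists [:: (v j k, S (ctens alpha (u i k) cone ⋅ alpha b))].
  move=> _ /[!inE] /eqP -> /=; have [c ->] := vc j k.
  under eq_bigr do rewrite -[\sum_l _]scale1r.
  apply: lin_span_sum => b'; apply: lin_span_sum => l; apply: lin_span_incl.
  by exists d, u; split=> //; exists l, b'.
by rewrite /tens_sum big_seq1.
Qed.

Let regular_act b w c : dual_algebra phi w -> right_act alpha b w c -> regular (alpha c).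
Proof.
move=> [a [s [sS ->]] ->] [s' s'P <-]; rewrite (slicel_unique s'P (slicel_tens_mull _ SP)).
have [sl sc sE] := SP.
rewrite (linfun_sum (tens_linearl (ctens alpha) cone)) cmul_suml (linfun_sum sl).
rewrite (linfun_sum al); elim: s sS {s'P} => [|u s IHs] sS.
  by rewrite big_nil; exists [::] => //; rewrite /tens_sum big_nil.
rewrite big_cons.
rewrite (linfunZ (tens_linearl (ctens alpha) cone)) cmulZl (linfunZ sl) (linfunZ al).
apply: regularZD; last first.
  by apply: IHs => v vs; apply: sS; rewrite inE vs orbT.
have [d [m [mP mI [i [j ->]]]]] := sS u (mem_head _ _).
exact: coact_slice_coefficient.
Qed.

Lemma coact_regular p : regular_part phi alpha p -> regular (alpha p).
Proof.
move=> [s [sS ->]]; elim: s sS => [|u s IHs] sS.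
  by rewrite big_nil (linfun0 al); exists [::] => //; rewrite /tens_sum big_nil.
rewrite big_cons al; apply: regularZD; last first.
  by apply: IHs => v vs; apply: sS; rewrite inE vs orbT.
by have [b [w [wd bw]]] := sS u (mem_head _ _); exact: regular_act bw.
Qed.

End CoactionInvariants.

(* [alpha p] lies in the span of [a (x) b] with [star a] a matrix             *)
(* coefficient, on which the slices by [phi (star a .)] are faithful: density *)
(* of the matrix coefficients is not needed.                                  *)
Lemma invariant_coact (R : realType) (G : compact_quantum_group R) (phi : G -> R[i])
    (B : cstarAlgType R) (alpha : coaction G B) (p : B) :
  haar_state phi -> faithful phi -> regular_part phi alpha p ->
  invariant_elt phi alpha p -> alpha p = ctens alpha cone p.
Proof.
move=> phiH phiF pr pinv; have phil := (haar_posfun phiH).1.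
(* Invariance at [phi] itself supplies its slice map, as [cone] is a matrix coefficient. *)
have [S SP _] : exists2 S, is_slicel (ctens alpha) phi S & True.
  have [|S SP _] := pinv (fun x => phi (cone ⋅ x)).
    by exists cone => //; exact: matrix_coefficients1.
  by exists S => //; congr is_slicel: SP; apply/funext => x; rewrite cmul1l.
have [s sS ap] := coact_regular phiH phiF SP pr.
apply/eqP; rewrite -subr_eq0 ap addrC -(linfunN (tens_linearl (ctens alpha) p)); apply/eqP.
(* The list represents [alpha p - 1 (x) p]; its slices vanish by invariance. *)
have := @slices_separate _ _ _ phiH phiF _ _ (ctens alpha) ((- cone, p) :: s).
rewrite /tens_sum big_cons; apply=> [u|a ac].
  rewrite inE => /orP[/eqP ->|/sS //] /=.
  rewrite starN star1 -scaleN1r -[_ *: _]addr0; apply: lin_spanZD; last exact: lin_span0.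
  exact: matrix_coefficients1.
have [S' S'P S'E] := pinv (fun x => phi (a ⋅ x)) (ex_intro2 _ _ a ac erefl).
have [S'l _ S'F] := S'P.
move: S'E; rewrite ap /tens_sum (linfun_sum S'l) big_cons /=.
rewrite cmulNr (scalfunN phil) scaleNr cmul1r.
under eq_bigr do rewrite S'F.
by move=> ->; rewrite addNr.
Qed.

(** * Operators, orthonormal bases and traces *)

Section BopTheory.
Variables (R : realType) (H : hilbertType R).
Implicit Types (S T : bop H) (x y z : H).

Lemma bop_cmulE S T x : (S ⋅ T) x = S (T x). Proof. by []. Qed.
Lemma bop_coneE x : (cone : bop H) x = x. Proof. by []. Qed.
Lemma bop_starP T x y : inner (T x) y = inner x (star T y).
Proof. exact: adjointP. Qed.
Lemma bop_sumE I (r : seq I) (F : I -> bop H) x :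
  (\sum_(i <- r) F i) x = \sum_(i <- r) F i x.
Proof.
elim: r => [|i r IHr]; first by rewrite !big_nil.
by rewrite !big_cons bopDE IHr.
Qed.
Lemma bop_sum T I (r : seq I) P (F : I -> H) :
  T (\sum_(i <- r | P i) F i) = \sum_(i <- r | P i) T (F i).
Proof. exact: (big_morph T (bopD T) (bop0 T)). Qed.
Lemma inner_suml I (r : seq I) P (F : I -> H) y :
  inner (\sum_(i <- r | P i) F i) y = \sum_(i <- r | P i) inner (F i) y.
Proof. by apply: (big_morph (inner^~ y)) => [a b|]; rewrite ?innerDl ?inner0l. Qed.
Lemma inner0r y : inner y 0 = 0 :> R[i].
Proof. by rewrite innerC inner0l rmorph0. Qed.
Lemma inner_sumr I (r : seq I) P (F : I -> H) y :
  inner y (\sum_(i <- r | P i) F i) = \sum_(i <- r | P i) inner y (F i).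
Proof. by apply: (big_morph (inner y)) => [a b|]; rewrite ?innerDr ?inner0r. Qed.
Lemma inner_ge0 x : 0 <= inner x x.
Proof. by rewrite -norm_inner exprn_ge0. Qed.
Lemma inner_eq0 x : inner x x = 0 -> x = 0.
Proof. by rewrite -norm_inner => /eqP; rewrite sqrf_eq0 normr_eq0 => /eqP. Qed.

Lemma bop_continuous T : continuous T.
Proof.
apply: (@bounded_continuous _ _ _ _ (bop_norm T)) => [x y|x]; first exact: bopB.
exact: bop_normP.
Qed.

Lemma inner_continuousl y : continuous (fun x => inner x y : R[i]^o).
Proof.
apply: (@bounded_continuous _ _ R[i]^o _ `|y|) => [u v|u]; first by rewrite innerBl.
by rewrite [leRHS]mulrC; exact: Defs.CauchySchwarz.
Qed.

Lemma bounded_linear_rank1 x y : bounded_linear (fun z => inner z y *: x).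
Proof.
split=> [c u v|].
  by rewrite innerDl innerZl scalerDl scalerA.
have [r r0 rE] := ge0_complex (mulr_ge0 (normr_ge0 y) (normr_ge0 x)).
exists r => z; rewrite normrZ -rE [leRHS]mulrAC ler_wpM2r // [leRHS]mulrC.
exact: Defs.CauchySchwarz.
Qed.

Definition rank1 x y : bop H := Bop (bounded_linear_rank1 x y).

Lemma rank1E x y z : rank1 x y z = inner z y *: x. Proof. by []. Qed.

Lemma star_rank1 x y : star (rank1 x y) = rank1 y x.
Proof.
apply: bopP => u; apply: inner_inj => v; rewrite -bop_starP !rank1E.
by rewrite innerZl innerZr -innerC mulrC.
Qed.

Let real_scale_continuous x : continuous (fun a : R => a%:C *: x).
Proof.
move=> a; apply/cvgrPdist_lt => e e0; have [e' e'0 ->] := gt0_complex e0.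
have [r r0 rE] := norm_complex x.
have r1 : 0 < r + 1 by rewrite ltr_wpDl.
near=> b; rewrite -scalerBl normrZ rE -rmorphB normc_def /= expr0n addr0 sqrtr_sqr.
rewrite -realCM ltcR.
have h : `|a - b| < e' / (r + 1).
  by near: b; apply: cvgr_dist_lt; [exact: cvg_id|rewrite divr_gt0].
move: h; rewrite ltr_pdivlMr //; apply: le_lt_trans.
by rewrite ler_wpM2l // lerDl.
Unshelve. all: by end_near. Qed.

(** The image of the unit ball lies in the image of a compact real square under
    [(a, b) |-> (a + i b) x]. *)
Lemma compact_op_rank1 x y : compact_op (rank1 x y).
Proof.
have [M M0 ME] := norm_complex y.
pose f (u : R * R) := u.1%:C *: x + u.2%:C *: ((0 +i* 1) *: x).
have fc : continuous f.
  move=> u; apply: cvgD.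
    by apply: (cvg_comp fst (fun a => a%:C *: x) cvg_fst); exact: real_scale_continuous.
  apply: (cvg_comp snd (fun a => a%:C *: ((0 +i* 1) *: x)) cvg_snd).
  exact: real_scale_continuous.
have K : compact (f @` (`[- M, M] `*` `[- M, M])).
  apply: continuous_compact; last by apply: compact_setX; exact: segment_compact.
  exact: continuous_subspaceT.
apply: (precompact_subset (B := f @` (`[- M, M] `*` `[- M, M]))); last first.
  rewrite precompact_closed //; apply: compact_closed K; exact: norm_hausdorff.
move=> _ [z z1 <-]; rewrite rank1E.
have : `|inner z y| <= M%:C.
  apply: le_trans (Defs.CauchySchwarz _ _) _; rewrite -ME -[leRHS]mul1r ler_wpM2r //.
case: (inner z y) => a b; rewrite normc_def lecR /= => ab.
have aM : `|a| <= M.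
  by apply: le_trans ab; rewrite -sqrtr_sqr ler_wsqrtr // lerDl sqr_ge0.
have bM : `|b| <= M.
  by apply: le_trans ab; rewrite -sqrtr_sqr ler_wsqrtr // lerDr sqr_ge0.
exists (a, b); first by split; rewrite /= in_itv /= -ler_norml.
rewrite /f /= scalerA -scalerDl; congr (_ *: _).
by apply/eqP; rewrite eq_complex /=; apply/andP; split; apply/eqP; ring.
Qed.

Lemma compact_op_mull S T : compact_op T -> compact_op (S ⋅ T).
Proof.
rewrite /compact_op precompactE => K.
apply: (precompact_subset (B := S @` closure (T @` [set x | `|x| <= 1]))).
  by move=> _ [x x1 <-]; exists (T x) => //; apply: subset_closure; exists x.
rewrite precompact_closed.
  by apply: continuous_compact => //; apply: continuous_subspaceT; exact: bop_continuous.
apply: compact_closed; first exact: norm_hausdorff.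
by apply: continuous_compact => //; apply: continuous_subspaceT; exact: bop_continuous.
Qed.

Lemma bop_eq_compact S T : (forall k, compact_op k -> S ⋅ k = T ⋅ k) -> S = T.
Proof.
move=> h; apply: bopP => x; have [->|x0] := eqVneq x 0; first by rewrite !bop0.
have := congr1 (fun A : bop H => A x) (h _ (compact_op_rank1 x x)).
rewrite !bop_cmulE rank1E !bopZ => /scalerI; apply.
by apply/eqP => /inner_eq0/eqP; exact/negP.
Qed.

End BopTheory.

(** [mult_slice] determines [S] only through the products [S ⋅ k] with [k] compact, so the identity
    is tested on these: [X ⋅ k] is again compact, and [1 (x) X] can be pulled out of a slice. *)
Lemma mult_slice_commute (R : realType) (G : compact_quantum_group R)
    (H : hilbertType R) (T : cstarAlgType R) (t : tensor_product G (bop H) T)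
    (w : G -> R[i]) (U : mult T) (S X : bop H) :
  mult_slice t w U S ->
  mult_eq (tens_compact t) (mult_mul U (mult_of (t cone X)))
    (mult_mul (mult_of (t cone X)) U) ->
  S ⋅ X = X ⋅ S.
Proof.
move=> [s sP sE] UX; apply: bop_eq_compact => k kc.
have kX : compact_op (X ⋅ k) by exact: compact_op_mull.
have tk : tens_compact t (t cone k).
  by apply: subset_closure; apply: lin_span_incl; exists cone, k.
rewrite -!cmulA sE // sE // -(slicel_tens_mulr _ _ sP).
have /= [<- _] := UX _ tk.
by rewrite tensM cmul1l.
Qed.

Lemma cvg_norm_le (R : realType) (V : normedModType R[i]) (u : nat -> V) l (c : R[i]) :
  u @ \oo --> l -> (\forall n \near \oo, `|u n| <= c) -> `|l| <= c.
Proof.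
move=> ul uc; apply/ler_addgt0Pr => e e0.
have /cvgrPdist_le/(_ _ e0) h := ul.
have [n [/= h1 h2]] := filter_ex (filterI h uc).
by rewrite -(subrK (u n) l) addrC; apply: le_trans (ler_normD _ _) _; exact: lerD.
Qed.

(** * Partial expansions along an orthonormal set *)

Section Orthonormal.
Variables (R : realType) (H : hilbertType R) (E : set H).
Hypothesis onE : forall x y, E x -> E y -> inner x y = (x == y)%:R :> R[i].

Definition fproj (X : {fset H}) (v : H) : H := \sum_(x <- X) inner v x *: x.

Lemma fprojD X v w : fproj X (v + w) = fproj X v + fproj X w.
Proof.
by rewrite -big_split; apply: eq_bigr => x _; rewrite innerDl scalerDl.
Qed.

Lemma fprojZ X c v : fproj X (c *: v) = c *: fproj X v.
Proof. by rewrite scaler_sumr; apply: eq_bigr => x _; rewrite innerZl scalerA. Qed.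

Lemma fprojB X v w : fproj X (v - w) = fproj X v - fproj X w.
Proof. by rewrite fprojD -scaleN1r fprojZ scaleN1r. Qed.

Lemma fproj_lsum X I (r : seq I) (c : I -> R[i]) (F : I -> H) :
  fproj X (\sum_(i <- r) c i *: F i) = \sum_(i <- r) c i *: fproj X (F i).
Proof.
elim: r => [|i r IHr]; last by rewrite !big_cons fprojD fprojZ IHr.
by rewrite !big_nil -[LHS]subr0 -{1}(subrr (0 : H)) fprojB subrr subr0.
Qed.

Lemma inner_fproj X v y : [set` X] `<=` E -> y \in X -> inner (fproj X v) y = inner v y.
Proof.
move=> XE yX; rewrite inner_suml (bigD1_seq y) ?fset_uniq //= big1_seq.
  by have Ey : E y := XE _ yX; rewrite addr0 innerZl (onE Ey Ey) eqxx mulr1.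
by move=> x /andP[xy xX]; rewrite innerZl (onE (XE _ xX) (XE _ yX)) (negPf xy) mulr0.
Qed.

Lemma fproj_id X y : [set` X] `<=` E -> y \in X -> fproj X y = y.
Proof.
move=> XE yX; rewrite /fproj (bigD1_seq y) ?fset_uniq //= big1_seq.
  by rewrite onE ?eqxx ?scale1r ?addr0 //; exact: XE.
move=> x /andP[xy xX]; rewrite onE 1?eq_sym ?(negPf xy) ?scale0r //; exact: XE.
Qed.

Lemma inner_fproj_orth X v w : [set` X] `<=` E ->
  inner (v - fproj X v) (fproj X w) = 0.
Proof.
move=> XE; rewrite inner_sumr big1_seq // => x /andP[_ xX].
by rewrite innerZr innerBl inner_fproj // subrr mulr0.
Qed.

Lemma norm_fproj_compl X v : [set` X] `<=` E -> `|v - fproj X v| <= `|v|.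
Proof.
move=> XE; rewrite -(@ler_pXn2r _ 2) ?nnegrE // !norm_inner.
rewrite innerBr inner_fproj_orth // subr0 innerBl lerBlDr lerDl.
rewrite -[v in inner _ v](subrK (fproj X v)) innerDr.
by rewrite innerC inner_fproj_orth // rmorph0 add0r inner_ge0.
Qed.

Lemma norm_fproj_fsubset X Y v : [set` Y] `<=` E -> (X `<=` Y)%fset ->
  `|v - fproj X v| ^+ 2 = `|v - fproj Y v| ^+ 2 + `|fproj Y v - fproj X v| ^+ 2.
Proof.
move=> YE XY; have XE : [set` X] `<=` E by move=> x /(fsubsetP XY) /YE.
have YX : fproj Y (fproj X v) = fproj X v.
  rewrite {2}/fproj fproj_lsum.
  apply: eq_big_seq => x xX; rewrite fproj_id //; exact: (fsubsetP XY).
have o : inner (v - fproj Y v) (fproj Y v - fproj X v) = 0.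
  by rewrite innerBr -[in X in _ - X]YX !inner_fproj_orth // subrr.
have e : v - fproj X v = (v - fproj Y v) + (fproj Y v - fproj X v) by rewrite subrKA.
rewrite !norm_inner e; move: o; move: (v - fproj Y v) (fproj Y v - fproj X v) => a b o.
by rewrite innerDl !innerDr o [inner b a]innerC o rmorph0 addr0 add0r.
Qed.

(** A combination [z] of vectors of [X] is fixed by [fproj X], so [v - fproj X v] is the image of
    [v - z] under the contraction [1 - fproj X]. *)
Lemma fproj_approx v (e : R[i]) : closed_span E v -> 0 < e ->
  exists2 X0 : {fset H}, [set` X0] `<=` E &
  forall X : {fset H}, (X0 `<=` X)%fset -> [set` X] `<=` E -> `|v - fproj X v| <= e.
Proof.
move=> /closure_approxP h /h [_ [s [sE ->]] ve].
pose X0 := [fset x | x in map snd s]%fset.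
exists X0 => [x|X X0X XE].
  by rewrite /= !inE => /mapP[u us ->]; exact: sE.
set z := (X in v - X) in ve.
have zX : fproj X z = z.
  rewrite /z fproj_lsum.
  apply: eq_big_seq => u us; rewrite fproj_id //; apply: (fsubsetP X0X).
  by rewrite !inE; apply/mapP; exists u.
rewrite (_ : v - _ = (v - z) - fproj X (v - z)).
  by apply: le_trans (norm_fproj_compl _ XE) _; exact: ltW.
by rewrite fprojB zX opprB subrKA.
Qed.

Let fm (v : H) := filter_from [set X0 : {fset H} | [set` X0] `<=` E]
  (fun X0 => [set fproj X v | X in [set X : {fset H} | (X0 `<=` X)%fset /\ [set` X] `<=` E]]).

Let fm_proper v : ProperFilter (fm v).
Proof.
apply: filter_from_proper; last by move=> X0 X0E; exists (fproj X0 v); exists X0.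
apply: filter_from_filter; first by exists fset0 => x; rewrite /= inE.
move=> X Y XE YE; exists (X `|` Y)%fset.
  by move=> x /=; rewrite inE => /orP[/XE|/YE].
move=> _ [Z [/= XYZ ZE] <-]; split; exists Z => //; split=> //; apply: fsubset_trans XYZ.
  exact: fsubsetUl.
exact: fsubsetUr.
Qed.

(** By Pythagoras the squared distance [r X ^+ 2] decreases as [X] grows; once it is within
    [(e' / 2) ^+ 2] of its infimum, enlarging [X] moves the partial expansion by less than
    [e' / 2]. *)
Let fm_cvg v : cvg (fm v).
Proof.
have FF := fm_proper v.
pose r X := complex.Re `|v - fproj X v|.
have rE X : `|v - fproj X v| = (r X)%:C by rewrite RRe_real // ger0_real.
have r0 X : 0 <= r X by rewrite -ler0c -rE.
pose D := [set r X ^+ 2 | X in [set X : {fset H} | [set` X] `<=` E]].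
have D0 : has_inf D.
  split; last by exists 0 => _ [X _ <-]; exact: sqr_ge0.
  by exists (r fset0 ^+ 2); exists fset0 => // x; rewrite /= inE.
apply: cauchy_cvg; apply/cauchy_ballP => e e0.
have [e' e'0 ->] := gt0_complex e0.
have e20 : 0 < (e' / 2) ^+ 2 by rewrite exprn_gt0 // divr_gt0.
have [_ [X0 X0E <-] X0D] := inf_adherent e20 D0.
have h X : (X0 `<=` X)%fset -> [set` X] `<=` E -> `|fproj X v - fproj X0 v| < (e' / 2)%:C.
  move=> X0X XE; rewrite -(@ltr_pXn2r _ 2) ?nnegrE ?ler0c ?divr_ge0 ?(ltW e'0) //.
  have := norm_fproj_fsubset v XE X0X; rewrite !rE.
  have [q q0 ->] := norm_complex (fproj X v - fproj X0 v).
  rewrite -!rmorphXn -rmorphD ltcR /= => /complexI qE.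
  have : inf D <= r X ^+ 2 by apply: ge_inf; [exact: D0.2|exists X].
  by move: X0D; rewrite qE; lra.
pose S := [set fproj X v | X in [set X : {fset H} | (X0 `<=` X)%fset /\ [set` X] `<=` E]].
exists (S, S); first by split; exists X0.
move=> [_ _] [/= [X [X0X XE] <-] [Y [X0Y YE] <-]]; rewrite -ball_normE /=.
rewrite -(subrKA (fproj X0 v)) (splitr e') rmorphD /=.
by apply: le_lt_trans (ler_normD _ _) _; rewrite ltrD ?h // distrC h.
Qed.

Lemma orthonormal_projection v :
  exists2 l, closed_span E l & forall x, E x -> inner (v - l) x = 0.
Proof.
have FF := fm_proper v; pose l := lim (fm v).
have near e : 0 < e -> forall X0 : {fset H}, [set` X0] `<=` E ->
    exists2 X : {fset H}, (X0 `<=` X)%fset /\ [set` X] `<=` E & `|l - fproj X v| < e.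
  move=> e0 X0 X0E; have /(@cvgrPdist_lt _ _ _ (fm v) _ id) /(_ _ e0) h : fm v --> l := @fm_cvg v.
  have h' : fm v [set fproj X v | X in [set X : {fset H} | (X0 `<=` X)%fset /\ [set` X] `<=` E]].
    by exists X0.
  by have [y [/= ly [X XX yE]]] := filter_ex (filterI h h'); exists X; rewrite // yE.
exists l.
  apply/closure_approxP => e e0.
  have [|X [_ XE] lX] := near e e0 fset0; first by move=> x; rewrite /= inE.
  exists (fproj X v) => //; exists [seq (inner v x, x) | x <- X]; rewrite big_map; split=> //.
  by move=> _ /mapP[x xX ->]; exact: XE.
move=> x Ex; apply/eqP; rewrite -normr_le0; apply/ler_addgt0Pr => e e0.
have x1 : `|x| = 1.
  by apply/eqP; rewrite -sqrp_eq1 // norm_inner onE // eqxx.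
have [|X [xX XE] lX] := near e e0 [fset x]%fset; first by move=> y; rewrite /= inE => /eqP ->.
have xX' : x \in X by rewrite (fsubsetP xX) // inE.
rewrite add0r (_ : inner (v - l) x = inner (fproj X v - l) x).
  by apply: le_trans (Defs.CauchySchwarz _ _) _; rewrite x1 mulr1 distrC ltW.
by rewrite !innerBl inner_fproj.
Qed.

End Orthonormal.

Section OrthogonalProjection.
Variables (R : realType) (H : hilbertType R) (P : bop H).
Hypotheses (Ps : star P = P) (PP : P ⋅ P = P).

Let V := [set x | P x = x].

Let PK x : P (P x) = P x. Proof. by rewrite -[in RHS]PP. Qed.
Let PC x y : inner (P x) y = inner x (P y). Proof. by rewrite bop_starP Ps. Qed.

Lemma norm_projection x : `|P x| <= `|x|.
Proof.
have [->|x0] := eqVneq `|P x| 0; first exact: normr_ge0.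
rewrite -(@ler_pM2r _ `|P x|); last by rewrite lt_def x0 normr_ge0.
rewrite -expr2 norm_inner PC PK -(ger0_norm (x := inner x (P x))).
  exact: Defs.CauchySchwarz.
by rewrite -PK -PC inner_ge0.
Qed.

(** A maximal orthonormal subset of [V], from Zorn's lemma, is total: otherwise the normalized
    residue of some [v] could be added. That residue stays in [V] because the fixed space of [P] is
    closed. *)
Lemma orthonormal_basis_ex : exists E, orthonormal_basis V E.
Proof.
pose on (E : set H) := E `<=` V /\ forall x y, E x -> E y -> inner x y = (x == y)%:R :> R[i].
have [F FP Ftot|A [[AV Aon] Amax]] := @Zorn_bigcup H on.
  split=> [x [E /FP [EV _] /EV //]|x y [E1 F1 E1x] [E2 F2 E2y]].
  have [h|h] := Ftot _ _ F1 F2.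
    by apply: (FP _ F2).2 => //; exact: h.
  by apply: (FP _ F1).2 => //; exact: h.
exists A; split=> // v Vv.
have [l lA lo] := orthonormal_projection Aon v.
suff -> : v = l by [].
apply/eqP; rewrite -subr_eq0; apply/negPn/negP => u0.
have lV : P l = l.
  apply: (@continuous_eq_closure _ _ _ P id (lin_span A)) => //.
  - exact: bop_continuous.
  - by move=> x; exact: cvg_id.
  move=> _ [s [sA ->]]; rewrite bop_sum; apply: eq_big_seq => u us.
  by rewrite bopZ (AV _ (sA _ us)).
pose u := `|v - l|^-1 *: (v - l).
have uu : inner u u = 1.
  rewrite innerZl innerZr -norm_inner geC0_conj ?invr_ge0 // expr2.
  by rewrite mulKf ?normr_eq0 // mulVf ?normr_eq0.
have uA x : A x -> inner u x = 0 by move=> Ax; rewrite innerZl lo ?mulr0.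
have uA' x : A x -> inner x u = 0 by move=> Ax; rewrite innerC uA ?rmorph0.
have nA : ~ A u by move=> /uA; rewrite uu => /eqP; rewrite oner_eq0.
apply: (Amax (A `|` [set u])).
  split; first by move=> x Ax; left.
  by move=> /(_ u (or_intror erefl)).
split=> [x [/AV //|->]|x y]; first by rewrite /V /= /u bopZ bopB lV Vv.
have ne x' : A x' -> (x' == u) = false.
  by move=> Ax; apply/eqP => xu; apply: nA; rewrite -xu.
move=> [Ax|->] [Ay|->].
- exact: Aon.
- by rewrite uA' // ne.
- by rewrite uA // eq_sym ne.
- by rewrite uu eqxx.
Qed.

(** The condition in [trace_on] quantifies over all bases and would be vacuous without one; a single
    basis makes the sum unique. *)
Lemma trace_onE (T : bop H) (tau : R[i]) :
  (forall E, orthonormal_basis V E -> has_sum E (fun x => inner (T x) x) tau) ->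
  trace_on V T = tau.
Proof.
move=> h; have [E EV] := orthonormal_basis_ex.
apply: xget_subset1 => // t1 t2 /(_ E EV) h1 /(_ E EV) h2.
apply/eqP; rewrite -subr_eq0 -normr_le0; apply/ler_addgt0Pr => e e0.
have [e' e'0 ->] := gt0_complex e0.
have e20 : 0 < e' / 2 by rewrite divr_gt0.
have [X1 X1E hX1] := h1 _ e20; have [X2 X2E hX2] := h2 _ e20.
pose X := (X1 `|` X2)%fset.
have XE : [set` X] `<=` E by move=> x /=; rewrite inE => /orP[/X1E|/X2E].
have := hX1 X (fsubsetUl _ _) XE; have := hX2 X (fsubsetUr _ _) XE.
rewrite add0r; set s := \sum_(x <- X) _ => l2 l1.
rewrite -(subrKA s) (splitr e') rmorphD /=.
by apply: le_trans (ler_normD _ _) _; rewrite lerD // ltW // distrC.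
Qed.

Variables (nu : nat -> R) (e f : nat -> H) (A S : bop H) (tau : R[i]).
Hypotheses (nu0 : forall k, 0 <= nu k) (nuc : cvgn (series nu)).
Hypotheses (e1 : forall k, `|e k| <= 1) (f1 : forall k, `|f k| <= 1).
Hypothesis AE : forall x,
  (\sum_(0 <= k < m) ((nu k)%:C * inner x (e k)) *: f k) @[m --> \oo] --> A x.
Hypothesis tauE :
  (\sum_(0 <= k < m) (nu k)%:C * inner (P (S (f k))) (e k)) @[m --> \oo] --> (tau : R[i]^o).

(** A finite basis sum over [X] equals the series with [fproj X (S (f k))] in the place of
    [P (S (f k))]. Finitely many [k] are handled by enlarging [X], the others by the tail of
    [nu]. *)
Lemma trace_on_series : trace_on V (S ⋅ A) = tau.
Proof.
apply: trace_onE => E [EV onE VE] ep ep0.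
have [M0' M0'0 SM'] := bop_bound S.
pose M := M0' + 1.
have M0 : 0 < M by rewrite ltr_wpDl.
have SM x : `|S x| <= M%:C * `|x|.
  by apply: le_trans (SM' x) _; rewrite ler_wpM2r // lecR lerDl.
have ep40 : 0 < ep / 4 / M by rewrite !divr_gt0.
have /cauchy_cvgP/cauchy_seriesP /(_ _ ep40)[[N1 N2] [/= [n1 _ hn1] [n2 _ hn2] hN]] := nuc.
pose N := maxn n1 n2.
have tail m : (N <= m)%N -> \sum_(N <= k < m) nu k < ep / 4 / M.
  move=> Nm; apply: le_lt_trans (ler_norm _) (hN (N, m) _); split.
    by apply: hn1; rewrite /= leq_maxl.
  by apply: hn2; rewrite /= (leq_trans _ Nm) // leq_maxr.
pose t := \sum_(0 <= k < N) nu k.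
have t0 : 0 <= t by apply: sumr_ge0.
(* Error budget: the first [N] terms have weight [t] and error [d], the tail has weight below
   [ep / 4 / M] and error [M]. The [+ 1] covers [t = 0]. *)
pose d := ep / 4 / (t + 1).
have d0 : 0 < d by rewrite !divr_gt0 // ltr_wpDl.
have dt : d * t <= ep / 4.
  rewrite /d mulrAC ler_pdivrMr ?ltr_wpDl // ler_pM2l ?divr_gt0 //.
  by rewrite lerDl.
have [X0 X0E hX0] : exists2 X0 : {fset H}, [set` X0] `<=` E &
    forall k, (k < N)%N -> forall X : {fset H}, (X0 `<=` X)%fset -> [set` X] `<=` E ->
    `|P (S (f k)) - fproj X (P (S (f k)))| <= d%:C.
  elim: (N) => [|n [X XE hX]]; first by exists fset0 => // x; rewrite /= inE.
  have dc0 : 0 < d%:C by rewrite ltcR.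
  have [|Y YE hY] := fproj_approx onE (v := P (S (f n))) _ dc0.
    by apply: VE; rewrite /V /= PK.
  exists (X `|` Y)%fset; first by move=> x /=; rewrite inE => /orP[/XE|/YE].
  move=> k; rewrite ltnS leq_eqVlt => /orP[/eqP ->|kn] Z ZXY ZE.
    by apply: hY => //; apply: fsubset_trans ZXY; exact: fsubsetUr.
  by apply: hX => //; apply: fsubset_trans ZXY; exact: fsubsetUl.
exists X0 => // X X0X XE.
have fP w : fproj X w = fproj X (P w).
  by apply: eq_big_seq => x xX; rewrite PC (EV x) //; exact: XE.
pose D m := \sum_(0 <= k < m) (nu k)%:C * inner (fproj X (S (f k)) - P (S (f k))) (e k) : R[i]^o.
have Dl : D @ \oo --> (\sum_(x <- X) inner (S (A x)) x - tau : R[i]^o).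
  pose F x m := inner (S (\sum_(0 <= k < m) ((nu k)%:C * inner x (e k)) *: f k)) x : R[i]^o.
  have Fl x : F x @ \oo --> (inner (S (A x)) x : R[i]^o).
    have c : continuous (fun y => inner (S y) x : R[i]^o).
      move=> y; apply: (@continuous_comp _ _ _ S (fun y => inner y x : R[i]^o)).
        exact: bop_continuous.
      exact: inner_continuousl.
    exact: (cvg_comp _ _ (@AE x) (c (A x))).
  have Fs : (fun m => \sum_(x <- X) F x m) @ \oo --> (\sum_(x <- X) inner (S (A x)) x : R[i]^o).
    by apply: cvg_big => [|x _]; [exact: add_continuous|exact: Fl].
  rewrite (_ : D = fun m => \sum_(x <- X) F x m -
    \sum_(0 <= k < m) (nu k)%:C * inner (P (S (f k))) (e k)).
    have h := @cvgB _ R[i]^o _ _ _ _ _ _ _ Fs tauE.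
    exact: h.
  apply/funext => m; rewrite /D /F.
  transitivity (\sum_(0 <= k < m) (nu k)%:C * inner (fproj X (S (f k))) (e k) -
    \sum_(0 <= k < m) (nu k)%:C * inner (P (S (f k))) (e k)).
    by rewrite -sumrB; apply: eq_bigr => k _; rewrite innerBl mulrBr.
  congr (_ - _); under [RHS]eq_bigr do rewrite bop_sum inner_suml.
  rewrite exchange_big; apply: eq_bigr => k _; rewrite inner_suml mulr_sumr.
  by apply: eq_bigr => x _; rewrite bopZ !innerZl -mulrA [inner (S _) _ * _]mulrC.
apply: (@le_lt_trans _ _ (ep / 2)%:C); last by rewrite ltcR ltr_pdivrMr // ltr_pMr // ltr1n.
apply: (@cvg_norm_le _ R[i]^o _ _ _ Dl); exists N => // m /= Nm.
pose b k := if (k < N)%N then d else M.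
have Db k : `|inner (fproj X (S (f k)) - P (S (f k))) (e k)| <= (b k)%:C.
  apply: le_trans (Defs.CauchySchwarz _ _) _.
  apply: le_trans (ler_wpM2l (normr_ge0 _) (e1 k)) _; rewrite mulr1 distrC fP /b.
  case: ltnP => [kN|_]; first exact: hX0.
  apply: le_trans (norm_fproj_compl onE _ XE) _; apply: le_trans (norm_projection _) _.
  apply: le_trans (SM _) _; rewrite -[leRHS]mulr1 ler_wpM2l // ler0c ltW //.
apply: (@le_trans _ _ (\sum_(0 <= k < m) nu k * b k)%:C).
  rewrite rmorph_sum; apply: le_trans (ler_norm_sum _ _ _) _; apply: ler_sum => k _.
  rewrite /= realCM normrM [X in X * _]ger0_norm ?ler0c //.
  by rewrite ler_wpM2l // ler0c.
rewrite lecR (big_cat_nat (n := N)) //= (_ : ep / 2 = ep / 4 + ep / 4); last by field.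
apply: lerD.
  apply: le_trans dt; rewrite mulr_sumr le_eqVlt; apply/orP; left; apply/eqP.
  by apply: eq_big_nat => k /andP[_ kN]; rewrite /b kN mulrC.
apply: (@le_trans _ _ (M * \sum_(N <= k < m) nu k)); last first.
  by rewrite mulrC -ler_pdivlMr // ltW // tail.
rewrite mulr_sumr le_eqVlt; apply/orP; left; apply/eqP.
by apply: eq_big_nat => k /andP[Nk _]; rewrite /b ltnNge Nk mulrC.
Qed.

End OrthogonalProjection.

(** * Singular values *)

Section SummableCancellation.
Variables (R : realType) (mu : nat -> R) (r : nat).
Hypotheses (mu0 : forall k, 0 <= mu k) (r0 : (0 < r)%N).
Hypothesis muc : cvgn (series (fun k => mu k ^+ r)).

Lemma small_tail_pos (l : R) : 0 < l -> exists N, forall k, (N <= k)%N -> mu k != l.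
Proof.
move=> l0; have /cvgr0Pnorm_lt /(_ (l ^+ r)) := cvg_series_cvg_0 muc.
rewrite exprn_gt0 // => /(_ isT)[N _ hN]; exists N => k Nk.
apply/eqP => kl; have := hN k Nk; rewrite /= kl ger0_norm ?ltxx //.
by rewrite exprn_ge0 // ltW.
Qed.

Lemma level_set_ex (l : R) : 0 < l -> exists2 J, uniq J & forall k, (k \in J) = (mu k == l).
Proof.
move=> /small_tail_pos[N hN]; exists [seq k <- iota 0 N | mu k == l].
  by rewrite filter_uniq // iota_uniq.
move=> k; rewrite mem_filter mem_iota /= add0n.
by case: ltnP => [_|/hN /negPf ->]; rewrite ?andbT.
Qed.

(** Finite unions of full level sets: the [e j] with [j] in [J] span a space preserved by every
    operator that commutes with [C ^ 2]. *)
Definition level_closed (J : seq nat) :=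
  [/\ uniq J, forall j, j \in J -> mu j != 0
    & forall j k, j \in J -> mu k = mu j -> k \in J].

Lemma level_closed_ex N : exists2 J, level_closed J &
  forall k, (k < N)%N -> mu k != 0 -> k \in J.
Proof.
have [N' hN'] : exists N', forall k i, (N' <= k)%N -> (i < N)%N -> mu i != 0 -> mu k != mu i.
  elim: N => [|n [m hm]]; first by exists 0%N.
  have [z|z] := eqVneq (mu n) 0.
    exists m => k i mk; rewrite ltnS leq_eqVlt => /orP[/eqP ->|]; first by rewrite z eqxx.
    exact: hm.
  have hm' : exists m', forall k, (m' <= k)%N -> mu k != mu n.
    by apply: small_tail_pos; rewrite lt_def z mu0.
  have [m'' h''] := hm'; exists (maxn m m'') => k i.
  rewrite geq_max => /andP[mk m'k]; rewrite ltnS leq_eqVlt => /orP[/eqP -> _|].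
    exact: h''.
  exact: hm.
exists [seq k <- iota 0 N' | (mu k \in map mu (iota 0 N)) && (mu k != 0)].
  split=> [|j|j k]; rewrite ?filter_uniq ?iota_uniq // !mem_filter.
    by case/andP => /andP[].
  move=> /andP[/andP[jN j0] _] kj; rewrite kj jN j0 /= mem_iota /= add0n.
  rewrite ltnNge; apply/negP => N'k; case/mapP: jN => q.
  rewrite mem_iota add0n /= => qN jq.
  by have := hN' k q N'k qN; rewrite -jq kj eqxx j0 => /(_ isT).
move=> k kN k0; rewrite mem_filter k0 andbT mem_iota add0n /=; apply/andP; split.
  by apply: map_f; rewrite mem_iota.
by rewrite ltnNge; apply/negP => N'k; have := hN' k k N'k kN k0; rewrite eqxx.
Qed.

Lemma sum_uniq_nat (V : zmodType) (J : seq nat) (P : pred nat) (F : nat -> V) m :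
  uniq J -> (forall k, k \in J -> (k < m)%N) ->
  \sum_(k <- J | P k) F k = \sum_(0 <= k < m) (if (k \in J) && P k then F k else 0).
Proof.
move=> Ju Jm; rewrite -[LHS]big_filter.
rewrite [RHS](_ : _ = \sum_(0 <= k < m | (k \in J) && P k) F k); last by rewrite [RHS]big_mkcond.
rewrite -[RHS]big_filter; apply: perm_big.
apply: uniq_perm; rewrite ?filter_uniq ?iota_uniq // => k.
rewrite !mem_filter mem_index_iota /=.
case kJ: (k \in J); rewrite ?andbF //= ?andbT.
by rewrite (Jm _ kJ) andbT.
Qed.

(** A partial sum may cut level sets apart. It is compared with the sum over a level-closed [J]
    containing all small indices; the discrepancy only involves indices from [N] on, whose total is
    bounded by the tail. *)
Lemma cvg_level_cancel (g : nat -> R[i]) (K : R) J1 :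
  0 <= K -> (forall k, `|g k| <= (K * mu k ^+ r)%:C) -> uniq J1 ->
  (forall k, (k \in J1) = (mu k == 1)) ->
  (forall J, level_closed J -> \sum_(k <- J | mu k != 1) g k = 0) ->
  (\sum_(0 <= k < m) g k) @[m --> \oo] --> (\sum_(k <- J1) g k : R[i]^o).
Proof.
move=> K0 gK J1u J1E Jg; apply/(@cvgrPdist_le _ R[i]^o) => e0 e0p.
have [e ep ->] := gt0_complex e0p.
have eK : 0 < e / (K + 1) by rewrite divr_gt0 // ltr_wpDl.
have /cauchy_cvgP/cauchy_seriesP /(_ _ eK)[[N1 N2] [/= [n1 _ hn1] [n2 _ hn2] hN]] := muc.
have [n3 hn3] := small_tail_pos ltr01.
pose N := maxn n1 (maxn n2 n3).
have tail m : (N <= m)%N -> \sum_(N <= k < m) mu k ^+ r < e / (K + 1).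
  move=> Nm; apply: le_lt_trans (ler_norm _) (hN (N, m) _); split.
    by apply: hn1; rewrite /= leq_maxl.
  by apply: hn2; rewrite /= (leq_trans _ Nm) // /N !leq_max leqnn orbT.
have J1N k : k \in J1 -> (k < N)%N.
  rewrite J1E ltnNge => k1; apply/negP => Nk.
  have := hn3 k; rewrite k1 => /(_ _)/negP; apply=> //; apply: leq_trans Nk.
  by rewrite !leq_max leqnn !orbT.
have [J Jc JN] := level_closed_ex N.
have [Ju J0 _] := Jc.
exists N => // m /= Nm.
pose M := maxn m (\max_(k <- J) k.+1).
have JM k : k \in J -> (k < M)%N.
  by move=> kJ; rewrite /M leq_max (leq_bigmax_seq (F := fun k => k.+1)) ?orbT.
have NM : (N <= M)%N by rewrite (leq_trans Nm) // leq_maxl.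
have J1M k : k \in J1 -> (k < M)%N by move=> /J1N /leq_trans; apply.
have e1 : \sum_(k <- J1) g k = \sum_(0 <= k < M) (if mu k == 1 then g k else 0).
  rewrite (sum_uniq_nat _ _ J1u J1M); apply: eq_bigr => k _.
  by rewrite J1E andbT.
have e2 : \sum_(0 <= k < m) g k = \sum_(0 <= k < M) (if (k < m)%N then g k else 0).
  rewrite (big_cat_nat (n := m) (p := M)) ?leq_maxl //= [X in _ = _ + X]big_nat_cond.
  rewrite [X in _ = _ + X]big1 => [|k /andP[/andP[mk _] _]]; last by rewrite ltnNge mk.
  by rewrite addr0; apply: eq_big_nat => k /andP[_ ->].
have e3 := sum_uniq_nat (fun k => mu k != 1) g Ju JM; rewrite Jg // in e3.
(* The vanishing sum over [J] enters as a [0] expanded by [e3], so that the terms of index below [N]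
   cancel one by one. *)
rewrite distrC (_ : _ - _ = \sum_(0 <= k < m) g k - 0 - \sum_(k <- J1) g k); last by rewrite subr0.
rewrite [X in _ - X - _]e3 e1 e2 -!sumrB.
rewrite (big_cat_nat (n := N)) //= big_nat_cond big1 => [|k /andP[/andP[_ kN] _]]; last first.
  rewrite (leq_trans kN Nm); case: eqP => [_|/eqP k1]; first by rewrite andbF subr0 subrr.
  rewrite andbT subr0; case kJ: (k \in J); first by rewrite subrr.
  rewrite subr0; have [k0|/(JN k kN)] := eqVneq (mu k) 0; last by rewrite kJ.
  apply/eqP; rewrite -normr_le0; apply: le_trans (gK k) _.
  by rewrite k0 expr0n eqn0Ngt r0 mulr0.
rewrite add0r; apply: le_trans (ler_norm_sum _ _ _) _.
apply: (@le_trans _ _ (\sum_(N <= k < M) K * mu k ^+ r)%:C).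
  rewrite rmorph_sum; rewrite big_nat_cond [leRHS]big_nat_cond.
  apply: ler_sum => k /andP[/andP[Nk _] _] /=; apply: le_trans (gK k).
  have k1 : mu k == 1 = false by rewrite -J1E; apply/negP => /J1N; rewrite ltnNge Nk.
  by rewrite k1 subr0; case: ifP => _; case: ifP => _;
    rewrite ?subrr ?subr0 ?sub0r ?normrN ?normr0.
rewrite lecR -mulr_sumr; apply: (@le_trans _ _ ((K + 1) * (e / (K + 1)))); last first.
  by rewrite mulrC divfK // gt_eqF // ltr_wpDl.
apply: ler_pM => //; first by apply: sumr_ge0 => k _; rewrite exprn_ge0.
  by rewrite lerDl.
by rewrite ltW // tail.
Qed.

End SummableCancellation.

Section SchattenNormalForm.
Variables (R : realType) (H : hilbertType R).

(* Unlike in [schatten], [e k] and [f k] vanish when [mu k] does. *)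
Definition singular_values (r : nat) (T : bop H) (mu : nat -> R) (e f : nat -> H) :=
  [/\ forall k, 0 <= mu k, cvgn (series (fun k => mu k ^+ r)),
      forall j k, inner (e j) (e k) = ((j == k) && (mu j != 0))%:R :> R[i],
      forall j k, inner (f j) (f k) = ((j == k) && (mu j != 0))%:R :> R[i]
    & forall x, (\sum_(0 <= k < m) ((mu k)%:C * inner x (e k)) *: f k)
        @[m --> \oo] --> T x].

Lemma schatten_singular_values r T : schatten r T ->
  exists mu e f, singular_values r T mu e f.
Proof.
move=> [mu [e [f [mu0 on muc TE]]]].
pose z (v : nat -> H) k := if mu k == 0 then 0 else v k.
exists mu, (z e), (z f); split=> // [j k|j k|x].
- rewrite /z; case: (eqVneq (mu j) 0) => [_|j0]; first by rewrite inner0l andbF.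
  case: (eqVneq (mu k) 0) => [k0|k0]; last by rewrite (on _ _ j0 k0).1 andbT.
  rewrite inner0r; case: eqP => // jk; by rewrite jk k0 eqxx in j0.
- rewrite /z; case: (eqVneq (mu j) 0) => [_|j0]; first by rewrite inner0l andbF.
  case: (eqVneq (mu k) 0) => [k0|k0]; last by rewrite (on _ _ j0 k0).2 andbT.
  rewrite inner0r; case: eqP => // jk; by rewrite jk k0 eqxx in j0.
- rewrite (_ : (fun m => _) = fun m => \sum_(0 <= k < m) ((mu k)%:C * inner x (e k)) *: f k) //.
  apply/funext => m; apply: eq_bigr => k _; rewrite /z.
  by case: eqP => // ->; rewrite !mul0r !scale0r.
Qed.

(** Carries the decomposition of [[F, P]], where summability is given, over to [C = F [F, P]]. *)
Lemma singular_values_isometry r T F mu e f : star F ⋅ F = cone ->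
  singular_values r T mu e f -> singular_values r (F ⋅ T) mu e (fun k => F (f k)).
Proof.
move=> FF [mu0 muc ee ff TE]; split=> // [j k|x].
  by rewrite bop_starP -[star F (F _)]/((star F ⋅ F) _) FF ff.
rewrite (_ : (fun m => _) =
  fun m => F (\sum_(0 <= k < m) ((mu k)%:C * inner x (e k)) *: f k)).
  rewrite bop_cmulE; have h := bop_continuous (T := F) (x := T x).
  exact: (cvg_comp _ _ (TE x) h).
by apply/funext => m; rewrite bop_sum; apply: eq_bigr => k _; rewrite bopZ.
Qed.

End SchattenNormalForm.

Lemma scale_half_double (R : realType) (V : lmodType R[i]) (v : V) : 2^-1 *: (v + v) = v.
Proof.
rewrite scalerDr -scalerDl (_ : 2^-1 + 2^-1 = 1) ?scale1r //.
by rewrite [RHS]splitr mul1r.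
Qed.

Lemma eventually_const_lim (R : realType) (V : normedModType R[i]) (u : nat -> V) a b N :
  u @ \oo --> a -> (forall m, (N <= m)%N -> u m = b) -> a = b.
Proof.
move=> ua ub; apply: (@norm_cvg_unique _ _ (u @ \oo)) => //=.
by apply: cvg_near_cst; exists N.
Qed.

Section CommutingProjections.
Variables (R : realType) (H : hilbertType R).
Implicit Types P Q : bop H.

Definition is_projector P := star P = P /\ P ⋅ P = P.

Lemma projector_mul P Q : is_projector P -> is_projector Q -> P ⋅ Q = Q ⋅ P ->
  is_projector (P ⋅ Q).
Proof.
move=> [Ps PP] [Qs QQ] PQ; split; first by rewrite starM Ps Qs PQ.
by rewrite -cmulA [Q ⋅ (P ⋅ Q)]cmulA -PQ -[P ⋅ Q ⋅ Q]cmulA QQ cmulA PP.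
Qed.

Lemma projector_mul_fixed P Q x : is_projector P -> is_projector Q -> P ⋅ Q = Q ⋅ P ->
  ((P ⋅ Q) x = x) <-> (P x = x /\ Q x = x).
Proof.
move=> [_ PP] [_ QQ] PQ; split=> [h|[Px Qx]]; last by rewrite bop_cmulE Qx Px.
have Px : P x = x by rewrite -[in RHS]h -[in LHS]h -!bop_cmulE cmulA PP.
have Qx : Q x = x by rewrite -[in RHS]h -[in LHS]h PQ -!bop_cmulE cmulA QQ.
by [].
Qed.

Lemma symmetry_projector (s : bop H) : star s = s -> s ⋅ s = cone ->
  is_projector (2^-1 *: (cone + s)).
Proof.
move=> ss s1; split; first by rewrite starZ starD star1 ss fmorphV rmorph_nat.
rewrite cmulZl cmulZr scalerA cmulDl !cmulDr !cmul1l cmul1r s1.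
by rewrite [s + cone]addrC -scalerA scale_half_double.
Qed.

Lemma symmetry_projector_fixed (s : bop H) x :
  (2^-1 *: (cone + s)) x = x <-> s x = x.
Proof.
rewrite bopZE bopDE bop_coneE; split=> h.
  have n2 : 2^-1 != 0 :> R[i] by rewrite invr_eq0 pnatr_eq0.
  by apply: (addrI x); apply: (scalerI n2); rewrite h scale_half_double.
by rewrite h scale_half_double.
Qed.

End CommutingProjections.

(** * Eigenspaces of the square of a self-adjoint Schatten operator *)

Section Spectral.
Variables (R : realType) (H : hilbertType R) (C : bop H) (r : nat).
Variables (mu : nat -> R) (e f : nat -> H).
Hypotheses (Cs : star C = C) (Csv : singular_values r C mu e f) (r0 : (0 < r)%N).

Let mu0 k : 0 <= mu k. Proof. by case: Csv => /(_ k). Qed.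
Let muc : cvgn (series (fun k => mu k ^+ r)). Proof. by case: Csv. Qed.
Let ee j k : inner (e j) (e k) = ((j == k) && (mu j != 0))%:R :> R[i].
Proof. by case: Csv. Qed.
Let ff j k : inner (f j) (f k) = ((j == k) && (mu j != 0))%:R :> R[i].
Proof. by case: Csv. Qed.
Let CE x : (\sum_(0 <= k < m) ((mu k)%:C * inner x (e k)) *: f k) @[m --> \oo] --> C x.
Proof. by case: Csv => _ _ _ _; apply. Qed.
Let CC x y : inner (C x) y = inner x (C y). Proof. by rewrite bop_starP Cs. Qed.

Let norm_unit (v : nat -> H) k :
  (forall j k, inner (v j) (v k) = ((j == k) && (mu j != 0))%:R :> R[i]) -> `|v k| <= 1.
Proof.
move=> vv; rewrite -(@ler_pXn2r _ 2) ?nnegrE // norm_inner vv eqxx expr1n.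
by case: (_ != _).
Qed.

Lemma norm_e_le1 k : `|e k| <= 1. Proof. exact: norm_unit. Qed.
Lemma norm_f_le1 k : `|f k| <= 1. Proof. exact: norm_unit. Qed.

Lemma singular_e j : C (e j) = (mu j)%:C *: f j.
Proof.
apply: (eventually_const_lim (N := j.+1) (@CE (e j))) => m jm; rewrite (bigD1_seq j) ?iota_uniq ?mem_index_iota //=.
rewrite big1 => [|k kj]; last by rewrite ee eq_sym (negPf kj) mulr0 scale0r.
rewrite addr0 ee eqxx /=; have [->|_] := eqVneq (mu j) 0; first by rewrite !mul0r.
by rewrite mulr1.
Qed.

(** Self-adjointness makes [C] exchange the two families of singular vectors, whence [e j] is an
    eigenvector of [C ^ 2], though in general not of [C]. *)
Lemma singular_f j : C (f j) = (mu j)%:C *: e j.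
Proof.
apply: inner_inj => x; rewrite -CC innerZr.
have h : (fun m => \sum_(0 <= k < m) (mu k)%:C * inner x (e k) * inner (f k) (f j) : R[i]^o)
    @ \oo --> (inner (C x) (f j) : R[i]^o).
  rewrite (_ : (fun m => _) =
    fun m => inner (\sum_(0 <= k < m) ((mu k)%:C * inner x (e k)) *: f k) (f j)).
    exact: (cvg_comp _ _ (@CE x) (inner_continuousl (y := f j) (x := C x))).
  by apply/funext => m; rewrite inner_suml; apply: eq_bigr => k _; rewrite innerZl.
apply: (@eventually_const_lim _ R[i]^o _ _ _ j.+1 h) => m jm; rewrite (bigD1_seq j) ?iota_uniq ?mem_index_iota //=.
rewrite big1 => [|k kj]; last by rewrite ff (negPf kj) mulr0.
rewrite addr0 ff eqxx /= geC0_conj ?ler0c //.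
by have [->|_] := eqVneq (mu j) 0; rewrite ?mul0r // mulr1.
Qed.

Lemma singular_sqr j : C (C (e j)) = (mu j ^+ 2)%:C *: e j.
Proof. by rewrite singular_e bopZ singular_f scalerA -realCM. Qed.

(** Such an [x] is orthogonal to every [e k] with [mu k != l], so the series of [C (C x)] reduces to
    a finite sum. [J] may exceed the level set, the extra coefficients being zero. *)
Lemma eigen_expand (l : R) x J : 0 < l -> C (C x) = (l ^+ 2)%:C *: x ->
  uniq J -> (forall k, mu k = l -> k \in J) -> x = \sum_(j <- J) inner x (e j) *: e j.
Proof.
move=> l0 Cx Ju JE.
have xe k : mu k != l -> inner x (e k) = 0.
  move=> kl; have : (l ^+ 2)%:C * inner x (e k) = (mu k ^+ 2)%:C * inner x (e k).
    by rewrite -innerZl -Cx !CC singular_sqr innerZr geC0_conj // ler0c exprn_ge0.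
  move/eqP; rewrite -subr_eq0 -mulrBl mulf_eq0 => /orP[|/eqP //].
  rewrite -rmorphB subr_sqr /= => /eqP/complexI/eqP; rewrite mulf_eq0 subr_eq0 eq_sym (negPf kl) /=.
  by rewrite gt_eqF // ltr_pwDl.
have lim : (\sum_(0 <= k < m) ((mu k ^+ 2)%:C * inner x (e k)) *: e k) @[m --> \oo] --> C (C x).
  rewrite (_ : (fun m => _) = fun m => C (\sum_(0 <= k < m) ((mu k)%:C * inner x (e k)) *: f k)).
    exact: (cvg_comp _ _ (@CE x) (bop_continuous (T := C) (x := C x))).
  apply/funext => m; rewrite bop_sum; apply: eq_bigr => k _.
  by rewrite bopZ singular_f scalerA mulrAC -realCM.
have l2 : (l ^+ 2)%:C != 0 :> R[i].
  by rewrite -[0]/(0%:C); apply/eqP => /complexI/eqP; rewrite expf_eq0 gt_eqF.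
apply: (scalerI l2); rewrite -Cx.
apply: (eventually_const_lim (N := \max_(j <- J) j.+1) lim) => m Jm.
have Jm' k : k \in J -> (k < m)%N.
  by move=> kJ; apply: leq_trans Jm; exact: (leq_bigmax_seq (F := fun k => k.+1)).
rewrite (sum_uniq_nat xpredT _ Ju Jm') scaler_sumr; apply: eq_bigr => k _.
rewrite andbT; have [kl|kl] := eqVneq (mu k) l; first by rewrite JE // kl scalerA.
by rewrite xe // mulr0 !scale0r; case: ifP; rewrite ?scaler0 // xe // scale0r.
Qed.

(* A self-adjoint [W] commuting with [C ^ 2] preserves the finite dimensional *)
(* spaces spanned by level sets; the trace of [Y W W] is then both itself and *)
(* its opposite.                                                              *)
Lemma level_trace_eq0 J (W Y : bop H) (h c : nat -> R[i]) :
  level_closed mu J -> star W = W -> W ⋅ (C ⋅ C) = C ⋅ C ⋅ W ->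
  (forall k, k \in J -> W (W (e k)) = c k *: e k) -> Y ⋅ W = - (W ⋅ Y) ->
  (forall j k, mu j = mu k -> h j = h k) ->
  \sum_(k <- J) h k * c k * inner (Y (e k)) (e k) = 0.
Proof.
move=> [Ju J0 Jc] Ws WC We YW hE.
have WW x y : inner (W x) y = inner x (W y) by rewrite bop_starP Ws.
pose b j k := inner (W (e k)) (e j).
have CCW k : C (C (W (e k))) = (mu k ^+ 2)%:C *: W (e k).
  by rewrite -!bop_cmulE -WC !bop_cmulE singular_sqr bopZ.
have WeE k : k \in J -> W (e k) = \sum_(j <- J) b j k *: e j.
  move=> kJ; apply: (eigen_expand (l := mu k)) => //.
    by rewrite lt_def (J0 _ kJ) mu0.
  by move=> j jk; exact: Jc jk.
have bC j k : b j k = (b k j)^* by rewrite /b WW innerC.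
have hb j k : h k * b j k = h j * b j k.
  have [jk|jk] := eqVneq (mu j) (mu k); first by rewrite (hE _ _ jk).
  suff -> : b j k = 0 by rewrite !mulr0.
  have : (mu k ^+ 2)%:C * b j k = (mu j ^+ 2)%:C * b j k.
    by rewrite -innerZl -CCW !CC singular_sqr innerZr geC0_conj // ler0c exprn_ge0.
  move/eqP; rewrite -subr_eq0 -mulrBl mulf_eq0 => /orP[|/eqP //].
  rewrite -rmorphB subr_sqr /= => /eqP/complexI/eqP.
  rewrite mulf_eq0 subr_eq0 eq_sym (negPf jk) /= paddr_eq0 // => /andP[/eqP k0 /eqP j0].
  by rewrite k0 j0 eqxx in jk.
set t := \sum_(k <- J) _; suff tt : t = - t.
  by apply/eqP; rewrite -[t == 0]/((2 == 0)%N || (t == 0)) -mulrn_eq0 mulr2n {1}tt addNr.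
transitivity (\sum_(k <- J) h k * inner (Y (W (W (e k)))) (e k)).
  by apply: eq_big_seq => k kJ; rewrite We // bopZ innerZl mulrA.
(* Cyclicity of a finite trace in coordinates: [Y W W = - W Y W], and the left factor [W] is moved
   to the right end past [h]. *)
transitivity (- \sum_(k <- J) \sum_(j <- J) \sum_(l <- J)
    inner (Y (e j)) (e l) * (h k * b j k * b k l)).
  rewrite -sumrN; apply: eq_big_seq => k kJ.
  have -> : Y (W (W (e k))) = - W (Y (W (e k))).
    by rewrite -[Y (W _)]bop_cmulE YW bopNE.
  rewrite innerNl mulrN WW {1}(WeE k kJ) {1}(WeE k kJ) bop_sum inner_suml; congr (- _).
  rewrite mulr_sumr; apply: eq_bigr => j _; rewrite inner_sumr mulr_sumr.
  by apply: eq_bigr => l _; rewrite bopZ innerZl innerZr -bC; ring.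
congr (- _); rewrite exchange_big; apply: eq_big_seq => j jJ; rewrite exchange_big.
transitivity (\sum_(l <- J) inner (Y (e j)) (e l) * (h j * inner (W (W (e l))) (e j))).
  apply: eq_big_seq => l lJ; rewrite -mulr_sumr; congr (_ * _).
  rewrite WW {1}(WeE l lJ) inner_suml mulr_sumr; apply: eq_big_seq => k kJ.
  by rewrite hb innerZl innerC -/(b k j) -bC; ring.
rewrite (bigD1_seq j) //= [X in _ + X]big1_seq => [|l /andP[lj lJ]]; last first.
  by rewrite We // innerZl ee (negPf lj) !mulr0.
by rewrite addr0 We // innerZl ee eqxx J0 // mulr1; ring.
Qed.

(** Written as the iterated product of [phi_F] at equal arguments, so that the two are
    convertible. *)
Definition bop_exp (T : bop H) m : bop H := \big[cmul/cone]_(i < m) T.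

Lemma bop_expS T m : bop_exp T m.+1 = T ⋅ bop_exp T m.
Proof. exact: big_ord_recl. Qed.

Lemma bop_expSr T m : bop_exp T m.+1 = bop_exp T m ⋅ T.
Proof.
elim: m => [|m IHm]; first by rewrite bop_expS /bop_exp big_ord0 cmul1l cmul1r.
by rewrite bop_expS {1}IHm cmulA -bop_expS.
Qed.

Lemma bop_exp_singular m j : bop_exp C m.*2 (f j) = (mu j ^+ m.*2)%:C *: f j.
Proof.
elim: m => [|m IHm]; first by rewrite /bop_exp big_ord0 expr0 scale1r.
rewrite doubleS !bop_expS !bop_cmulE IHm !bopZ singular_f bopZ singular_e !scalerA.
by rewrite -!realCM; congr (_%:C *: _); rewrite !exprS; ring.
Qed.

Lemma bop_exp_series m x :
  (\sum_(0 <= k < N) ((mu k ^+ m.*2.+1)%:C * inner x (e k)) *: f k) @[N --> \oo] -->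
  bop_exp C m.*2.+1 x.
Proof.
rewrite bop_expSr bop_cmulE (_ : (fun N => _) =
  fun N => bop_exp C m.*2 (\sum_(0 <= k < N) ((mu k)%:C * inner x (e k)) *: f k)).
  exact: (cvg_comp _ _ (@CE x) (bop_continuous (T := bop_exp C m.*2) (x := C x))).
apply/funext => N; rewrite bop_sum; apply: eq_bigr => k _.
by rewrite bopZ bop_exp_singular scalerA exprSr realCM; congr (_ *: _); ring.
Qed.

Variable J1 : seq nat.
Hypotheses (J1u : uniq J1) (J1E : forall k, (k \in J1) = (mu k == 1)).

(* [eigenproj1] projects onto [C ^ 2 x = x], [eigenproj] onto [C x = x]. *)
Definition eigenproj1 : bop H := \sum_(j <- J1) rank1 (e j) (e j).

Lemma eigenproj1E x : eigenproj1 x = \sum_(j <- J1) inner x (e j) *: e j.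
Proof. by rewrite bop_sumE. Qed.

Lemma eigenproj1_sqr x : C (C (eigenproj1 x)) = eigenproj1 x.
Proof.
rewrite eigenproj1E !bop_sum; apply: eq_big_seq => j; rewrite J1E => /eqP j1.
by rewrite !bopZ singular_sqr j1 expr1n scale1r.
Qed.

Lemma eigenproj1_fixed x : C (C x) = x -> eigenproj1 x = x.
Proof.
move=> Cx; rewrite eigenproj1E; apply/esym/(eigen_expand (l := 1)) => //.
  by rewrite expr1n scale1r.
by move=> k k1; rewrite J1E k1.
Qed.

Lemma eigenproj1_e k : eigenproj1 (e k) = if mu k == 1 then e k else 0.
Proof.
rewrite eigenproj1E; case: ifP => k1.
  rewrite (bigD1_seq k) ?J1E //= big1 => [|j jk]; last by rewrite ee eq_sym (negPf jk) scale0r.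
  by rewrite addr0 ee eqxx (eqP k1) oner_eq0 scale1r.
rewrite big1_seq // => j /=; rewrite J1E => j1; rewrite ee; case: eqP => [kj|]; last by rewrite scale0r.
by rewrite kj j1 in k1.
Qed.

Lemma eigenproj1_projector : is_projector eigenproj1.
Proof.
split; first by rewrite star_sum; apply: eq_bigr => j _; rewrite star_rank1.
by apply: bopP => x; rewrite bop_cmulE eigenproj1_fixed // eigenproj1_sqr.
Qed.

(** [X] preserves the fixed space of [C ^ 2]; the adjoint of that relation gives the commutation. *)
Lemma eigenproj1_commute X : star X = X -> X ⋅ (C ⋅ C) = C ⋅ C ⋅ X ->
  X ⋅ eigenproj1 = eigenproj1 ⋅ X.
Proof.
move=> Xs XC; have [Ks _] := eigenproj1_projector.
have h : eigenproj1 ⋅ (X ⋅ eigenproj1) = X ⋅ eigenproj1.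
  apply: bopP => x; rewrite bop_cmulE eigenproj1_fixed //.
  by rewrite -!bop_cmulE !cmulA -XC -!cmulA !bop_cmulE eigenproj1_sqr.
have := congr1 star h; rewrite !starM Ks Xs => h'.
by rewrite -[LHS]h cmulA h'.
Qed.

Definition eigenproj : bop H := 2^-1 *: ((cone + C) ⋅ eigenproj1).

Lemma eigenprojE x : eigenproj x = 2^-1 *: (eigenproj1 x + C (eigenproj1 x)).
Proof. by rewrite bopZE bop_cmulE bopDE. Qed.

Lemma eigenproj_C x : C (eigenproj x) = eigenproj x.
Proof. by rewrite eigenprojE bopZ bopD eigenproj1_sqr addrC. Qed.

Lemma eigenproj_fixed x : eigenproj x = x <-> C x = x.
Proof.
split=> [<-|Cx]; first exact: eigenproj_C.
by rewrite eigenprojE eigenproj1_fixed ?Cx // scale_half_double.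
Qed.

Lemma eigenproj_projector : is_projector eigenproj.
Proof.
have [Ks _] := eigenproj1_projector; split; last first.
  by apply: bopP => x; rewrite bop_cmulE; apply/eigenproj_fixed; exact: eigenproj_C.
rewrite starZ starM starD star1 Cs Ks fmorphV rmorph_nat /eigenproj.
congr (_ *: _); rewrite cmulDl cmulDr cmul1l cmul1r; congr (_ + _).
by rewrite eigenproj1_commute // cmulA.
Qed.

Lemma eigenproj_commute X : star X = X -> X ⋅ C = C ⋅ X ->
  X ⋅ eigenproj = eigenproj ⋅ X.
Proof.
move=> Xs XC; rewrite /eigenproj cmulZr cmulZl; congr (_ *: _).
rewrite -cmulA -eigenproj1_commute //; last by rewrite cmulA XC -cmulA XC cmulA.
by rewrite !cmulA cmulDl cmulDr XC cmul1l cmul1r.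
Qed.

Lemma eigenproj_e k : mu k != 1 -> eigenproj (e k) = 0.
Proof. by move=> /negPf k1; rewrite eigenprojE eigenproj1_e k1 bop0 addr0 scaler0. Qed.

Lemma eigenproj_e1 k : mu k = 1 -> eigenproj (e k) = 2^-1 *: (e k + C (e k)).
Proof. by move=> k1; rewrite eigenprojE eigenproj1_e k1 eqxx. Qed.

End Spectral.

(** * The index formula *)

Lemma trace_on_eq (R : realType) (H : hilbertType R) (V : set H) (S S' : bop H) :
  (forall x, V x -> S x = S' x) -> trace_on V S = trace_on V S'.
Proof.
move=> SS'; congr xget; apply/seteqP; split=> tau h E EV e e0;
  have [X0 X0E hX] := h E EV e e0; have [EV' _ _] := EV;
  exists X0 => // X X0X XE; apply: le_lt_trans (hX X X0X XE);
  rewrite le_eqVlt; apply/orP; left; apply/eqP; congr (`|_ - _|);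
  by apply: eq_big_seq => x /XE /EV' /SS' ->.
Qed.

Section OddOperator.
Variables (R : realType) (H : hilbertType R) (F g P T : bop H) (n : nat).
Hypotheses (Fs : star F = F) (FF : F ⋅ F = cone) (gs : star g = g) (gg : g ⋅ g = cone).
Hypotheses (Fg : F ⋅ g = - (g ⋅ F)) (Ps : star P = P) (PP : P ⋅ P = P).
Hypotheses (Pg : P ⋅ g = g ⋅ P) (TF : T ⋅ F = F ⋅ T).
Hypothesis TP : T ⋅ P = P ⋅ T.
Hypothesis Psch : schatten n.*2.+1 (commutator F P).

Let Q := F ⋅ P ⋅ F.
Let C := P - Q.
Let W := cone - P - Q.

Let Qs : star Q = Q. Proof. by rewrite /Q !starM Fs Ps cmulA. Qed.
Let QQ : Q ⋅ Q = Q.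
Proof. by rewrite /Q -!cmulA [F ⋅ (F ⋅ _)]cmulA FF cmul1l [P ⋅ (P ⋅ _)]cmulA PP. Qed.
Let Qg : Q ⋅ g = g ⋅ Q.
Proof.
by rewrite /Q -!cmulA Fg !cmulNr [P ⋅ (g ⋅ _)]cmulA Pg -!cmulA [F ⋅ (g ⋅ _)]cmulA Fg
  cmulNl opprK !cmulA.
Qed.
Let QT : T ⋅ Q = Q ⋅ T.
Proof. by rewrite /Q !cmulA TF -[F ⋅ T ⋅ P]cmulA TP -!cmulA TF. Qed.
Let Cs : star C = C. Proof. by rewrite starB Ps Qs. Qed.
Let Ws : star W = W. Proof. by rewrite !starB star1 Ps Qs. Qed.
Let Cg : g ⋅ C = C ⋅ g. Proof. by rewrite cmulBl cmulBr Pg Qg. Qed.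
Let CT : T ⋅ C = C ⋅ T. Proof. by rewrite cmulBl cmulBr TP QT. Qed.
Let Wg : g ⋅ W = W ⋅ g. Proof. by rewrite !cmulBl !cmulBr Pg Qg cmul1l cmul1r. Qed.
Let WT : T ⋅ W = W ⋅ T. Proof. by rewrite !cmulBl !cmulBr TP QT cmul1l cmul1r. Qed.
Let FC : F ⋅ C = commutator F P.
Proof. by rewrite cmulBr /Q !cmulA FF cmul1l. Qed.
Let CF : C ⋅ F = - (F ⋅ C).
Proof. by rewrite FC opprB cmulBl /Q -!cmulA FF cmul1r. Qed.
(** [W ⋅ C = P ⋅ Q - Q ⋅ P] is anti-self-adjoint, whereas both factors are self-adjoint. *)
Let WC : W ⋅ C = - (C ⋅ W).
Proof.
have h : W ⋅ C = P ⋅ Q - Q ⋅ P.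
  rewrite cmulBl cmulBl !cmulBr !cmul1l PP QQ !opprB.
  by rewrite [P - Q + _]addrC subrKA subrKA.
by rewrite h -[C ⋅ W]starK [star (C ⋅ W)]starM Cs Ws h starB [star (P ⋅ Q)]starM
  [star (Q ⋅ P)]starM Ps Qs opprB.
Qed.
Let WW : W ⋅ W = cone - C ⋅ C.
Proof.
have WP : W ⋅ P = - (Q ⋅ P) by rewrite !cmulBl cmul1l PP subrr sub0r.
have WQ : W ⋅ Q = - (P ⋅ Q) by rewrite !cmulBl cmul1l QQ addrAC subrr sub0r.
have h : W ⋅ W = W - - (Q ⋅ P) - - (P ⋅ Q) by rewrite -WP -WQ -{3}(cmul1r W) -!cmulBr.
have k : C ⋅ C = (P - Q ⋅ P) - (P ⋅ Q - Q).
  have CP : C ⋅ P = P - Q ⋅ P by rewrite cmulBl PP.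
  have CQ : C ⋅ Q = P ⋅ Q - Q by rewrite cmulBl QQ.
  by rewrite -CP -CQ -cmulBr.
rewrite h k !opprK opprB /W -!addrA; congr (_ + _).
rewrite addrC [RHS]addrCA opprB -!addrA; congr (_ + _).
by rewrite addrCA.
Qed.

Let bop_exp_odd m : F ⋅ bop_exp (commutator F P) m.*2.+1 =
  (-1) ^+ m *: bop_exp C m.*2.+1.
Proof.
have DD : commutator F P ⋅ commutator F P = - (C ⋅ C).
  by rewrite -FC cmulA -[F ⋅ C ⋅ F]cmulA CF cmulNr cmulA FF cmul1l cmulNl.
have h : bop_exp (commutator F P) m.*2 = (-1) ^+ m *: bop_exp C m.*2.
  elim: m => [|k IHk]; first by rewrite /bop_exp !big_ord0 scale1r.
  rewrite doubleS !bop_expS cmulA DD IHk cmulNl cmulZr -scalerN.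
  by rewrite cmulA exprSr mulrN1 scaleNr scalerN.
by rewrite !bop_expS h cmulZr -{1}FC !cmulZr !cmulA FF cmul1l.
Qed.

(** Both sides reduce to sums over the singular values equal to 1: the right one to half the sum of
    [<g T (f k), e k>], the left one to half the sum of [<g T (f k), e k + f k>]. *)
Lemma odd_trace_formula :
  trace_on [set x | g x = x /\ C x = x] T - trace_on [set x | g x = - x /\ C x = x] T =
  (-1) ^+ n / 2 * trace (g ⋅ T ⋅ F ⋅ bop_exp (commutator F P) n.*2.+1).
Proof.
have [mu [e [f]]] := schatten_singular_values Psch.
have FFs : star F ⋅ F = cone by rewrite Fs.
move/(singular_values_isometry FFs).
have -> : F ⋅ commutator F P = C by rewrite -FC cmulA FF cmul1l.
move: (fun k => F (f k)) => {}f Csv.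
have [mu0 muc ee ff CE] := Csv.
have [J1 J1u J1E] := level_set_ex muc ltr01.
have r0 : (0 < n.*2.+1)%N by [].
have [K K0 TK] := bop_bound T; have [K' K'0 gK] := bop_bound g.
have e1 k := norm_e_le1 Csv k; have f1 k := norm_f_le1 Csv k.
have Ce k := singular_e Csv k.
have nu0 k : 0 <= mu k ^+ n.*2.+1 by rewrite exprn_ge0.
have AE x := @bop_exp_series _ _ _ _ _ _ _ Cs Csv n x.
have bnd (S : bop H) (M : R) : 0 <= M -> (forall x, `|S x| <= M%:C * `|x|) ->
    forall k, `|(mu k ^+ n.*2.+1)%:C * inner (S (f k)) (e k)| <= (M * mu k ^+ n.*2.+1)%:C.
  move=> M0 SM k; rewrite normrM [X in X * _]ger0_norm ?ler0c // mulrC realCM.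
  rewrite ler_wpM2r ?ler0c //; apply: le_trans (Defs.CauchySchwarz _ _) _.
  apply: le_trans (ler_pM _ _ (SM _) (e1 k)) _ => //; rewrite mulr1.
  by rewrite -[leRHS]mulr1 ler_wpM2l // ler0c.
have Wsqr k : W (W (e k)) = (1 - mu k ^+ 2)%:C *: e k.
  rewrite -bop_cmulE WW bopBE bop_coneE bop_cmulE (singular_sqr Cs Csv).
  by rewrite rmorphB scalerBl scale1r.
have WCC : W ⋅ (C ⋅ C) = C ⋅ C ⋅ W.
  by rewrite cmulA WC cmulNl -cmulA WC cmulNr opprK cmulA.
have FCC : F ⋅ (C ⋅ C) = C ⋅ C ⋅ F.
  by rewrite -[RHS]cmulA CF cmulNr [C ⋅ (F ⋅ C)]cmulA CF cmulNl opprK cmulA.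
have tr : trace (g ⋅ T ⋅ F ⋅ bop_exp (commutator F P) n.*2.+1) =
    (-1) ^+ n * \sum_(k <- J1) inner (g (T (f k))) (e k).
  pose S := (-1) ^+ n *: (g ⋅ T).
  rewrite -cmulA bop_exp_odd cmulZr -cmulZl -/S /trace.
  rewrite (_ : setT = [set x | (cone : bop H) x = x]); last first.
    by apply/seteqP; split.
  have SE y : S y = (-1) ^+ n *: g (T y) by rewrite bopZE.
  have SK x : `|S x| <= (K' * K)%:C * `|x|.
    rewrite SE normrZ normrX normrN1 expr1n mul1r; apply: le_trans (gK _) _.
    by rewrite realCM -mulrA ler_wpM2l ?ler0c.
  have := @trace_on_series R H cone (star1 _) (cmul1l cone) (fun k => mu k ^+ n.*2.+1) e f
    (bop_exp C n.*2.+1) S _ nu0 muc e1 f1 AE.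
  apply.
  rewrite (_ : _ * _ = \sum_(k <- J1) (mu k ^+ n.*2.+1)%:C * inner (S (f k)) (e k)).
    apply: (@cvg_level_cancel _ _ _ mu0 r0 muc _ (K' * K)) => //.
    - by rewrite mulr_ge0.
    - by apply: bnd => //; rewrite mulr_ge0.
    move=> J Jc.
    (* [W (W (e k))] brings in a factor [1 - mu k ^+ 2], which [h] divides out; the value [0] at
       [mu k = 1] matches the terms excluded from the sum. *)
    pose h k : R[i] := if mu k == 1 then 0 else (mu k ^+ n.*2 / (1 - mu k ^+ 2))%:C.
    rewrite -[RHS](@level_trace_eq0 _ _ _ _ _ _ _ Cs Csv J W (S ⋅ C) h
      (fun k => (1 - mu k ^+ 2)%:C)) //.
    - rewrite big_mkcond; apply: eq_bigr => k _; rewrite /h.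
      case: eqVneq => [_|k1]; first by rewrite !mul0r.
      have k2 : 1 - mu k ^+ 2 != 0.
        rewrite subr_eq0 eq_sym -subr_eq0 subr_sqr_1 mulf_neq0 ?subr_eq0 //.
        by rewrite gt_eqF // ltr_wpDl.
      rewrite -realCM divfK // bop_cmulE Ce bopZ innerZl mulrA -realCM.
      by rewrite -exprSr.
    - rewrite /S !cmulZl cmulZr -scalerN; congr (_ *: _).
      rewrite -[LHS]cmulA -[C ⋅ W]opprK -WC cmulNr; congr (- _).
      by rewrite !cmulA -Wg -[g ⋅ W ⋅ T]cmulA -WT !cmulA.
    - by move=> j k jk; rewrite /h jk.
  rewrite mulr_sumr; apply: eq_big_seq => k; rewrite J1E => /eqP ->.
  by rewrite expr1n mul1r SE innerZl.
pose Pi s := 2^-1 *: (cone + s) ⋅ eigenproj C e J1.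
have trV s : star s = s -> s ⋅ s = cone -> s ⋅ C = C ⋅ s ->
    trace_on [set x | s x = x /\ C x = x] T =
    \sum_(k <- J1) inner (T (f k)) (2^-1 *: (eigenproj C e J1 (e k) + s (eigenproj C e J1 (e k)))).
  move=> ss s1 sC.
  have Ep := eigenproj_projector Cs Csv J1u J1E; have sp := symmetry_projector ss s1.
  have cp : 2^-1 *: (cone + s) ⋅ eigenproj C e J1 = eigenproj C e J1 ⋅ (2^-1 *: (cone + s)).
    have := eigenproj_commute Cs Csv J1u J1E ss sC; move: (eigenproj C e J1) => E1 sE1.
    by rewrite cmulZl cmulZr cmulDl cmulDr cmul1l cmul1r sE1.
  have [Pis PiPi] := projector_mul sp Ep cp.
  have VE : [set x | s x = x /\ C x = x] = [set x | Pi s x = x].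
    apply/seteqP; split=> x /=.
      move=> [sx Cx]; apply/(projector_mul_fixed x sp Ep cp); split.
        exact/symmetry_projector_fixed.
      exact/(eigenproj_fixed Cs Csv J1u J1E).
    move/(projector_mul_fixed x sp Ep cp) => [/symmetry_projector_fixed sx].
    by move/(eigenproj_fixed Cs Csv J1u J1E).
  have PiE k : Pi s (e k) = 2^-1 *: (eigenproj C e J1 (e k) + s (eigenproj C e J1 (e k))).
    by rewrite /Pi cmulZl bopZE bop_cmulE bopDE.
  have PiC x y : inner (Pi s x) y = inner x (Pi s y) by rewrite bop_starP Pis.
  (* On [C x = x] the factor [C^(2n+1)] is the identity; inserting it gives the operator a
     convergent singular series. *)
  transitivity (trace_on [set x | s x = x /\ C x = x] (T ⋅ bop_exp C n.*2.+1)).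
    apply: trace_on_eq => x [_ Cx]; rewrite bop_cmulE; congr (T _).
    elim: (n.*2.+1) => [|m IHm]; first by rewrite /bop_exp big_ord0.
    by rewrite bop_expS bop_cmulE -IHm Cx.
  rewrite VE; have := @trace_on_series R H (Pi s) Pis PiPi (fun k => mu k ^+ n.*2.+1) e f
    (bop_exp C n.*2.+1) T _ nu0 muc e1 f1 AE.
  apply.
  rewrite (_ : \sum_(k <- J1) _ =
    \sum_(k <- J1) (mu k ^+ n.*2.+1)%:C * inner ((Pi s ⋅ T) (f k)) (e k)).
    apply: (@cvg_level_cancel _ _ _ mu0 r0 muc _ K) => //.
      apply: (bnd (Pi s ⋅ T) K) => // x; rewrite bop_cmulE.
      by apply: le_trans (norm_projection Pis PiPi _) _; exact: TK.
    move=> J _; apply: big1 => k k1.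
    by rewrite bop_cmulE PiC PiE (eigenproj_e Csv J1u J1E k1) bop0 addr0 scaler0 inner0r mulr0.
  apply: eq_big_seq => k; rewrite J1E => /eqP ->.
  by rewrite expr1n mul1r bop_cmulE PiC PiE.
have sg : (-1) ^+ n * (-1) ^+ n = 1 :> R[i] by rewrite -expr2 sqrr_sign.
rewrite tr mulrA [_ / 2 * _]mulrAC sg mul1r.
rewrite (trV g) // (_ : [set x | g x = - x /\ _] = [set x | (- g) x = x /\ C x = x]); last first.
  apply/seteqP; split=> x [gx Cx]; split=> //; first by rewrite bopNE gx opprK.
  by move: gx; rewrite bopNE => gx; rewrite -[in RHS]gx opprK.
rewrite (trV (- g)); first last.
- by rewrite cmulNl cmulNr Cg.
- by rewrite cmulNl cmulNr opprK.
- by rewrite starN gs.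
have gC x y : inner (g x) y = inner x (g y) by rewrite bop_starP gs.
have J1c : level_closed mu J1.
  split=> // [j|j k]; rewrite !J1E => /eqP j1; first by rewrite j1 oner_eq0.
  by move=> ->; rewrite j1.
(* Here [F] plays the role of [W], with [F ⋅ F = 1]. On these levels [f k = C (e k)], and [C]
   commutes with [g] and [T], which turns each [f k] into [e k]. *)
have gT0 : \sum_(k <- J1) inner (g (T (f k))) (f k) = 0.
  rewrite -[RHS](@level_trace_eq0 _ _ _ _ _ _ _ Cs Csv J1 F (g ⋅ T) (fun=> 1) (fun=> 1)) //.
  - apply: eq_big_seq => k; rewrite J1E => /eqP k1; rewrite !mul1r bop_cmulE.
    have fk : f k = C (e k) by rewrite Ce k1 scale1r.
    have CC x y : inner (C x) y = inner x (C y) by rewrite bop_starP Cs.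
    rewrite fk -CC (_ : C (g (T (C (e k)))) = g (T (C (C (e k))))).
      by rewrite (singular_sqr Cs Csv) k1 expr1n scale1r.
    have Cgx y : C (g y) = g (C y) by rewrite -bop_cmulE -Cg.
    have CTx y : C (T y) = T (C y) by rewrite -bop_cmulE -CT.
    by rewrite Cgx CTx.
  - by move=> k _; rewrite -bop_cmulE FF bop_coneE scale1r.
  - by rewrite -cmulA TF cmulA cmulA Fg cmulNl opprK.
transitivity (2^-1 * (\sum_(k <- J1) inner (g (T (f k))) (e k) +
    \sum_(k <- J1) inner (g (T (f k))) (f k))); last by rewrite gT0 addr0.
rewrite -sumrB -big_split mulr_sumr.
apply: eq_big_seq => k; rewrite J1E => /eqP k1.
rewrite -innerBr -scalerBr opprD addrACA subrr add0r bopNE opprK scale_half_double.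
rewrite (eigenproj_e1 Csv J1u J1E k1) Ce k1 scale1r -gC innerZr innerDr.
by rewrite fmorphV rmorph_nat.
Qed.

End OddOperator.

(** * Kernel and cokernel of the index operator *)

Section IndexSpaces.
Variables (R : realType) (G : compact_quantum_group R) (phi : G -> R[i]).
Variables (B : cstarAlgType R) (alpha : coaction G B) (H : hilbertType R).
Variables (M : fredholm_module phi alpha H) (p : B).
Hypotheses (pr : regular_part phi alpha p) (pP : is_projection p).

Local Notation F := (fop M).
Local Notation g := (fgrading M).
Local Notation P := (frep M p).
Local Notation C := (P - F ⋅ P ⋅ F).

Lemma frep_projection : star P = P /\ P ⋅ P = P.
Proof. by case: pP => ps pp; rewrite -(frep_star M pr) -(frepM M pr pr) ps pp. Qed.

Let PC x y : inner (P x) y = inner x (P y).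
Proof. by rewrite bop_starP frep_projection.1. Qed.
Let FC x y : inner (F x) y = inner x (F y).
Proof. by rewrite bop_starP fop_star. Qed.
Let PPx x : P (P x) = P x.
Proof. by rewrite -bop_cmulE frep_projection.2. Qed.
Let gP x : g (P x) = P (g x).
Proof. by rewrite -!bop_cmulE (frep_even M pr). Qed.
Let gF x : g (F x) = - F (g x).
Proof. by rewrite -[F (g x)]bop_cmulE fop_odd bopNE opprK. Qed.

Let p_plusE x : p_plus M p x = 2^-1 *: (P x + g (P x)).
Proof. by rewrite bopZE bop_cmulE bopDE. Qed.
Let p_minusE x : p_minus M p x = 2^-1 *: (P x - g (P x)).
Proof. by rewrite bopZE bop_cmulE bopBE. Qed.

(** If [C x = x], then [|x|^2 = |P x|^2 - |P F x|^2], and [P] is a contraction, so [P F x = 0]. *)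
Let C_fixed x : C x = x <-> P x = x /\ P (F x) = 0.
Proof.
have CE : C x = P x - F (P (F x)) by rewrite bopBE !bop_cmulE.
rewrite CE; split=> [Cx|[-> ->]]; last by rewrite bop0 subr0.
suff z : P (F x) = 0 by split=> //; move: Cx; rewrite z bop0 subr0.
apply: inner_eq0; apply/eqP; rewrite eq_le inner_ge0 andbT.
have h : inner x x = inner (P x) (P x) - inner (P (F x)) (P (F x)).
  have a : inner (P x) x = inner (P x) (P x) by rewrite -{1}PPx PC.
  have b : inner (F (P (F x))) x = inner (P (F x)) (P (F x)).
    by rewrite FC -{1}[P (F x)]PPx PC.
  by rewrite -{1}Cx innerBl a b.
have := norm_projection frep_projection.1 frep_projection.2 x.
by rewrite -(@ler_pXn2r _ 2) ?nnegrE // !norm_inner h lerBrDr gerDl.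
Qed.

Let p_plus_image : p_plus M p @` H_plus M = [set x | g x = x /\ P x = x].
Proof.
have e y : g y = y -> p_plus M p y = P y.
  by move=> gy; rewrite p_plusE gP gy scale_half_double.
apply/seteqP; split=> [_ [y gy <-]|x [gx Px]].
  by rewrite (e _ gy); split; [rewrite gP gy|exact: PPx].
by exists x => //; rewrite e.
Qed.

Let p_minus_image : p_minus M p @` H_minus M = [set x | g x = - x /\ P x = x].
Proof.
have e y : g y = - y -> p_minus M p y = P y.
  by move=> gy; rewrite p_minusE gP gy bopN opprK scale_half_double.
apply/seteqP; split=> [_ [y gy <-]|x [gx Px]].
  by rewrite (e _ gy); split; [rewrite gP gy bopN|exact: PPx].
by exists x => //; rewrite e.
Qed.

Let index_opE x : g x = x -> P x = x -> index_op M p x = P (F x).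
Proof.
move=> gx Px; rewrite !bop_cmulE p_plusE Px gx scale_half_double p_minusE.
by rewrite gP gF gx bopN opprK scale_half_double.
Qed.

Lemma index_kerE : index_ker M p = [set x | g x = x /\ C x = x].
Proof.
rewrite /index_ker p_plus_image; apply/seteqP; split=> x.
  by move=> [[gx Px]]; rewrite index_opE // => PF; split=> //; exact/C_fixed.
by move=> [gx /C_fixed[Px PF]]; split=> //; rewrite index_opE.
Qed.

Lemma index_cokerE : index_coker M p = [set x | g x = - x /\ C x = x].
Proof.
rewrite /index_coker p_plus_image p_minus_image; apply/seteqP; split=> y.
  move=> [[gy Py] yP]; split=> //; apply/C_fixed; split=> //.
  (* Test vector [P (F y)]: it lies in [p_+ H_+] because [F] is odd, and its pairing is the squared
     norm of [P (F y)]. *)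
  apply: inner_eq0; have h : g (P (F y)) = P (F y) by rewrite gP gF gy !bopN opprK.
  have := yP _ (conj h (PPx _)); rewrite index_opE //.
  by rewrite -PC Py -FC -{1}[P (F y)]PPx -PC.
move=> [gy /C_fixed[Py PF]]; split=> // x [gx Px].
by rewrite index_opE // -PC Py -FC -Px -PC PF inner0l.
Qed.

End IndexSpaces.

Theorem theorem3p1 (R : realType)
    (G : compact_quantum_group R) (phi : G -> R[i])
    (B : cstarAlgType R) (alpha : coaction G B)
    (H : hilbertType R) (M : fredholm_module phi alpha H)
    (piU : (G -> R[i]) -> bop H) (n : nat) (p : B) (w : G -> R[i]) :
  haar_state phi -> faithful phi ->
  nondegenerate_coaction alpha ->
  associated_rep M piU ->
  summable_module M n.*2.+1 ->
  regular_part phi alpha p -> invariant_elt phi alpha p -> is_projection p ->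
  dual_algebra phi w ->
  Ind_F M piU p w = pairing (phi_F M piU n) p w.
Proof.
move=> phiH phiF _ piUP Msum pr pinv pP wd.
have [Ps PP] := frep_projection M pr pP.
have TU X := mult_slice_commute (piUP w wd) (X := X).
have TP : piU w ⋅ frep M p = frep M p ⋅ piU w.
  (* For the one-term list [1 (x) p], equivariance says that [U] commutes with [1 (x) pi(p)]. *)
  apply: TU; have := @fequiv _ _ _ _ _ _ M p [:: (cone, p)] pr.
  rewrite /tens_sum !big_seq1 /=; apply.
    by move=> u /[!inE] /eqP ->.
  exact: (invariant_coact phiH phiF pr pinv).
rewrite /Ind_F index_kerE // index_cokerE //.
exact: (odd_trace_formula (fop_star M) (fop_sqr M) (fgrading_star M) (fgrading_sqr M)
  (fop_odd M) Ps PP (frep_even M pr) (TU _ (@fcorep_op _ _ _ _ _ _ M)) TP (Msum p pr)).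
Qed.
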